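(* Let $g$ be a non-zero integer and let $E/\mathbb{Q}$ be the elliptic curve $y^2=x^3+g$ (with CM by $\mathbb{Q}(\sqrt{-3})$). Assume the Hardy--Littlewood conjecture (HL). Then there are only finitely many anomalous primes for $E$ if and only if $g$ has one of the forms $$n^2,\quad -3n^2,\quad n^3,\quad 80n^6,\quad -2160n^6,\quad -268912n^6,\quad 7260624n^6$$ for some integer $n$.
   Context: For $E/\mathbb{Q}$ of conductor $N_E$ and $p\nmid N_E$, $a_p(E)=p+1-|E_p(\mathbb{F}_p)|$. A prime $p\nmid N_E$ is anomalous for $E$ if $a_p(E)=1$. (HL): for all $a,b,c\in\mathbb{Z}$ with $a>0$, $b^2-4ac$ not a square, $\gcd(a,b,c)=1$, and $a+b$, $c$ not both even, the number $\pi_{a,b,c}(x)$ of primes $p\leqslant x$ of the form $am^2+bm+c$, $m\in\mathbb{Z}_{\geqslant1}$, satisfies $\pi_{a,b,c}(x)\sim\frac{\gcd(2,a+b)}{\sqrt a}\frac{\Delta}{\varphi(\Delta)}\prod_{p\nmid2a}\Big(1-\frac{(\frac{b^2-4ac}{p})}{p-1}\Big)\frac{\sqrt x}{\log x}$, $\Delta$ being the odd part of $\gcd(a,b)$ and the product over primes taken in increasing order. *)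

(* Defs.v *)
From HB Require Import structures.
From mathcomp Require Import all_boot all_order all_algebra.
From mathcomp Require Import all_classical all_reals all_analysis.
Import Order.TTheory GRing.Theory Num.Theory.
Import numFieldNormedType.Exports.

Set Implicit Arguments.
Unset Strict Implicit.
Unset Printing Implicit Defensive.

Local Open Scope ring_scope.
Local Open Scope classical_set_scope.

(** * Weierstrass equations *)

(* y^2 + a1 x y + a3 y = x^3 + a2 x^2 + a4 x + a6 *)
Record weierstrass (R : Type) := Weierstrass {
  wa1 : R; wa2 : R; wa3 : R; wa4 : R; wa6 : R }.

Definition map_weierstrass (R S : Type) (f : R -> S) (W : weierstrass R) :
    weierstrass S :=
  Weierstrass (f (wa1 W)) (f (wa2 W)) (f (wa3 W)) (f (wa4 W)) (f (wa6 W)).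

Definition wdisc (R : comNzRingType) (W : weierstrass R) : R :=
  let: Weierstrass a1 a2 a3 a4 a6 := W in
  let b2 := a1 ^+ 2 + 4 * a2 in
  let b4 := 2 * a4 + a1 * a3 in
  let b6 := a3 ^+ 2 + 4 * a6 in
  let b8 := a1 ^+ 2 * a6 + 4 * a2 * a6 - a1 * a3 * a4 + a2 * a3 ^+ 2
            - a4 ^+ 2 in
  - (b2 ^+ 2 * b8) - 8 * b4 ^+ 3 - 27 * b6 ^+ 2 + 9 * b2 * b4 * b6.

(* W' is obtained from W by the substitution
   x = u^2 x' + r,  y = u^3 y' + u^2 s x' + t  with u <> 0;
   these are the isomorphisms over F between Weierstrass equations. *)
Definition wisomorphic (F : fieldType) (W W' : weierstrass F) : Prop :=
  let: Weierstrass a1 a2 a3 a4 a6 := W in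
  let: Weierstrass a1' a2' a3' a4' a6' := W' in
  exists u r s t : F,
    u != 0 /\
    u * a1' = a1 + 2 * s /\
    u ^+ 2 * a2' = a2 - s * a1 + 3 * r - s ^+ 2 /\
    u ^+ 3 * a3' = a3 + r * a1 + 2 * t /\
    u ^+ 4 * a4' = a4 - s * a3 + 2 * r * a2 - (t + r * s) * a1
                   + 3 * r ^+ 2 - 2 * s * t /\
    u ^+ 6 * a6' = a6 + r * a4 + r ^+ 2 * a2 + r ^+ 3 - t * a3 - t ^+ 2
                   - r * t * a1.

(* The number of points over a finite field, including the point at infinity *)
Definition wcard (F : finFieldType) (W : weierstrass F) : nat :=
  #|[set P : F * F |
      P.2 ^+ 2 + wa1 W * P.1 * P.2 + wa3 W * P.2
      == P.1 ^+ 3 + wa2 W * P.1 ^+ 2 + wa4 W * P.1 + wa6 W]%SET|.+1.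

Definition wreduction (p : nat) (W : weierstrass int) : weierstrass 'F_p :=
  map_weierstrass (fun z : int => z%:~R) W.

(* W is an integral equation for E whose reduction modulo p is nonsingular;
   in particular it is minimal at p.  The conductor N_E is by definition
   supported exactly on the primes of bad reduction, so such a W exists
   precisely when p does not divide N_E, and then wreduction p W is a model
   of E_p; its isomorphism class does not depend on W. *)
Definition good_model (E : weierstrass rat) (p : nat) (W : weierstrass int) :
    Prop :=
  wisomorphic E (map_weierstrass (fun z : int => z%:~R) W) /\
  ~~ (p%:Z %| wdisc W)%Z.

Definition trace_of_Frobenius (p : nat) (W : weierstrass int) : int :=
  p%:Z + 1 - (wcard (wreduction p W))%:Z.

Definition anomalous (E : weierstrass rat) (p : nat) : Prop :=
  prime p /\
  exists W : weierstrass int,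
    good_model E p W /\ trace_of_Frobenius p W = 1.

(* y^2 = x^3 + g *)
Definition mordell (g : int) : weierstrass rat :=
  Weierstrass 0 0 0 0 g%:~R.

(** * The Hardy--Littlewood conjecture *)

(* Legendre symbol (d / p), for p an odd prime *)
Definition legendre (d : int) (p : nat) : int :=
  if (d%:~R : 'F_p) == 0 then 0
  else if [exists y : 'F_p, y ^+ 2 == d%:~R] then 1 else -1.

(* The number of primes p <= x of the form a m^2 + b m + c, m >= 1 (for
   x >= 0; Num.truncn is the integral part) *)
Definition quad_prime_count (R : realType) (a b c : int) (x : R) : nat :=
  \sum_(0 <= p < (Num.truncn x).+1 |
        prime p && `[< exists m : nat, (0 < m)%N /\
                         p%:Z = a * m%:Z ^+ 2 + b * m%:Z + c >]) 1.

(* The product may converge only conditionally: it is the limit of the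
   products over the primes below n. *)
Definition HL_product (R : realType) (a b c : int) : R :=
  limn (fun n : nat =>
    \prod_(0 <= p < n | prime p && ~~ (p%:Z %| 2 * a)%Z)
      (1 - (legendre (b ^+ 2 - 4 * a * c) p)%:~R / (p%:R - 1)) : R).

Definition HL_constant (R : realType) (a b c : int) : R :=
  let Delta := ((gcdn `|a| `|b|)`_2^')%N in
  (gcdz 2 (a + b))%:~R / Num.sqrt a%:~R
  * (Delta%:R / (totient Delta)%:R) * HL_product R a b c.

Definition Hardy_Littlewood (R : realType) : Prop :=
  forall a b c : int,
    0 < a ->
    ~ (exists n : int, b ^+ 2 - 4 * a * c = n ^+ 2) ->
    gcdz a (gcdz b c) = 1 ->
    ~ ((2 %| a + b)%Z /\ (2 %| c)%Z) ->
    (quad_prime_count a b c x)%:R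
      / (HL_constant R a b c * (Num.sqrt x / ln x)) @[x --> +oo%R] --> (1 : R).

(* Main.v *)
Require Import Defs.
From HB Require Import structures.
From mathcomp Require Import all_boot all_order all_algebra all_solvable all_field.
From mathcomp Require Import all_classical all_reals all_analysis.
From mathcomp Require Import zify ring lra.
Import Order.TTheory GRing.Theory Num.Theory.
Import numFieldNormedType.Exports.

(** Put [S(g) = sum_x ((x^3+g)/p)], so that [a_p = - S(g)].  If [a_p = 1] then
    [p = 3k^2+3k+1], and [r = 3k+1] is a primitive cube root of unity modulo [p].
    The first two moments of [S], its value modulo [p] (power sums) and a count
    modulo 9 determine all values of [S]: [p] is anomalous if and only if [g] is a
    quadratic nonresidue and [g^((p-1)/3)] is [r] for odd [k] and [r^2] for even [k].

    The same values give the Jacobi sum [J] of the cubic character sending [r] to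
    [w], namely [w^(k+2) J = (k+1) + (2k+1) w].  Gauss sums computed in a field of
    characteristic [q] then yield reciprocity: if
    [z = ((k+1) + (2k+1) w) / ((k+1) + (2k+1) w^2)] and [N] is [q-1] or [q+1],
    whichever is divisible by 3, then [z^N = 1], the quadratic symbol of [q* = +-q]
    is [z^(N/2)], and the cubic symbol of [q] is [w^(k+2) z] to the power [+-N/3].
    When [k] runs over the residues modulo [q], [z] takes every value in the group
    of [N]-th roots of unity except [-1].  Hence every pair of symbols occurs for
    [q >= 11], but for [q = 5, 7], where [N = 6], the pair (nonresidue, trivial
    cubic class) is missed.  The symbols of -1, 2 and 3 depend on [k] modulo 72.

    By the Chinese remainder theorem, unless [g] is a square, -3 times a square, a
    cube, or one of the combinations of 2, -3 and 5 or 7 that require exactly the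
    missed pair, all large primes [3k^2+3k+1] with [k] in a suitable progression
    [Mm + k0] are anomalous; the Hardy-Littlewood conjecture for the polynomial
    [3(Mm+k0)^2 + 3(Mm+k0) + 1] makes them infinitely many. *)

Set Implicit Arguments.
Unset Strict Implicit.
Unset Printing Implicit Defensive.

Local Open Scope ring_scope.

(** * Powers in finite fields *)

(** The three traces attached to the cubic classes have sum 0 and sum of squares 6p. A value 1 or -1
    forces 4p = 1 + 3m^2 with m odd; conversely, for such p, the essential uniqueness of X^2 + 3Y^2
    = 4p and a parity fix the triple up to sign and order. The congruence modulo p settles the
    order, the count modulo 9 the sign and the cubic symbol of 4.

    These values are rational integers, so the Jacobi sum can be evaluated in any field containing
    w, and Frobenius in characteristic q replaces congruences in Z[w].

    Writing z as a power of a generator, the exponent modulo 2 gives the quadratic symbol and modulo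
    3 the cubic one. If N > 6, the unattainable -1 can be traded for another element with the same
    symbols; if N = 6, it cannot.

    The constants are 80 = 2^4 5, -2160 = 2^4 (-3)^3 5, -268912 = 2^4 (-7)^5 and 7260624 = 2^4
    (-3)^3 (-7)^5. The square 2^4 carries the required cubic class up to a term in k, which the
    exponents 1 of 5 and 5 of -7 cancel; what is then demanded of 5 or -7 is the missed pair. *)

Section FiniteField.
Variable F : finFieldType.

Lemma card_finField_gt0 : (0 < #|F|.-1)%N.
Proof. by rewrite -ltnS prednK ?finNzRing_gt1 // ltnW ?finNzRing_gt1. Qed.

Lemma expf_card_pred (x : F) : x != 0 -> x ^+ #|F|.-1 = 1.
Proof.
move=> x0; apply: (mulfI x0); rewrite -exprS mulr1 prednK ?expf_card //.
exact: ltnW (finNzRing_gt1 F).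
Qed.

Lemma finField_prim_root : exists z : F, (#|F|.-1).-primitive_root z.
Proof.
pose rs := [seq x <- enum F | x != 0].
have urs : uniq rs by rewrite filter_uniq ?enum_uniq.
have srs : (#|F|.-1 <= size rs)%N.
  have : size rs = #|F|.-1.
    rewrite size_filter -(cardC1 (0 : F)) cardE /enum_mem size_filter.
    by rewrite /rs /enum_mem count_filter; apply: eq_count => x /=; rewrite andbT.
  by move=> ->.
have ars : all (#|F|.-1).-unity_root rs.
  apply/allP => x; rewrite mem_filter => /andP[x0 _].
  by rewrite unity_rootE expf_card_pred.
by have /hasP[z _ zP] := has_prim_root card_finField_gt0 ars urs srs; exists z.
Qed.

Section Powers.
Variables d m : nat.
Hypothesis dm : #|F|.-1 = (d * m)%N.

Let d_gt0 : (0 < d)%N.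
Proof. by have := card_finField_gt0; rewrite dm; case: d. Qed.

Let m_gt0 : (0 < m)%N.
Proof. by have := card_finField_gt0; rewrite dm; case: m; rewrite ?muln0. Qed.

Lemma expf_eq1_root (x : F) : x ^+ m = 1 -> exists y : F, y ^+ d = x.
Proof.
move=> xm; have [z zP] := finField_prim_root.
have [|[i /= _] xE] := prim_rootP zP (x := x).
  by rewrite dm mulnC exprM xm expr1n.
move: xm; rewrite xE -exprM => /eqP; rewrite -(prim_order_dvd zP) dm.
rewrite dvdn_pmul2r // => /dvdnP[j iE].
by exists (z ^+ j); rewrite -exprM -iE.
Qed.

Lemma expf_root_eq1 (y : F) : y != 0 -> (y ^+ d) ^+ m = 1.
Proof. by move=> y0; rewrite -exprM -dm expf_card_pred. Qed.

Lemma card_expf_eq (y : F) : y != 0 -> #|[pred v : F | v ^+ d == y ^+ d]| = d.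
Proof.
move=> y0; have [z zP] := finField_prim_root.
have zd : d.-primitive_root (z ^+ m).
  have -> : m = (#|F|.-1 %/ d)%N by rewrite dm mulKn.
  by apply: (dvdn_prim_root zP); rewrite dm dvdn_mulr.
pose h (i : 'I_d) := y * (z ^+ m) ^+ i.
have inj : injective h.
  move=> i j /(mulfI y0) /eqP; rewrite (eq_prim_root_expr zd) !modn_small //.
  by move=> /eqP /val_inj.
transitivity #|codom h|; last by rewrite card_codom ?card_ord.
apply: eq_card => v.
rewrite inE; apply/eqP/codomP => [vd|[i ->]].
  have [|i vE] := prim_rootP zd (x := v / y).
    by rewrite expr_div_n vd divff // expf_neq0.
  by exists i; rewrite /h -vE mulrC divfK.
by rewrite /h exprMn -(exprM (z ^+ m)) mulnC exprM (prim_expr_order zd) expr1n mulr1.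
Qed.

Lemma sum_expf (V : zmodType) (f : F -> V) :
  \sum_(v : F | v != 0) f (v ^+ d) = (\sum_(u : F | u ^+ m == 1) f u) *+ d.
Proof.
rewrite (partition_big (fun v : F => v ^+ d) (fun u => u ^+ m == 1)) /=; last first.
  by move=> v v0; rewrite expf_root_eq1.
rewrite -sumrMnl; apply: eq_bigr => u /eqP um.
have [y yE] := expf_eq1_root um.
have y0 : y != 0.
  apply/eqP => y0; move: um; rewrite -yE y0 expr0n.
  by rewrite (gtn_eqF d_gt0) expr0n (gtn_eqF m_gt0) => /esym/eqP; rewrite oner_eq0.
rewrite (eq_bigr (fun _ => f u)) => [|v /andP[_ /eqP->] //].
rewrite -[in RHS](card_expf_eq y0) -sumr_const; apply: eq_bigl => v.
rewrite unfold_in /= yE; case: (eqVneq v 0) => //= v0.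
by rewrite v0 expr0n gtn_eqF //= -yE eq_sym expf_eq0 (negPf y0) andbF.
Qed.

End Powers.

Lemma sumr_neq0 (V : zmodType) (f : F -> V) :
  \sum_(x : F | x != 0) f x = \sum_(x : F) f x - f 0.
Proof. by rewrite [in RHS](bigD1 0) //= addrAC subrr add0r. Qed.

Lemma sum_mulf (V : zmodType) (f : F -> V) (a : F) :
  a != 0 -> \sum_(x : F) f (a * x) = \sum_(x : F) f x.
Proof.
move=> a0; rewrite [RHS](reindex (fun x => a * x)) //=.
by exists (fun x => a^-1 * x) => x _; rewrite ?mulKf ?mulVKf.
Qed.

Lemma sum_mulf_neq0 (V : zmodType) (f : F -> V) (a : F) :
  a != 0 -> \sum_(x : F | x != 0) f (a * x) = \sum_(x : F | x != 0) f x.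
Proof. by move=> a0; rewrite !sumr_neq0 sum_mulf // mulr0. Qed.

Lemma sum_addf (V : zmodType) (f : F -> V) (a : F) :
  \sum_(x : F) f (x + a) = \sum_(x : F) f x.
Proof.
rewrite [RHS](reindex (fun x => x + a)) //=.
by exists (fun x => x - a) => x _; rewrite ?addrK ?subrK.
Qed.

(** Scaling [x] by a generator multiplies the sum by a factor other than 1. *)
Lemma sum_expr (j : nat) :
  (0 < j)%N -> ~~ (#|F|.-1 %| j)%N -> \sum_(x : F) x ^+ j = 0.
Proof.
move=> j0 jn; have [z zP] := finField_prim_root.
have z0 : z != 0.
  apply/eqP => z0; move: (prim_expr_order zP); rewrite z0 expr0n.
  by rewrite gtn_eqF ?card_finField_gt0 // => /esym/eqP; rewrite oner_eq0.
have := sum_mulf (fun x => x ^+ j) z0.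
rewrite (eq_bigr (fun x => z ^+ j * x ^+ j)) => [|x _]; last by rewrite exprMn.
rewrite -mulr_sumr => /eqP; rewrite -subr_eq0 -{2}[\sum_x _]mul1r -mulrBl mulf_eq0.
by rewrite subr_eq0 -(prim_order_dvd zP) (negPf jn) => /eqP.
Qed.

Lemma sum_expr_card_pred : \sum_(x : F) x ^+ #|F|.-1 = -1.
Proof.
have -> : \sum_(x : F) x ^+ #|F|.-1 = \sum_(x : F | x != 0) 1.
  rewrite [LHS](bigD1 0) //= expr0n (gtn_eqF card_finField_gt0) add0r.
  by apply: eq_bigr => x; exact: expf_card_pred.
rewrite sumr_neq0; suff -> : \sum_(x : F) 1 = 0 :> F by rewrite sub0r.
have := sum_addf (fun x => x) (1 : F).
by rewrite big_split /= => /eqP; rewrite -subr_eq0 addrAC subrr add0r => /eqP.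
Qed.

End FiniteField.

(** * The quadratic character *)

(** Euler's criterion as a definition; with integer values the same sums can be read in Z, modulo
    [p], and in any coefficient field. *)
Definition qchar (F : finFieldType) (x : F) : int :=
  if x == 0 then 0 else if x ^+ (#|F|.-1)./2 == 1 then 1 else -1.

Section QuadraticCharacter.
Variables (F : finFieldType) (m : nat).
Hypothesis Fm : #|F|.-1 = (2 * m)%N.

Let m_gt0 : (0 < m)%N.
Proof. by have := card_finField_gt0 F; rewrite Fm; case: m; rewrite ?muln0. Qed.

Lemma half_card : (#|F|.-1)./2 = m.
Proof. by rewrite Fm mul2n doubleK. Qed.

Lemma expf_half (x : F) : x != 0 -> (x ^+ m == 1) || (x ^+ m == -1).
Proof.
by move=> x0; rewrite -sqrf_eq1 -exprM mulnC -Fm expf_card_pred.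
Qed.

Lemma exists_nonresidue : exists2 z : F, z != 0 & z ^+ m = -1 /\ 1 != -1 :> F.
Proof.
have [z zP] := finField_prim_root F.
have z0 : z != 0.
  apply/eqP => z0; move: (prim_expr_order zP); rewrite z0 expr0n.
  by rewrite gtn_eqF ?card_finField_gt0 // => /esym/eqP; rewrite oner_eq0.
have zm : z ^+ m != 1.
  by rewrite -(prim_order_dvd zP) Fm gtnNdvd // mul2n -addnn -{1}[m]addn0 ltn_add2l.
exists z => //; have := expf_half z0; rewrite (negPf zm) /= => /eqP <-.
by rewrite eq_sym.
Qed.

Lemma finField_neq1N1 : (1 == -1 :> F) = false.
Proof. by have [z _ [_ /negPf]] := exists_nonresidue. Qed.

Lemma finField_N1neq1 : (-1 == 1 :> F) = false.
Proof. by rewrite eq_sym finField_neq1N1. Qed.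

Lemma finField_two_neq0 : 2 != 0 :> F.
Proof. by rewrite -[2]/(1 + 1 : F) addr_eq0 finField_neq1N1. Qed.

Lemma qcharE (x : F) : (qchar x)%:~R = x ^+ m.
Proof.
rewrite /qchar half_card; case: (eqVneq x 0) => [->|x0].
  by rewrite expr0n gtn_eqF.
by have /orP[/eqP ->|/eqP ->] := expf_half x0; rewrite ?eqxx // finField_N1neq1 rmorphN1.
Qed.

Lemma qchar0 : qchar (0 : F) = 0.
Proof. by rewrite /qchar eqxx. Qed.

Lemma qchar_neq0 (x : F) : x != 0 -> qchar x = 1 \/ qchar x = -1.
Proof. by move=> /negPf x0; rewrite /qchar x0; case: ifP; [left|right]. Qed.

Lemma qchar_eq1 (x : F) : (qchar x == 1) = (x ^+ m == 1).
Proof.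
rewrite /qchar half_card; case: (eqVneq x 0) => [->|x0].
  by rewrite expr0n gtn_eqF //= [RHS]eq_sym oner_eq0.
by case: ifP.
Qed.

Lemma qchar_eqN1 (x : F) : (qchar x == -1) = (x ^+ m == -1).
Proof.
rewrite /qchar half_card; case: (eqVneq x 0) => [->|x0].
  by rewrite expr0n gtn_eqF //= [RHS]eq_sym oppr_eq0 oner_eq0.
by have /orP[/eqP ->|/eqP ->] := expf_half x0; rewrite ?eqxx ?finField_neq1N1 ?finField_N1neq1.
Qed.

Lemma qcharM (x y : F) : qchar (x * y) = qchar x * qchar y.
Proof.
have [->|x0] := eqVneq x 0; first by rewrite mul0r qchar0 mul0r.
have [->|y0] := eqVneq y 0; first by rewrite mulr0 qchar0 mulr0.
have xy0 : x * y != 0 by rewrite mulf_neq0.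
have h (u : F) : u != 0 -> qchar u = if u ^+ m == 1 then 1 else -1.
  by move=> /negPf u0; rewrite /qchar u0 half_card.
rewrite !h // exprMn.
have /orP[/eqP ->|/eqP ->] := expf_half x0; have /orP[/eqP ->|/eqP ->] := expf_half y0;
  by rewrite ?(mulrNN, mulr1, mul1r) ?eqxx ?finField_N1neq1 ?(mulrNN, mulr1, mul1r).
Qed.

Lemma qchar1 : qchar (1 : F) = 1.
Proof. by apply/eqP; rewrite qchar_eq1 expr1n. Qed.

Lemma qcharX (x : F) n : qchar (x ^+ n) = qchar x ^+ n.
Proof. by elim: n => [|n IH]; rewrite ?expr0 ?qchar1 // !exprS qcharM IH. Qed.

Lemma qchar_sqr_eq1 (x : F) : x != 0 -> qchar x ^+ 2 = 1.
Proof. by move=> /qchar_neq0 [->|->]; rewrite ?expr1n // sqrrN expr1n. Qed.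

Lemma sum_qchar : \sum_(x : F) qchar x = 0.
Proof.
have [z z0 [zm _]] := exists_nonresidue.
have := sum_mulf (@qchar F) z0.
rewrite (eq_bigr (fun x => - qchar x)); first by rewrite sumrN; move: (\sum_(x : F) _) => s; lia.
move=> x _; rewrite qcharM; suff -> : qchar z = -1 by rewrite mulN1r.
by apply/eqP; rewrite qchar_eqN1 zm.
Qed.

Lemma sum1_finField : \sum_(x : F) 1 = #|F|%:Z.
Proof. by rewrite sumr_const natz. Qed.

Lemma card_sqrt (a : F) : #|[pred y : F | y ^+ 2 == a]|%:Z = 1 + qchar a.
Proof.
have [->|a0] := eqVneq a 0.
  rewrite qchar0 addr0; congr Posz; transitivity #|pred1 (0 : F)|; last exact: card1.
  by apply: eq_card => y; rewrite !inE expf_eq0.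
case: (eqVneq (a ^+ m) 1) => am.
  have /eqP -> : qchar a == 1 by rewrite qchar_eq1 am.
  have [y yE] := expf_eq1_root Fm am.
  have y0 : y != 0 by apply: contra_neq a0 => y0; rewrite -yE y0 expr0n.
  by rewrite -yE (card_expf_eq Fm y0).
have /eqP -> : qchar a == -1.
  by rewrite qchar_eqN1; have := expf_half a0; rewrite (negPf am).
rewrite subrr eq_card0 // => y; rewrite !inE; apply/negbTE; apply: contraNneq am => yE.
have y0 : y != 0 by apply: contra_neq a0 => y0; rewrite -yE y0 expr0n.
by rewrite -yE expf_root_eq1.
Qed.

(** For [a != b] and [d = b - a], chi(i) chi(i + d) = chi(1 + d/i) when [i] is nonzero; inverting
    and scaling [i] gives a complete character sum with only chi(1) = 1 missing. *)
Lemma sum_qchar_shift (a b : F) :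
  \sum_(g : F) qchar (a + g) * qchar (b + g) = #|F|%:Z * (a == b)%:Z - 1.
Proof.
under eq_bigr => g _ do rewrite (addrC a) (addrC b).
have -> : \sum_(i : F) qchar (i + a) * qchar (i + b)
    = \sum_(i : F) qchar i * qchar (i + (b - a)).
  by rewrite -[RHS](sum_addf _ a); apply: eq_bigr => i _; rewrite -addrA [a + _]addrC subrK.
have [->|ab] := eqVneq a b.
  rewrite subrr mulr1 -sum1_finField [X in _ = X - 1](bigD1 0) //= [LHS](bigD1 0) //= qchar0 mul0r add0r.
  rewrite addrAC subrr add0r; apply: eq_bigr => i i0.
  by rewrite addr0 -expr2 qchar_sqr_eq1.
set d := b - a; have d0 : d != 0 by rewrite subr_eq0 eq_sym.
rewrite mulr0 sub0r (bigD1 0) //= qchar0 mul0r add0r.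
have -> : \sum_(i : F | i != 0) qchar i * qchar (i + d)
    = \sum_(i : F | i != 0) qchar (1 + d * i^-1).
  apply: eq_bigr => i i0; rewrite -[RHS]mul1r -(qchar_sqr_eq1 i0) expr2 -mulrA -!qcharM.
  by congr (qchar (_ * _)); rewrite mulrDr mulr1 mulrC divfK.
have -> : \sum_(i : F | i != 0) qchar (1 + d * i^-1) = \sum_(i : F | i != 0) qchar (1 + d * i).
  rewrite [RHS](reindex_inj (@invr_inj F)) /=.
  by apply: eq_bigl => i; rewrite invr_eq0.
rewrite (sum_mulf_neq0 (fun i => qchar (1 + i)) d0) sumr_neq0 addr0 qchar1.
under eq_bigr do rewrite addrC.
by rewrite sum_addf sum_qchar sub0r.
Qed.

End QuadraticCharacter.

(** * The six values of the Mordell sums *)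

Definition mordell_sum (F : finFieldType) (g : F) : int :=
  \sum_(x : F) qchar (x ^+ 3 + g).

(** Restricting to squares removes the sign of the quadratic twist: the value depends only on the
    cubic class of [h], so three integers describe all the sums up to sign. *)
Definition square_trace (F : finFieldType) (h : F) : int := - mordell_sum (h ^+ 2).

Section MordellSums.
Variables (F : finFieldType) (n : nat) (r c : F).
Hypothesis Fn : #|F|.-1 = (6 * n)%N.
Hypothesis rP : 3.-primitive_root r.
Hypothesis cr : c ^+ (2 * n) = r.

Local Notation S := (@mordell_sum F).
Local Notation T := (@square_trace F).

Let F2 : #|F|.-1 = (2 * (3 * n))%N. Proof. by rewrite Fn mulnA. Qed.
Let F3 : #|F|.-1 = (3 * (2 * n))%N. Proof. by rewrite Fn mulnA. Qed.
Let n_gt0 : (0 < n)%N.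
Proof. by have := card_finField_gt0 F; rewrite Fn; case: n. Qed.
Let cardF : #|F| = (6 * n).+1.
Proof. by rewrite -Fn prednK // ltnW ?finNzRing_gt1. Qed.
Let r0 : r != 0.
Proof.
apply/eqP => rz; move: (prim_expr_order rP).
by rewrite rz expr0n /= => /esym/eqP; rewrite oner_eq0.
Qed.
Let c0 : c != 0.
Proof.
by apply/eqP => cz; move: r0; rewrite -cr cz expr0n; case: n n_gt0 => // k _; rewrite eqxx.
Qed.

Lemma mordell_sum_twist (g u : F) : u != 0 -> S (g * u ^+ 3) = qchar u * S g.
Proof.
move=> u0; rewrite /mordell_sum -(sum_mulf _ u0) mulr_sumr; apply: eq_bigr => x _.
rewrite exprMn [g * _]mulrC -mulrDr (qcharM F2) (qcharX F2) exprS.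
by rewrite (qchar_sqr_eq1 u0) mulr1.
Qed.

Lemma mordell_sum0 : S 0 = 0.
Proof.
rewrite /mordell_sum -[RHS](sum_qchar F2); apply: eq_bigr => x _.
have [->|x0] := eqVneq x 0; first by rewrite expr0n /= addr0.
by rewrite addr0 (qcharX F2) exprS (qchar_sqr_eq1 x0) mulr1.
Qed.

Lemma cubic_class (u : F) : u != 0 -> exists i : 'I_3, u ^+ (2 * n) = r ^+ i.
Proof.
move=> u0; have [|i iE] := prim_rootP rP (x := u ^+ (2 * n)); last by exists i.
by rewrite -exprM mulnC -F3 expf_card_pred.
Qed.

Lemma square_trace_cube (h v : F) : v != 0 -> T (h * v ^+ 3) = T h.
Proof.
move=> v0; rewrite /square_trace exprMn -exprM mulnC exprM mordell_sum_twist ?expf_neq0 //.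
by rewrite (qcharX F2) qchar_sqr_eq1 // mul1r.
Qed.

Lemma square_trace_class (u v : F) :
  u != 0 -> v != 0 -> u ^+ (2 * n) = v ^+ (2 * n) -> T u = T v.
Proof.
move=> u0 v0 uv; have [|y yE] := expf_eq1_root F3 (x := u / v).
  by rewrite expr_div_n uv divff ?expf_neq0.
rewrite -[u](divfK v0) -yE mulrC square_trace_cube //.
apply: contra_neq u0 => y0; apply/eqP; move: yE; rewrite y0 expr0n /= => /esym/eqP.
by rewrite mulf_eq0 invr_eq0 (negPf v0) orbF.
Qed.

(** Since [g^4 = g * g^3], the curve attached to [g^4] is the quadratic twist by [g] of the one
    attached to [g]. *)
Lemma mordell_sum_sqr (g : F) : S g ^+ 2 = T (g ^+ 2) ^+ 2.
Proof.
have [->|g0] := eqVneq g 0; first by rewrite /square_trace !expr0n /= mordell_sum0 oppr0.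
rewrite /square_trace sqrrN -exprM -[(2 * 2)%N]/(1 + 3)%N exprD expr1 mordell_sum_twist //.
by rewrite exprMn qchar_sqr_eq1 // mul1r.
Qed.

Lemma sum_cubic_class (V : zmodType) (f : F -> V) (i : nat) :
  \sum_(v : F | v != 0) f (c ^+ i * v ^+ 3) =
  (\sum_(u : F | u ^+ (2 * n) == r ^+ i) f u) *+ 3.
Proof.
rewrite (sum_expf F3 (fun v => f (c ^+ i * v))); congr (_ *+ _).
have ci0 : c ^+ i != 0 by rewrite expf_neq0.
rewrite [RHS](reindex (fun x => c ^+ i * x)) /=; last first.
  by exists (fun x => (c ^+ i)^-1 * x) => x _; rewrite ?mulKf ?mulVKf.
apply: eq_bigl => u; rewrite exprMn -(exprM c) [(i * _)%N]mulnC (exprM c) cr.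
by rewrite -[X in _ = (_ == X)]mulr1 (inj_eq (mulfI _)) // expf_neq0.
Qed.

Lemma sum_cubic_classes (V : zmodType) (f : F -> V) :
  \sum_(u : F | u != 0) f u = \sum_(i < 3) \sum_(u : F | u ^+ (2 * n) == r ^+ i) f u.
Proof.
rewrite (exchange_big_dep xpredT) //=.
rewrite [LHS]big_mkcond /=; apply: eq_bigr => u _; case: eqVneq => [->|u0] /=.
  rewrite big_pred0 // => i; rewrite expr0n muln_eq0 /= gtn_eqF // eq_sym expf_eq0.
  by rewrite (negPf r0) andbF.
have [i iE] := cubic_class u0.
rewrite (big_pred1 i) // => j; rewrite iE (eq_prim_root_expr rP) !modn_small //.
Qed.

Lemma sum_cubic_classes3 (V : zmodType) (f : F -> V) :
  (\sum_(u : F | u != 0) f u) *+ 3 =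
  \sum_(i < 3) \sum_(v : F | v != 0) f (c ^+ i * v ^+ 3).
Proof.
by rewrite sum_cubic_classes -sumrMnl; apply: eq_bigr => i _; rewrite sum_cubic_class.
Qed.

Lemma sum1_neq0 : \sum_(u : F | u != 0) 1 = 6 * n%:Z.
Proof. by rewrite sumr_neq0 sum1_finField cardF; lia. Qed.

Lemma sum_square_trace_fun (f : int -> int) :
  \sum_(u : F | u != 0) f (T u) = 2 * n%:Z * \sum_(i < 3) f (T (c ^+ i)).
Proof.
have : (\sum_(u : F | u != 0) f (T u)) *+ 3 = 6 * n%:Z * \sum_(i < 3) f (T (c ^+ i)).
  rewrite sum_cubic_classes3 mulr_sumr; apply: eq_bigr => i _.
  rewrite -sum1_neq0 mulr_suml; apply: eq_bigr => v v0.
  by rewrite mul1r square_trace_cube.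
move: (\sum_(i < 3) _) (\sum_(u : F | _) _) => a b.
by rewrite mulrS mulr2n; lia.
Qed.

Lemma sum_mordell_sum : \sum_(g : F) S g = 0.
Proof.
rewrite exchange_big /= big1 // => x _; under eq_bigr do rewrite addrC.
by rewrite sum_addf (sum_qchar F2).
Qed.

(** The correlation of chi(i) with chi(j^3 + i) is #F - 1 for [j = 0] and -1 otherwise, so the total
    cancels. *)
Lemma sum_qchar_mordell_sum : \sum_(g : F) qchar g * S g = 0.
Proof.
under eq_bigr do rewrite mulr_sumr.
rewrite exchange_big /=.
have -> : \sum_(j : F) \sum_(i : F) qchar i * qchar (j ^+ 3 + i)
    = \sum_(j : F) (#|F|%:Z * (j == 0)%:Z - 1).
  apply: eq_bigr => j _; have := sum_qchar_shift F2 0 (j ^+ 3).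
  rewrite eq_sym expf_eq0 /= => <-; apply: eq_bigr => i _.
  by rewrite add0r.
rewrite sumrB sum1_finField -mulr_sumr (bigD1 0) //= eqxx big1 ?addr0 ?mulr1 ?subrr //.
by move=> i /negPf ->.
Qed.

(** Adding the plain and the chi-weighted first moments of [S] keeps only nonzero squares, where [S]
    is given by [T]; each cubic class then contributes equally often. *)
Lemma sum_square_trace : T 1 + T c + T (c ^+ 2) = 0.
Proof.
have h : \sum_(u : F | u != 0) T u = 0.
  rewrite /square_trace sumrN (sum_expf F2 S) big_mkcond -sumrMnl /=.
  have -> : \sum_(i : F) (if i ^+ (3 * n) == 1 then S i else 0) *+ 2
     = \sum_(g : F) (S g + qchar g * S g).
    apply: eq_bigr => g _; rewrite -(qchar_eq1 F2).
    have [->|g0] := eqVneq g 0; first by rewrite mordell_sum0 mulr0 addr0; case: ifP.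
    have [->|->] := qchar_neq0 g0; first by rewrite eqxx mul1r mulr2n.
    by rewrite mulN1r subrr.
  by rewrite big_split /= sum_mordell_sum sum_qchar_mordell_sum addr0 oppr0.
have := sum_square_trace_fun id; rewrite h !big_ord_recl big_ord0 /= /bump /= expr0 expr1.
move=> /esym/eqP; rewrite !mulf_eq0 => /orP[/orP[//|n0]|/eqP e].
  by move: n_gt0 n0; case: n.
by rewrite -[RHS]e /=; ring.
Qed.

Lemma sum_card_cube_eq (x : F) :
  \sum_(y : F) (x ^+ 3 == y ^+ 3)%:Z = if x == 0 then 1 else 3.
Proof.
rewrite (eq_bigr (fun y => if y \in [pred y : F | y ^+ 3 == x ^+ 3] then 1 else 0)); last first.
  by move=> y _; rewrite inE eq_sym; case: eqP.
rewrite -big_mkcond sumr_const [LHS]natz; case: (eqVneq x 0) => [->|x0] /=.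
  transitivity (#|pred1 (0 : F)|%:Z); last by rewrite card1.
  by congr Posz; apply: eq_card => y; rewrite !inE expr0n expf_eq0.
by rewrite (card_expf_eq F3 x0).
Qed.

(** By orthogonality only the pairs with [x^3 = y^3] carry the factor #F; there are 1 + 3(#F - 1) of
    them. *)
Lemma sum_mordell_sum_sqr : \sum_(g : F) S g ^+ 2 = 2 * #|F|%:Z * (#|F|%:Z - 1).
Proof.
have -> : \sum_(g : F) S g ^+ 2
   = \sum_(x : F) \sum_(y : F) (#|F|%:Z * (x ^+ 3 == y ^+ 3)%:Z - 1).
  under eq_bigr do rewrite expr2 /mordell_sum mulr_suml.
  rewrite exchange_big /=; apply: eq_bigr => x _.
  under eq_bigr do rewrite mulr_sumr.
  rewrite exchange_big /=; apply: eq_bigr => y _.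
  exact: (sum_qchar_shift F2).
have -> : \sum_(x : F) \sum_(y : F) (#|F|%:Z * (x ^+ 3 == y ^+ 3)%:Z - 1)
   = \sum_(x : F) (2 * #|F|%:Z - 2 * #|F|%:Z * (x == 0)%:Z).
  apply: eq_bigr => x _; rewrite sumrB sum1_finField -mulr_sumr sum_card_cube_eq.
  by case: eqP => _ /=; lia.
have e0 : \sum_(x : F) (x == 0)%:Z = 1.
  by rewrite (bigD1 0) //= eqxx big1 ?addr0 // => i /negPf ->.
have e1 : \sum_(x : F) 2 * #|F|%:Z = 2 * #|F|%:Z * #|F|%:Z.
  by rewrite sumr_const -[LHS]mulr_natr; congr (_ * _); rewrite [LHS]natz.
rewrite sumrB e1 (eq_bigr (fun x => 2 * #|F|%:Z * (x == 0)%:Z)) // -mulr_sumr e0.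
by ring.
Qed.

Lemma sum_square_trace_sqr :
  T 1 ^+ 2 + T c ^+ 2 + T (c ^+ 2) ^+ 2 = 6 * #|F|%:Z.
Proof.
have h : \sum_(u : F | u != 0) T (u ^+ 2) ^+ 2 = 2 * #|F|%:Z * (#|F|%:Z - 1).
  rewrite -sum_mordell_sum_sqr [RHS](bigD1 0) //= mordell_sum0 expr0n add0r.
  by apply: eq_bigr => g _; rewrite mordell_sum_sqr.
(* [S g ^+ 2] involves the class of [g ^+ 2]; doubling permutes the exponents modulo 3. *)
have tc3 (i : nat) : T (c ^+ (3 + i)) = T (c ^+ i).
  by rewrite exprD mulrC square_trace_cube.
have : (\sum_(u : F | u != 0) T (u ^+ 2) ^+ 2) *+ 3
    = 6 * n%:Z * \sum_(i < 3) T (c ^+ (2 * i)) ^+ 2.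
  rewrite (sum_cubic_classes3 (fun u => T (u ^+ 2) ^+ 2)) mulr_sumr; apply: eq_bigr => i _.
  rewrite -sum1_neq0 mulr_suml; apply: eq_bigr => v v0.
  rewrite mul1r exprMn -!exprM [(3 * 2)%N]mulnC (exprM v) square_trace_cube ?expf_neq0 //.
  by rewrite mulnC.
rewrite h !big_ord_recl big_ord0 /= /bump /= -[(2 * 1)%N]/2%N -[(2 * 2)%N]/(3 + 1)%N.
rewrite tc3 expr0 expr1 cardF mulrS mulr2n => e.
apply: (mulfI (_ : 6 * n%:Z != 0)); first by rewrite mulf_eq0 //; lia.
have -> : 6 * n%:Z * (T 1 ^+ 2 + T c ^+ 2 + T (c ^+ 2) ^+ 2)
  = 6 * n%:Z * (T 1 ^+ 2 + (T (c ^+ 2) ^+ 2 + (T c ^+ 2 + 0))) by ring.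
by rewrite -e; lia.
Qed.

End MordellSums.

(** * Congruences for the Mordell sums modulo p and modulo 9 *)

Lemma card_period3 (X : finType) (f : X -> X) (A : {set X}) :
  {in A, forall x, f x \in A} -> {in A, forall x, f (f (f x)) = x} ->
  #|A| = #|[pred x in A | f x == x]| %[mod 3].
Proof.
have [k] := ubnP #|A|; elim: k A => // k IH A Ak fA f3.
have [/existsP[x /andP[xA fx]]|] := boolP [exists x, (x \in A) && (f x != x)]; last first.
  rewrite negb_exists => /forallP h; congr (_ %% _)%N; apply: eq_card => x.
  by have := h x; rewrite !inE; case: (x \in A) => //=; rewrite negbK => ->.
have ffx : f (f x) != f x by apply: contraNneq fx => e; rewrite -{2}(f3 x xA) e e.
have ffx' : f (f x) != x by apply: contraNneq fx => e; rewrite -{2}(f3 x xA) e.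
pose B : {set X} := (x |: (f x |: [set f (f x)]))%SET.
have BA : B \subset A.
  by apply/fintype.subsetP => y; rewrite !inE => /or3P[] /eqP ->; rewrite ?fA.
have B3 : #|B| = 3%N.
  by rewrite !cardsU1 cards1 !inE negb_or ![x == _]eq_sym fx ffx' [f x == _]eq_sym ffx.
have BF : #|[pred y in A | f y == y]| = #|[pred y in (A :\: B)%SET | f y == y]|.
  apply: eq_card => y; rewrite !inE; case: (f y =P y) => fy; rewrite ?andbF // !andbT.
  case: (boolP (y \in A)) => yA; rewrite ?andbF // andbT; apply/esym; rewrite !negb_or.
  apply/and3P; split; apply: contraNneq fx => yE.
  - by rewrite -yE fy.
  - by have xy : x = y; [rewrite -[LHS](f3 x xA) -yE !fy|rewrite xy fy].
  - by have xy : x = y; [rewrite -[LHS](f3 x xA) -yE fy|rewrite xy fy].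
have cA : #|A| = (#|(A :\: B)%SET| + 3)%N.
  by rewrite -B3 -(cardsID B A) addnC (finset.setIidPr BA).
rewrite cA modnDr BF; apply: IH.
- by move: Ak; rewrite cA; lia.
- move=> y; rewrite !inE !negb_or => /andP[/and3P[y1 y2 y3] yA]; rewrite (fA y yA) andbT.
  by apply/and3P; split; [apply: contraNneq y3|apply: contraNneq y1|apply: contraNneq y2] => e;
    rewrite -(f3 y yA) e ?(f3 x xA).
- by move=> y; rewrite inE => /andP[_ /f3].
Qed.

Section MordellCongruences.
Variables (F : finFieldType) (n : nat) (r c : F).
Hypothesis Fn : #|F|.-1 = (6 * n)%N.
Hypothesis rP : 3.-primitive_root r.
Hypothesis cr : c ^+ (2 * n) = r.

Local Notation S := (@mordell_sum F).
Local Notation T := (@square_trace F).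

Let F2 : #|F|.-1 = (2 * (3 * n))%N. Proof. by rewrite Fn mulnA. Qed.
Let F3 : #|F|.-1 = (3 * (2 * n))%N. Proof. by rewrite Fn mulnA. Qed.
Let n_gt0 : (0 < n)%N.
Proof. by have := card_finField_gt0 F; rewrite Fn; case: n. Qed.
Let two0 : 2 != 0 :> F := finField_two_neq0 F2.

(** After expanding Euler's criterion, the power sum of exponent 3(3n - i) survives only when that
    exponent is 6n, that is, for [i = n]. So modulo [p] the trace is a fixed constant times the
    cubic symbol of [h]. *)
Lemma square_trace_binomial (h : F) :
  (T h)%:~R = 'C(3 * n, n)%:R * h ^+ (2 * n) :> F.
Proof.
rewrite rmorphN /mordell_sum rmorph_sum /=.
have -> : \sum_(x : F) (qchar (x ^+ 3 + h ^+ 2))%:~R =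
    \sum_(i < (3 * n).+1) (\sum_(x : F) x ^+ (3 * (3 * n - i))) * (h ^+ (2 * i) *+ 'C(3 * n, i)).
  under [RHS]eq_bigr do rewrite mulr_suml.
  rewrite [RHS]exchange_big /=; apply: eq_bigr => x _.
  rewrite (qcharE F2) exprDn; apply: eq_bigr => i _.
  by rewrite -!exprM mulrnAr.
have ni : (n < (3 * n).+1)%N by lia.
rewrite (bigD1 (Ordinal ni)) //= [X in _ + X]big1 => [|i].
  have -> : (3 * (3 * n - n) = #|F|.-1)%N by rewrite Fn; lia.
  by rewrite sum_expr_card_pred addr0 mulN1r opprK mulr_natl.
rewrite -val_eqE /= => iN.
suff -> : \sum_(x : F) x ^+ (3 * (3 * n - i)) = 0 by rewrite mul0r.
(* The exponent 0 escapes [sum_expr]; there the sum is #F, which vanishes in [F]. *)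
have [i3|i3] := eqVneq (i : nat) (3 * n)%N.
  rewrite i3 subnn muln0 (eq_bigr (fun=> 1)) //.
  have := sum_addf (fun x => x) (1 : F).
  by rewrite big_split /= => /eqP; rewrite -subr_eq0 addrAC subrr add0r => /eqP.
have il := ltn_ord i.
rewrite sum_expr //; first by lia.
rewrite Fn; apply/negP => /dvdnP[k kE].
by move: kE; case: k => [|[|k]]; nia.
Qed.

(** [x^3 + 1] has three roots in [F], so the remaining #F - 3 terms, each 1 or -1, are even in
    number. This is the rational 2-torsion of y^2 = x^3 + 1. *)
Lemma square_trace1_even : exists e : int, T 1 = 2 * e.
Proof.
have E (x : F) : qchar x = 1 - (x == 0)%:Z - 2 * (qchar x == -1)%:Z.
  by rewrite /qchar; case: eqP => // _; case: ifP.
rewrite /square_trace expr1n /mordell_sum (eq_bigr _ (fun x _ => E (x ^+ 3 + 1))).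
rewrite !sumrB -mulr_sumr sum1_finField.
have -> : \sum_(x : F) (x ^+ 3 + 1 == 0)%:Z = 3.
  transitivity (\sum_(y : F) ((-1 : F) ^+ 3 == y ^+ 3)%:Z).
    have -> : (-1) ^+ 3 = -1 :> F by ring.
    by apply: eq_bigr => x _; rewrite addr_eq0 eq_sym.
  by rewrite (sum_card_cube_eq Fn) oppr_eq0 oner_eq0.
have -> : #|F| = (6 * n).+1 by rewrite -Fn prednK // ltnW ?finNzRing_gt1.
move: (\sum_(x : F) _) => s; exists (s + 1 - 3 * n%:Z); lia.
Qed.

Lemma card_sum (P : pred F) : #|P|%:Z = \sum_(x : F) (P x)%:Z.
Proof.
rewrite -sum1_card big_mkcond /= -natz natr_sum; apply: eq_bigr => x _.
by rewrite unfold_in natz; case: (P x).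
Qed.

Lemma card_sub_sqr (a : F) : #|[pred x : F | x - x ^+ 2 == a]|%:Z = 1 + qchar (1 - 4 * a).
Proof.
rewrite -(card_sqrt F2) !card_sum /=.
rewrite -[RHS](sum_addf _ 1) -[RHS](sum_mulf _ (_ : -2 != 0)) ?oppr_eq0 //.
apply: eq_bigr => x _; rewrite /=; congr (_ : bool)%:Z.
have two2 : 4 = 2 * 2 :> F by rewrite -natrM.
rewrite -[LHS]subr_eq0 -[RHS]subr_eq0.
have -> : (-2 * x + 1) ^+ 2 - (1 - 4 * a) = - 4 * (x - x ^+ 2 - a) by ring.
by rewrite mulf_eq0 oppr_eq0 two2 mulf_eq0 (negPf two0).
Qed.

Lemma mordell_sum_sqr_scaled (a : F) :
  a != 0 -> S (16 * a ^+ 2) = \sum_(v : F) qchar (1 - 4 * (a * v ^+ 3)).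
Proof.
move=> a0; have u0 : -4 * a != 0.
  by rewrite mulf_neq0 // oppr_eq0 (_ : 4 = 2 * 2 :> F) ?mulf_neq0 // -natrM.
rewrite /mordell_sum -(sum_mulf _ u0); apply: eq_bigr => v _.
have -> : (-4 * a * v) ^+ 3 + 16 * a ^+ 2 = (4 * a) ^+ 2 * (1 - 4 * (a * v ^+ 3)) by ring.
rewrite (qcharM F2) (qcharX F2) (qchar_sqr_eq1) ?mul1r //.
by move: u0; rewrite mulNr oppr_eq0.
Qed.

Definition cube_products : {set F} := [set x : F | (x * (1 - x)) ^+ (2 * n) == 1]%SET.

(** The solutions of [x (1 - x) = v^3] are counted in two ways: for fixed [v] through the
    discriminant 1 - 4v^3, for fixed [x] through cube roots. The summand 2 comes from [x = 0] and
    [x = 1]. *)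
Lemma square_trace4_card : #|F|%:Z - T 4 = 2 + 3 * #|cube_products|%:Z.
Proof.
have h1 (a : F) : \sum_(v : F) (v ^+ 3 == a)%:Z = (a == 0)%:Z + 3 * (a ^+ (2 * n) == 1)%:Z.
  have [/existsP[y /eqP yE]|/existsPn no] := boolP [exists y : F, y ^+ 3 == a].
    rewrite -yE; under eq_bigr do rewrite eq_sym.
    rewrite (sum_card_cube_eq Fn) expf_eq0 /=.
    case: eqVneq => [->|y0] /=; last by rewrite (expf_root_eq1 F3 y0) eqxx.
    by rewrite !expr0n muln_eq0 /= gtn_eqF //= eq_sym oner_eq0.
  rewrite big1 => [|v _]; last by rewrite (negPf (no v)).
  case: eqP => [a0|_]; first by have := no 0; rewrite expr0n a0 eqxx.
  by case: eqP => // /(expf_eq1_root F3)[v vE]; have := no v; rewrite vE eqxx.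
have := mordell_sum_sqr_scaled (oner_neq0 F).
rewrite expr1n mulr1 => S16.
have T4 : T 4 = - S 16 by rewrite /square_trace -natrX.
have : \sum_(v : F) (1 + qchar (1 - 4 * v ^+ 3)) =
       \sum_(x : F) ((x - x ^+ 2 == 0)%:Z + 3 * ((x - x ^+ 2) ^+ (2 * n) == 1)%:Z).
  transitivity (\sum_(v : F) \sum_(x : F) (x - x ^+ 2 == v ^+ 3)%:Z).
    by apply: eq_bigr => v _; rewrite -card_sub_sqr card_sum.
  rewrite exchange_big; apply: eq_bigr => x _; rewrite -h1.
  by apply: eq_bigr => v _; rewrite eq_sym.
rewrite !big_split /= sum1_finField -mulr_sumr.
have -> : \sum_(v : F) qchar (1 - 4 * v ^+ 3) = S 16.
  by rewrite S16; apply: eq_bigr => v _; rewrite mul1r.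
have -> : \sum_(x : F) (x - x ^+ 2 == 0)%:Z = 2.
  by have := card_sub_sqr 0; rewrite mulr0 subr0 (qchar1 F2) card_sum => ->.
have -> : \sum_(x : F) ((x - x ^+ 2) ^+ (2 * n) == 1)%:Z = #|cube_products|%:Z.
  rewrite card_sum; apply: eq_bigr => x _.
  have -> : x - x ^+ 2 = x * (1 - x) by ring.
  by congr (nat_of_bool _)%:Z; have := finset.in_set (fun x : F => (x * (1 - x)) ^+ (2 * n) == 1) x.
by rewrite T4 opprK => ->.
Qed.

(* [x |-> 1 / (1 - x)] permutes this set with period 3; its fixed points are the
   two roots of [x - x^2 = 1]. *)
Lemma card_cube_products : #|cube_products| = 2 %[mod 3].
Proof.
pose f (x : F) := (1 - x)^-1.
have cond (x : F) : (x * (1 - x)) ^+ (2 * n) == 1 -> x != 0 /\ 1 - x != 0.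
  case: (eqVneq x 0) => [->|x0]; last case: (eqVneq (1 - x) 0) => [->|x1] //.
    by rewrite mul0r expr0n muln_eq0 /= gtn_eqF //= eq_sym oner_eq0.
  by rewrite mulr0 expr0n muln_eq0 /= gtn_eqF //= eq_sym oner_eq0.
have f1 (x : F) : 1 - x != 0 -> 1 - f x = - x * f x.
  by move=> x1; rewrite /f; field.
have f2 (x : F) : 1 - x != 0 -> f x * (1 - f x) = - (x * (1 - x)) * f x ^+ 3.
  by move=> x1; rewrite /f; field.
rewrite (card_period3 (f := f)).
- have -> : #|[pred x in cube_products | f x == x]| = #|[pred x : F | x - x ^+ 2 == 1]|.
    apply: eq_card => x; rewrite !inE; apply/andP/eqP => [[xA /eqP fx]|xE].
      have [x0 x1] := cond x xA.
      have <- : f x * (1 - x) = 1 by rewrite mulVf.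
      by rewrite fx; ring.
    have xE' : x * (1 - x) = 1 by transitivity (x - x ^+ 2); first by ring.
    split; first by rewrite xE' expr1n.
    have x1 : 1 - x != 0 by apply: contra_eq_neq xE' => ->; rewrite mulr0 eq_sym oner_neq0.
    by apply/eqP/(mulIf x1); rewrite /f mulVf // xE'.
  have r1 : r - 1 != 0.
    by rewrite subr_eq0 -[r]expr1 -(prim_order_dvd rP).
  have r3 : r ^+ 2 + r + 1 = 0.
    apply: (mulfI r1); rewrite mulr0; transitivity (r ^+ 3 - 1); first by ring.
    by rewrite (prim_expr_order rP) subrr.
  have rE : (2 * r + 1) ^+ 2 = -3 :> F.
    by transitivity (4 * (r ^+ 2 + r + 1) - 3); [ring|rewrite r3; ring].
  have := card_sub_sqr 1; have -> : 1 - 4 * 1 = (2 * r + 1) ^+ 2 by rewrite rE; ring.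
  rewrite (qcharX F2) qchar_sqr_eq1 => [[->] //|].
  apply: contraNneq r1 => e; rewrite -sqrf_eq0.
  have -> : (r - 1) ^+ 2 = (r ^+ 2 + r + 1) + (-3) * r by ring.
  by rewrite -rE e r3 expr0n mul0r addr0.
- move=> x; rewrite !inE => xA; have [x0 x1] := cond x xA; rewrite f2 // exprMn.
  rewrite (expf_root_eq1 F3) ?invr_eq0 // mulr1 -mulN1r exprMn [(-1) ^+ _]exprM.
  by rewrite sqrrN !expr1n mul1r (eqP xA).
- move=> x; rewrite inE => /cond [x0 x1]; have fx0 : f x != 0 by rewrite invr_eq0.
  have e : 1 - f x != 0 by rewrite f1 // mulf_neq0 // oppr_eq0.
  have -> : f (f (f x)) = (- f x * f (f x))^-1 by rewrite -f1.
  have -> : f (f x) = (- x * f x)^-1 by rewrite -f1.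
  by rewrite /f; field; rewrite x1 !oppr_eq0 x0 oner_eq0.
Qed.

End MordellCongruences.

(** * Evaluation of the traces at primes 3k^2 + 3k + 1 *)

Definition eis_norm (k : nat) : nat := (3 * k ^ 2 + 3 * k + 1)%N.

(* Normalised so that [trace_value k e] is congruent to [- (3k+1)^e] modulo
   [eis_norm k], where [3k+1] is a primitive cube root of unity. *)
Definition trace_value (k e : nat) : int :=
  match (e %% 3)%N with
  | 0 => -1
  | 1 => - (3 * k%:Z + 1)
  | _ => 3 * k%:Z + 2
  end.

Lemma trace_value_mod3 k e : trace_value k (e %% 3) = trace_value k e.
Proof. by rewrite /trace_value modn_mod. Qed.

Lemma trace_valueD k e e' i : e = e' %[mod 3] -> trace_value k (e + i) = trace_value k (e' + i).
Proof. by move=> h; rewrite -trace_value_mod3 -modnDml h modnDml trace_value_mod3. Qed.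

Lemma sqr_le_bounds (c b : int) : 0 <= b -> c ^+ 2 <= b ^+ 2 -> - b <= c <= b.
Proof. by move=> b0 cb; rewrite -ler_norml -(ger0_norm b0) -ler_sqr ?nnegrE ?normr_ge0 // -!normrX !ger0_norm ?sqr_ge0. Qed.

(** Multiply X + Y sqrt(-3) by 1 - m sqrt(-3): the product has norm 16 p^2 and is divisible by [p],
    which leaves [d^2 + 3 c^2 = 16]. The solutions with [c = 0] give X = 1 or -1 and contradict
    evenness. *)
Lemma norm_form_unique_aux (p : nat) (X Y m : int) : prime p ->
  X ^+ 2 + 3 * Y ^+ 2 = 4 * p%:Z -> 1 + 3 * m ^+ 2 = 4 * p%:Z ->
  (exists e, X = 2 * e) -> (p%:Z %| X * m - Y)%Z ->
  [\/ 2 * X = 1 + 3 * m, 2 * X = 1 - 3 * m, 2 * X = -1 + 3 * m | 2 * X = -1 - 3 * m].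
Proof.
move=> pp hX hm [e eX] /dvdzP[c cE].
have p0 : p%:Z != 0 by have := prime_gt0 pp; lia.
have h16 : (X + 3 * Y * m) ^+ 2 = p%:Z ^+ 2 * (16 - 3 * c ^+ 2).
  have : (X + 3 * Y * m) ^+ 2 + 3 * (X * m - Y) ^+ 2 = (X ^+ 2 + 3 * Y ^+ 2) * (1 + 3 * m ^+ 2).
    by ring.
  rewrite hX hm cE => h; transitivity ((X + 3 * Y * m) ^+ 2 + 3 * (c * p%:Z) ^+ 2 - 3 * (c * p%:Z) ^+ 2).
    by ring.
  by rewrite h; ring.
have /dvdzP[d dE] : (p%:Z %| X + 3 * Y * m)%Z.
  have : (p%:Z %| (X + 3 * Y * m) ^+ 2)%Z by rewrite h16 expr2 -mulrA dvdz_mulr.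
  by rewrite !dvdzE abszX Euclid_dvdX // => /andP[].
have hd : d ^+ 2 + 3 * c ^+ 2 = 16.
  apply: (mulfI (_ : p%:Z ^+ 2 != 0)); first by rewrite expf_neq0.
  by move: h16; rewrite dE => h; transitivity ((d * p%:Z) ^+ 2 + p%:Z ^+ 2 * (3 * c ^+ 2)); [ring|rewrite h; ring].
have h4 : 4 * X = d + 3 * m * c.
  apply: (mulfI p0); transitivity (X * (1 + 3 * m ^+ 2)); first by rewrite hm; ring.
  transitivity ((X + 3 * Y * m) + 3 * m * (X * m - Y)); first by ring.
  by rewrite dE cE; ring.
have c3 : -3 <= c <= 3.
  by apply: sqr_le_bounds => //; have := sqr_ge0 d; have := sqr_ge0 c; lia.
have d4 : -4 <= d <= 4.
  by apply: sqr_le_bounds => //; have := sqr_ge0 c; lia.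
have hcd : c = 0 \/ (c = 2 \/ c = -2) /\ (d = 2 \/ d = -2).
  have ic : (c == -3) || (c == -2) || (c == -1) || (c == 0) || (c == 1) || (c == 2) || (c == 3).
    by move: c3; clear; lia.
  have id : (d == -4) || (d == -3) || (d == -2) || (d == -1) || (d == 0) || (d == 1)
            || (d == 2) || (d == 3) || (d == 4).
    by move: d4; clear; lia.
  move: hd; clear -ic id; move: ic id.
  by do 6?[case/orP]; move/eqP => ->; do 8?[case/orP]; move/eqP => -> //; auto.
case: hcd => [c0|[cE' dE']].
  exfalso; move: hd h4; rewrite c0 expr0n mulr0 addr0 => hd.
  have /orP[] : (d == 4) || (d == -4) by rewrite -eqf_sqr hd.
    by move=> /eqP ->; move: eX; clear; lia.
  by move=> /eqP ->; move: eX; clear; lia.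
case: cE' dE' h4 => -> [] -> h4.
- by apply: Or41; move: h4; clear; lia.
- by apply: Or43; move: h4; clear; lia.
- by apply: Or42; move: h4; clear; lia.
- by apply: Or44; move: h4; clear; lia.
Qed.

Lemma norm_form_unique (p : nat) (X Y m : int) : prime p ->
  X ^+ 2 + 3 * Y ^+ 2 = 4 * p%:Z -> 1 + 3 * m ^+ 2 = 4 * p%:Z ->
  (exists e, X = 2 * e) ->
  [\/ 2 * X = 1 + 3 * m, 2 * X = 1 - 3 * m, 2 * X = -1 + 3 * m | 2 * X = -1 - 3 * m].
Proof.
move=> pp hX hm eX.
have : (p%:Z %| (X * m - Y) * (X * m + Y))%Z.
  have -> : (X * m - Y) * (X * m + Y) = p%:Z * (4 * (m ^+ 2 - Y ^+ 2)).
    transitivity (m ^+ 2 * (X ^+ 2 + 3 * Y ^+ 2) - Y ^+ 2 * (1 + 3 * m ^+ 2)); first by ring.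
    by rewrite hX hm; ring.
  by rewrite dvdz_mulr.
rewrite dvdzE abszM Euclid_dvdM // => /orP[] h.
  exact: (@norm_form_unique_aux p X Y).
apply: (@norm_form_unique_aux p X (- Y)) => //; first by rewrite sqrrN.
by rewrite opprK.
Qed.

(** With [m = 2k + 1], norm uniqueness makes [t0] equal to 3k + 1 or 3k + 2 up to sign, and evenness
    selects one by the parity of [k]. The quadratic relation yields the other two; the sign [d] and
    their order stay open. *)
Lemma trace_triple (k : nat) (t0 t1 t2 : int) (e := if odd k then 1%N else 2%N) :
  prime (eis_norm k) -> t0 + t1 + t2 = 0 ->
  t0 ^+ 2 + t1 ^+ 2 + t2 ^+ 2 = 6 * (eis_norm k)%:Z -> (exists a, t0 = 2 * a) ->
  exists2 d : int, d = 1 \/ d = -1 &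
    t0 = d * trace_value k e /\
    ((t1 = d * trace_value k e.+1 /\ t2 = d * trace_value k e.+2) \/
     (t1 = d * trace_value k e.+2 /\ t2 = d * trace_value k e.+1)).
Proof.
move=> pp s0 s2 [a aE].
have pE : (eis_norm k)%:Z = 3 * k%:Z ^+ 2 + 3 * k%:Z + 1 by rewrite /eis_norm; lia.
have t2E : t2 = - t0 - t1 by move: s0; clear; lia.
have q : t0 ^+ 2 + t0 * t1 + t1 ^+ 2 = 3 * (eis_norm k)%:Z by move: s2; rewrite t2E; clear; lia.
have [v vE] : exists v, t1 = t0 + 3 * v.
  have h3 : (3%:Z %| (t1 - t0) ^+ 2)%Z.
    by apply/dvdzP; exists ((eis_norm k)%:Z - t0 * t1); move: q; clear; lia.
  have : (3%:Z %| t1 - t0)%Z by move: h3; rewrite !dvdzE abszX Euclid_dvdX // => /andP[].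
  by move=> /dvdzP[v vE]; exists v; move: vE; clear; lia.
have hX : t0 ^+ 2 + 3 * (t0 + 2 * v) ^+ 2 = 4 * (eis_norm k)%:Z by move: q; rewrite vE; clear; lia.
have hm : 1 + 3 * (2 * k%:Z + 1) ^+ 2 = 4 * (eis_norm k)%:Z by rewrite pE; clear; lia.
have hk : k = (odd k + (k./2).*2)%N by rewrite odd_double_half.
have fin (d u : int) : (d = 1 \/ d = -1) -> t0 = d * u ->
   (u = 3 * k%:Z + 2 \/ u = - (3 * k%:Z + 1)) ->
   (t1 = - d /\ t2 = - d * (u - 1)) \/ (t1 = - d * (u - 1) /\ t2 = - d).
  move=> dd t0E uE.
  have : (t1 + d) * (t1 + d * (u - 1)) = 0.
    have d2 : d ^+ 2 = 1 by case: dd => ->.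
    transitivity (t0 ^+ 2 + t0 * t1 + t1 ^+ 2 - (d ^+ 2) * (u ^+ 2 - u + 1)).
      by rewrite t0E; ring.
    by rewrite q d2 pE; case: uE => ->; ring.
  move=> /eqP; rewrite mulf_eq0 => /orP[] /eqP h; [left|right].
    by split; [|rewrite t2E t0E]; move: h; clear; lia.
  by split; [|rewrite t2E t0E]; move: h; clear; lia.
have := norm_form_unique pp hX hm (ex_intro _ a aE).
rewrite /e; case: (boolP (odd k)) hk => ok hk;
  case=> h.
- by exfalso; move: h hk aE; clear; lia.
- exists 1; [by left|]; have t0E : t0 = 1 * (- (3 * k%:Z + 1)) by move: h; clear; lia.
  split; first by rewrite /trace_value /=.
  by have [||[-> ->]|[-> ->]] := fin 1 _ _ t0E; [left|right|right|left]; rewrite /trace_value /=; clear; lia.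
- exists (-1); [by right|]; have t0E : t0 = -1 * (- (3 * k%:Z + 1)) by move: h; clear; lia.
  split; first by rewrite /trace_value /=.
  by have [||[-> ->]|[-> ->]] := fin (-1) _ _ t0E; [right|right|right|left]; rewrite /trace_value /=; clear; lia.
- by exfalso; move: h hk aE; clear; lia.
- exists 1; [by left|]; have t0E : t0 = 1 * (3 * k%:Z + 2) by move: h; clear; lia.
  split; first by rewrite /trace_value /=.
  by have [||[-> ->]|[-> ->]] := fin 1 _ _ t0E; [left|left|left|right]; rewrite /trace_value /=; clear; lia.
- by exfalso; move: h hk aE; clear; lia.
- by exfalso; move: h hk aE; clear; lia.
- exists (-1); [by right|]; have t0E : t0 = -1 * (3 * k%:Z + 2) by move: h; clear; lia.
  split; first by rewrite /trace_value /=.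
  by have [||[-> ->]|[-> ->]] := fin (-1) _ _ t0E; [right|left|left|right]; rewrite /trace_value /=; clear; lia.
Qed.

Lemma prim_root3 (K : fieldType) (x : K) :
  x ^+ 2 + x + 1 = 0 -> x != 1 -> 3.-primitive_root x.
Proof.
move=> xE x1; have x3 : x ^+ 3 = 1.
  by apply/eqP; rewrite -subr_eq0; apply/eqP; transitivity ((x - 1) * (x ^+ 2 + x + 1));
    [ring|rewrite xE mulr0].
have [m mP m3] := prim_order_exists (ltn0Sn 2) x3.
have [_ /(_ m m3) /orP[] /eqP m1] := primeP (isT : prime 3); last by rewrite -m1.
by move: x1; rewrite -[x]expr1 -m1 (prim_expr_order mP) eqxx.
Qed.

Lemma eis_norm_pred k : (eis_norm k = (3 * (k * k.+1)).+1)%N.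
Proof. by rewrite /eis_norm; lia. Qed.

Lemma odd_eis_norm k : odd (eis_norm k).
Proof. by rewrite eis_norm_pred /= !oddM /= andbN. Qed.

(** The exponent [e] for which [trace_value k e] is even, hence the one belonging to [T 1]. *)
Definition eis_shift (k : nat) : nat := if odd k then 1 else 2.

Section EisensteinPrime.
Variable k : nat.
Hypothesis p_pr : prime (eis_norm k).
Local Notation p := (eis_norm k).
Local Notation F := 'F_p.
Local Notation r := ((3 * k + 1)%:R : F).

Let n := (k * k.+1)./2.

Let n2 : (2 * n = k * k.+1)%N.
Proof. by rewrite mul2n /n halfK oddM /= andbN subn0. Qed.

Lemma eis_norm_gt0 : (0 < k)%N.
Proof. by move: p_pr; case: k. Qed.

Lemma card_eis_field : #|F|.-1 = (6 * n)%N.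
Proof. by rewrite card_Fp // eis_norm_pred /= -n2 mulnA. Qed.

Lemma natr_eis_eq0 (m : nat) : (m%:R == 0 :> F) = (p %| m)%N.
Proof. by rewrite (dvdn_pcharf (pchar_Fp p_pr)). Qed.

Lemma natr_eis_neq0 (m : nat) : (0 < m < p)%N -> m%:R != 0 :> F.
Proof. by move=> /andP[m0 mp]; rewrite natr_eis_eq0 gtnNdvd. Qed.

(** For [r = 3k + 1] one has [r^2 + r + 1 = 3p]. *)
Lemma eis_rootP : 3.-primitive_root r.
Proof.
apply: prim_root3.
  rewrite -natrX -natrD -[1]/(1%:R) -natrD; apply/eqP; rewrite natr_eis_eq0.
  by apply/dvdnP; exists 3%N; rewrite /eis_norm; lia.
rewrite natrD -subr_eq0 addrK natr_eis_neq0 //.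
by have := eis_norm_gt0; rewrite /eis_norm; lia.
Qed.

Lemma eis_generator : exists c : F, c ^+ (2 * n) = r.
Proof.
have Fd : #|F|.-1 = (2 * n * 3)%N by rewrite card_eis_field; lia.
by apply: (expf_eq1_root Fd); exact: prim_expr_order eis_rootP.
Qed.

Lemma trace_valueF (e : nat) : (trace_value k e)%:~R = - r ^+ e :> F.
Proof.
have r3 := prim_expr_order eis_rootP.
have re : r ^+ e = r ^+ (e %% 3) by rewrite -(expr_mod _ r3).
have r2 : r ^+ 2 = - (3 * k + 2)%:R.
  apply/eqP; rewrite -subr_eq0 opprK -natrX -natrD natr_eis_eq0.
  by apply/dvdnP; exists 3%N; rewrite /eis_norm; lia.
rewrite re /trace_value; case: (e %% 3)%N (ltn_pmod e (isT : 0 < 3)%N) => [|[|[]]] // _.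

- by rewrite expr1 rmorphN /= natrD rmorphD rmorphM /= natrM -!pmulrn.
- by rewrite r2 opprK natrD rmorphD rmorphM /= natrM -!pmulrn.
Qed.

Lemma trace_valueF_inj (e e' : nat) :
  (trace_value k e)%:~R = (trace_value k e')%:~R :> F -> e = e' %[mod 3].
Proof.
by rewrite !trace_valueF => /oppr_inj /eqP; rewrite (eq_prim_root_expr eis_rootP) => /eqP.
Qed.

Lemma trace_value_inj (e e' : nat) : trace_value k e = trace_value k e' -> e = e' %[mod 3].
Proof. by move=> h; apply: trace_valueF_inj; rewrite h. Qed.

Let T := @square_trace F.

Lemma square_trace4_mod9 : exists j : int, T 4 = p%:Z - 8 - 9 * j.
Proof.
have [c cP] := eis_generator.
have := square_trace4_card card_eis_field; rewrite card_Fp //.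
have := card_cube_products card_eis_field eis_rootP.
move: #|_| => m m3 h; exists (m %/ 3)%N%:Z.
rewrite -[LHS](subKr p%:Z) {}h {1}(divn_eq m 3) m3 /=.
by move: (m %/ 3)%N => q; clear; lia.
Qed.

Lemma square_trace_value_exists (h : F) : h != 0 ->
  (exists e, T h = trace_value k e) /\ T 1 = trace_value k (eis_shift k).
Proof.
move=> h0; have [c cP] := eis_generator; have Fn := card_eis_field.
have r0 : r != 0.
  apply/eqP => rz; move: (prim_expr_order eis_rootP).
  by rewrite rz expr0n /= => /esym/eqP; rewrite oner_eq0.
have c0 : c != 0.
  apply/eqP => cz; move: r0; rewrite -cP cz expr0n muln_eq0 /=.
  by have := card_finField_gt0 F; rewrite Fn; case: n => //= m _; rewrite eqxx.
have cls (u : F) : u != 0 -> exists i : 'I_3, T u = T (c ^+ i).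
  move=> u0; have [i iE] := cubic_class Fn eis_rootP u0; exists i.
  have ci0 : c ^+ i != 0 by rewrite expf_neq0.
  by apply: (square_trace_class Fn u0 ci0); rewrite iE -exprM [(i * _)%N]mulnC (exprM c) cP.
have [|||d dd [t0 t12]] := @trace_triple k (T 1) (T c) (T (c ^+ 2)) p_pr.
- exact: (sum_square_trace Fn eis_rootP cP).
- by rewrite (sum_square_trace_sqr Fn eis_rootP cP) card_Fp.
- exact: (square_trace1_even Fn eis_rootP).
have vals (u : F) : u != 0 -> exists e, T u = d * trace_value k e.
  move=> /cls [i ->]; case: i => [[|[|[]]]] //= _; rewrite ?expr0 ?expr1.
  - by eexists; exact: t0.
  - by case: t12 => -[-> _]; eexists.
  - by case: t12 => -[_ ->]; eexists.
have four0 : (4 : F) != 0.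
  by rewrite natr_eis_neq0 // /eis_norm; have := eis_norm_gt0; lia.
(* Every [trace_value] is 2 modulo 3, and so is [T 4], as [p] is 1 modulo 3; this excludes
   [d = -1]. *)
have d1 : d = 1.
  have [e eE] := vals _ four0; have [j jE] := square_trace4_mod9.
  case: dd => // dN; exfalso; move: jE; rewrite eE dN /eis_norm /trace_value.
  by case: (e %% 3)%N => [|[|?]]; clear; lia.
split; first by have [e ->] := vals h h0; exists e; rewrite d1 mul1r.
by rewrite t0 d1 mul1r.
Qed.

(** By [square_trace_binomial], [T h] and [T 1 * h^(2n)] agree in [F], and the three possible values
    are distinct modulo [p]. *)
Lemma square_trace_value (h : F) (i : nat) : h != 0 -> h ^+ (k * k.+1) = r ^+ i ->
  T h = trace_value k (eis_shift k + i).
Proof.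
move=> h0 hi; have [[e eE] t1] := square_trace_value_exists h0.
have := square_trace_binomial card_eis_field eis_rootP h.
have := square_trace_binomial card_eis_field eis_rootP (1 : F).
rewrite expr1n mulr1 => <-; rewrite n2 hi -/T t1 eE trace_valueF trace_valueF mulNr.
move=> /oppr_inj /eqP; rewrite -exprD (eq_prim_root_expr eis_rootP) => /eqP ee.
by rewrite -trace_value_mod3 ee trace_value_mod3.
Qed.

(** Modulo 9 this trace is [p + 1], and exactly one of the three values has that residue; which one
    depends on [k] modulo 3. *)
Lemma square_trace4 : T 4 = trace_value k (k + 2).
Proof.
have four0 : (4 : F) != 0.
  by rewrite natr_eis_neq0 // /eis_norm; have := eis_norm_gt0; lia.
have [[e eE] _] := square_trace_value_exists four0.
have [j jE] := square_trace4_mod9; rewrite eE -trace_value_mod3 -[RHS]trace_value_mod3.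
move: jE; rewrite eE -trace_value_mod3.
have k3 : (k %% 3 < 3)%N by rewrite ltn_mod.
have e3 : (e %% 3 < 3)%N by rewrite ltn_mod.
have := divn_eq k 3; rewrite -(modnDml k); move: (k %/ 3)%N k3 e3 => l.
case: (k %% 3)%N => [|[|[|//]]] _; case: (e %% 3)%N => [|[|[|//]]] _ kE;
  rewrite /trace_value kE /eis_norm /=; clear; lia.
Qed.

(** No [T h] equals 1, which excludes squares. For a nonresidue [g] with cubic symbol [r^i] the sum
    is [T (g^2)], and it is -1 when [eis_shift k + 2 i = 0] modulo 3, that is, when
    [i = eis_shift k] modulo 3. *)
Lemma mordell_sum_eqN1 (g : F) : g != 0 ->
  (mordell_sum g = -1) <-> qchar g = -1 /\ g ^+ (k * k.+1) = r ^+ eis_shift k.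
Proof.
move=> g0; have Fn := card_eis_field.
have F2 : #|F|.-1 = (2 * (3 * n))%N by rewrite Fn; lia.
have nsq (h : F) : h != 0 -> mordell_sum (h ^+ 2) != -1.
  move=> h0; have [[e eE] _] := square_trace_value_exists h0.
  have -> : mordell_sum (h ^+ 2) = - T h by rewrite /T /square_trace opprK.
  rewrite eE /trace_value; have := eis_norm_gt0.
  by case: (e %% 3)%N => [|[|?]]; lia.
have [q1|qN1] := qchar_neq0 g0.
  split; last by case; rewrite q1.
  have /(expf_eq1_root F2)[h hE] : g ^+ (3 * n) = 1.
    by apply/eqP; rewrite -(qchar_eq1 F2) q1.
  have h0 : h != 0 by apply: contra_neq g0 => h0; rewrite -hE h0 expr0n.
  by rewrite -hE => /eqP; rewrite (negPf (nsq h h0)).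
have -> : mordell_sum g = T (g ^+ 2).
  rewrite /T /square_trace -exprM -[(2 * 2)%N]/(1 + 3)%N exprD expr1.
  by rewrite (mordell_sum_twist Fn) // qN1 mulN1r opprK.
have [i iE] := cubic_class Fn eis_rootP g0; rewrite n2 in iE.
have -> : T (g ^+ 2) = trace_value k (eis_shift k + i * 2).
  apply: square_trace_value; first by rewrite expf_neq0.
  by rewrite -(exprM g) [(2 * _)%N]mulnC (exprM g) iE -exprM.
have -> : (-1 = trace_value k 0) by [].
rewrite iE; split=> [/trace_value_inj h|[_ /eqP]].
  split=> //; apply/eqP; rewrite (eq_prim_root_expr eis_rootP).
  by move: h; rewrite /eis_shift; case: ifP => _; case: i {iE} => [[|[|[]]]].
rewrite (eq_prim_root_expr eis_rootP) => h.
rewrite -trace_value_mod3; congr trace_value.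
by move: h; rewrite /eis_shift; case: ifP => _; case: i {iE} => [[|[|[]]]].
Qed.

End EisensteinPrime.

(** * Gauss sums and quadratic reciprocity *)

Section GaussSums.
Variables (F : finFieldType) (L : fieldType) (psi : F -> L).
Hypothesis psiD : forall x y, psi (x + y) = psi x * psi y.
Hypothesis psi0 : psi 0 = 1.
Hypothesis sum_psi : \sum_(x : F) psi x = 0.

Definition mult_char (chi : F -> L) : Prop :=
  [/\ chi 0 = 0, chi 1 = 1 & {morph chi : x y / x * y}].

Definition gauss_sum (chi : F -> L) : L := \sum_(x : F) chi x * psi x.

Definition jacobi_sum (chi : F -> L) : L := \sum_(x : F) chi (x * (1 - x)).

Lemma sum_psi_mul (a : F) : \sum_(y : F) psi (y * a) = if a == 0 then #|F|%:R else 0.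
Proof.
case: eqVneq => [->|a0].
  by under eq_bigr do rewrite mulr0 psi0; rewrite sumr_const.
by under eq_bigr do rewrite mulrC; rewrite sum_mulf.
Qed.

Lemma psi_natmul (m : nat) (x : F) : psi (m%:R * x) = psi x ^+ m.
Proof.
elim: m => [|m IH]; first by rewrite mul0r psi0 expr0.
by rewrite -natr1 mulrDl mul1r psiD IH exprSr.
Qed.

Lemma gauss_sum_scale (chi : F -> L) (a : F) : mult_char chi -> a != 0 ->
  chi a * \sum_(x : F) chi x * psi (a * x) = gauss_sum chi.
Proof.
move=> [_ _ chiM] a0; rewrite mulr_sumr [RHS](_ : _ = \sum_(x : F) chi (a * x) * psi (a * x)).
  by apply: eq_bigr => x _; rewrite mulrA chiM.
by rewrite (sum_mulf (fun x => chi x * psi x)).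
Qed.

(** Put [x = t y]. The sum of psi(y(t + 1)) over nonzero [y] is -1 unless [t = -1], and these -1
    cancel since [chi] sums to 0. *)
Lemma gauss_sum_mul_inv (chi chi' : F -> L) : mult_char chi -> chi' 0 = 0 ->
  (forall x, x != 0 -> chi x * chi' x = 1) -> \sum_(x : F) chi x = 0 ->
  gauss_sum chi * gauss_sum chi' = chi (-1) * #|F|%:R.
Proof.
move=> [chi0 chi1 chiM] chi'0 chiV chis.
have -> : gauss_sum chi * gauss_sum chi' =
    \sum_(t : F) chi t * \sum_(y : F | y != 0) psi (y * (t + 1)).
  rewrite /gauss_sum [in X in _ * X](bigD1 0) //= chi'0 mul0r add0r mulr_sumr.
  under [RHS]eq_bigr do rewrite mulr_sumr.
  rewrite [RHS]exchange_big /=; apply: eq_bigr => y y0.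
  rewrite mulr_suml -(sum_mulf _ y0); apply: eq_bigr => t _.
  rewrite chiM mulrDr mulr1 psiD -[RHS]mul1r -(chiV y y0); ring.
rewrite (eq_bigr (fun t => chi t * (if t == -1 then #|F|%:R else 0) - chi t)).
  rewrite sumrB chis subr0 (bigD1 (-1)) //= eqxx big1 ?addr0 // => t /negPf ->.
  by rewrite mulr0.
move=> t _; rewrite sumr_neq0 mul0r psi0 sum_psi_mul addr_eq0.
by rewrite mulrBr mulr1.
Qed.

(** Collect terms by [s = x + y]: scaling by a nonzero [s] produces the Jacobi sum, and [s = 0]
    contributes a multiple of the vanishing sum of [chi^2]. *)
Lemma gauss_sum_sqr (chi : F -> L) : mult_char chi -> \sum_(x : F) chi x ^+ 2 = 0 ->
  gauss_sum chi ^+ 2 = jacobi_sum chi * gauss_sum (fun x => chi x ^+ 2).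
Proof.
move=> [chi0 chi1 chiM] chis.
have -> : gauss_sum chi ^+ 2 = \sum_(s : F) psi s * \sum_(x : F) chi x * chi (s - x).
  rewrite expr2 /gauss_sum mulr_suml.
  under [RHS]eq_bigr do rewrite mulr_sumr.
  rewrite [RHS]exchange_big /=; apply: eq_bigr => x _.
  rewrite -[RHS](sum_addf _ x) mulr_sumr; apply: eq_bigr => y _.
  by rewrite addrK psiD; ring.
rewrite /gauss_sum mulr_sumr (bigD1 0) //= [RHS](bigD1 0) //= chi0 expr0n /= mul0r mulr0 add0r.
have -> : \sum_(x : F) chi x * chi (0 - x) = 0.
  transitivity (chi (-1) * \sum_(x : F) chi x ^+ 2); last by rewrite chis mulr0.
  rewrite mulr_sumr; apply: eq_bigr => x _.
  by rewrite sub0r -[- x]mulN1r chiM expr2 mulrCA.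
rewrite mulr0 add0r; apply: eq_bigr => s s0.
rewrite -(sum_mulf _ s0) /jacobi_sum mulr_suml mulr_sumr; apply: eq_bigr => x _.
have -> : s - s * x = s * (1 - x) by ring.
by rewrite !chiM; ring.
Qed.

End GaussSums.

Section FrobeniusGaussSum.
Variables (F : finFieldType) (L : fieldType) (psi : F -> L) (q : nat).
Hypothesis psiD : forall x y, psi (x + y) = psi x * psi y.
Hypothesis psi0 : psi 0 = 1.
Hypothesis qL : q \in [pchar L].
Hypothesis qF : q%:R != 0 :> F.

(** In characteristic [q] the [q]-th power is additive, and it turns [psi x] into [psi (q x)]. *)
Lemma gauss_sum_Frobenius (chi chi' : F -> L) : mult_char chi' ->
  (forall x, chi x ^+ q = chi' x) ->
  chi' q%:R * gauss_sum psi chi ^+ q = gauss_sum psi chi'.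
Proof.
move=> chi'P chiq; rewrite -(gauss_sum_scale psi chi'P qF); congr (_ * _).
rewrite -(pFrobenius_autE qL) /gauss_sum rmorph_sum /=; apply: eq_bigr => x _.
by rewrite rmorphM /= !pFrobenius_autE chiq psi_natmul.
Qed.

End FrobeniusGaussSum.

Section AdditiveCharacter.
Variables (p : nat) (L : fieldType) (z : L).
Hypothesis p_pr : prime p.
Hypothesis zP : p.-primitive_root z.

Definition Fp_char (x : 'F_p) : L := z ^+ (x : nat).

Lemma Fp_charD (x y : 'F_p) : Fp_char (x + y) = Fp_char x * Fp_char y.
Proof.
have E m : (m %% (Zp_trunc (pdiv p)).+2 = m %% p)%N by rewrite Fp_cast.
by rewrite /Fp_char -exprD; apply/eqP; rewrite (eq_prim_root_expr zP) /= E modn_mod.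
Qed.

Lemma Fp_char0 : Fp_char 0 = 1.
Proof. by rewrite /Fp_char expr0. Qed.

Lemma sum_Fp_char : \sum_(x : 'F_p) Fp_char x = 0.
Proof.
have := sum_addf Fp_char (1 : 'F_p).
under eq_bigr do rewrite Fp_charD.
rewrite -mulr_suml => /eqP; rewrite -[X in _ == X]mulr1 -subr_eq0 -mulrBr mulf_eq0.
case/orP => [/eqP //|]; rewrite subr_eq0 /Fp_char -(prim_order_dvd zP) => /dvdn_leq.
have -> : nat_of_ord (1 : 'F_p) = 1%N by [].
by move=> /(_ isT); have := prime_gt1 p_pr; lia.
Qed.

End AdditiveCharacter.

Section QuadraticReciprocity.
Variables (p q : nat) (L : fieldType) (z : L).
Hypotheses (p_pr : prime p) (p_odd : odd p).
Hypothesis zP : p.-primitive_root z.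
Hypothesis qL : q \in [pchar L].
Hypotheses (q_odd : odd q) (pq : p != q).

(** For the quadratic Gauss sum [G], the base on the left is [G^2], while Frobenius gives
    [G^q = chi(q) G]. *)
Lemma Euler_quadratic_reciprocity :
  ((qchar (-1 : 'F_p))%:~R * p%:R) ^+ (q.-1)./2 = (qchar (q%:R : 'F_p))%:~R :> L.
Proof.
have q_pr := pcharf_prime qL.
pose F := 'F_p; pose m := p./2.
have F2 : #|F|.-1 = (2 * m)%N.
  by rewrite card_Fp // -(odd_double_half p) p_odd /= -mul2n.
pose chi (x : F) : L := (qchar x)%:~R.
have chiP : mult_char chi.
  split; rewrite /chi ?qchar0 ?(qchar1 F2) // => x y.
  by rewrite (qcharM F2) rmorphM.
have chiN (x : F) : x != 0 -> chi x ^+ 2 = 1.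
  by move=> x0; rewrite /chi -rmorphXn /= qchar_sqr_eq1.
have qF : q%:R != 0 :> F.
  by rewrite -(dvdn_pcharf (pchar_Fp p_pr)) dvdn_prime2.
have chiq (x : F) : chi x ^+ q = chi x.
  have [->|x0] := eqVneq x 0.
    by rewrite /chi qchar0 expr0n gtn_eqF // prime_gt0.
  by rewrite -(odd_double_half q) q_odd exprD expr1 -mul2n exprM chiN // expr1n mulr1.
have sum_chi : \sum_(x : F) chi x = 0.
  by rewrite -rmorph_sum /= (sum_qchar F2).
have G2 := gauss_sum_mul_inv (Fp_charD p_pr zP) (Fp_char0 p z) (sum_Fp_char p_pr zP) chiP
  (_ : chi 0 = 0) (fun x x0 => chiN x x0) sum_chi.
have {}G2 := G2 (_ : _); rewrite card_Fp // in G2.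
have Gq := gauss_sum_Frobenius (Fp_charD p_pr zP) (Fp_char0 p z) qL qF chiP chiq.
set G := gauss_sum _ _ in G2 Gq.
have pL : p%:R != 0 :> L.
  by rewrite -(dvdn_pcharf qL) dvdn_prime2 // eq_sym.
have G0 : G != 0.
  apply/eqP => Gz; move: G2; rewrite /chi qchar0 Gz mul0r => /(_ erefl)/esym/eqP.
  rewrite mulf_eq0 (negPf pL) orbF; apply/negP.
  by rewrite -/(chi _) -sqrf_eq0 chiN ?oner_eq0 // oppr_eq0 oner_eq0.
rewrite -G2; last by rewrite /chi qchar0.
rewrite -expr2 -exprM; apply: (mulfI G0); rewrite -exprS.
have -> : (2 * (q.-1)./2).+1 = q.
  by have := odd_double_half q; rewrite q_odd -mul2n; clear; lia.
transitivity (chi q%:R * (chi q%:R * G ^+ q)); last by rewrite Gq mulrC.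
by rewrite mulrA -expr2 chiN // mul1r.
Qed.

End QuadraticReciprocity.

(** * Cubic reciprocity *)

Section CubicCharacter.
Variables (F : finFieldType) (L : fieldType) (n : nat) (r c : F) (w : L).
Hypothesis Fn : #|F|.-1 = (6 * n)%N.
Hypothesis rP : 3.-primitive_root r.
Hypothesis cr : c ^+ (2 * n) = r.
Hypothesis wP : 3.-primitive_root w.

Let F2 : #|F|.-1 = (2 * (3 * n))%N. Proof. by rewrite Fn mulnA. Qed.
Let F3 : #|F|.-1 = (3 * (2 * n))%N. Proof. by rewrite Fn mulnA. Qed.
Let n_gt0 : (0 < n)%N.
Proof. by have := card_finField_gt0 F; rewrite Fn; case: n. Qed.

Definition cubic_log (x : F) : nat :=
  if x ^+ (2 * n) == 1 then 0 else if x ^+ (2 * n) == r then 1 else 2.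

Definition cubic_char (x : F) : L := if x == 0 then 0 else w ^+ cubic_log x.

Lemma cubic_char_class (x : F) i : x != 0 -> x ^+ (2 * n) = r ^+ i -> cubic_char x = w ^+ i.
Proof.
move=> /negPf x0 xi; rewrite /cubic_char x0 /cubic_log xi.
apply/eqP; rewrite (eq_prim_root_expr wP).
have := eq_prim_root_expr rP i 1; rewrite expr1 => ->.
rewrite -(prim_order_dvd rP) /dvdn; move: (ltn_pmod i (isT : 0 < 3)%N).
by case: (i %% 3)%N => [|[|[]]].
Qed.

Let r0 : r != 0.
Proof.
apply/eqP => rz; move: (prim_expr_order rP).
by rewrite rz expr0n /= => /esym/eqP; rewrite oner_eq0.
Qed.

Let c0 : c != 0.
Proof.
by apply/eqP => cz; move: r0; rewrite -cr cz expr0n; case: n n_gt0 => // k _; rewrite eqxx.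
Qed.

Lemma cubic_charP : mult_char cubic_char.
Proof.
split; first by rewrite /cubic_char eqxx.
  by rewrite (@cubic_char_class 1 0) ?oner_eq0 ?expr1n.
move=> x y; have [->|x0] := eqVneq x 0; first by rewrite mul0r /cubic_char eqxx mul0r.
have [->|y0] := eqVneq y 0; first by rewrite mulr0 /cubic_char eqxx mulr0.
have [i iE] := cubic_class Fn rP x0; have [j jE] := cubic_class Fn rP y0.
rewrite (cubic_char_class x0 iE) (cubic_char_class y0 jE) -exprD.
by apply: cubic_char_class; rewrite ?mulf_neq0 // exprMn iE jE exprD.
Qed.

Lemma cubic_char_c : cubic_char c = w.
Proof. by rewrite (@cubic_char_class c 1) ?expr1. Qed.

Lemma cubic_char_expr3 (x : F) : x != 0 -> cubic_char x ^+ 3 = 1.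
Proof.
move=> x0; rewrite /cubic_char (negPf x0) -exprM mulnC exprM (prim_expr_order wP).
by rewrite expr1n.
Qed.

Lemma sum_cubic_char_expr j : ~~ (3 %| j)%N -> \sum_(x : F) cubic_char x ^+ j = 0.
Proof.
move=> j3; have [_ _ chM] := cubic_charP.
have := sum_mulf (fun x => cubic_char x ^+ j) c0.
rewrite (eq_bigr (fun x => w ^+ j * cubic_char x ^+ j)); last first.
  by move=> x _; rewrite chM exprMn cubic_char_c.
rewrite -mulr_sumr => /eqP; rewrite -subr_eq0 -[X in _ - X]mul1r -mulrBl mulf_eq0.
by rewrite subr_eq0 -(prim_order_dvd wP) (negPf j3) => /eqP.
Qed.

Lemma cubic_charN1 : cubic_char (-1) = 1.
Proof.
rewrite (@cubic_char_class _ 0) ?expr0 ?oppr_eq0 ?oner_eq0 //.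
by rewrite exprM sqrrN !expr1n.
Qed.

Lemma sum_prim_root3 : \sum_(i < 3) w ^+ i = 0.
Proof.
have w1 : w - 1 != 0 by rewrite subr_eq0 -[w]expr1 -(prim_order_dvd wP).
apply: (mulfI w1); rewrite mulr0 !big_ord_recl big_ord0 /= /bump /=.
by transitivity (w ^+ 3 - 1); [ring|rewrite (prim_expr_order wP) subrr].
Qed.

(** Group by [a = x (1 - x)], which has 1 + qchar(1 - 4a) preimages, and split the nonzero [a] into
    classes [c^i v^3]. Each class yields a Mordell sum without its term [v = 0]; the missing 1
    cancel because 1 + w + w^2 = 0. *)
Lemma jacobi_sum_cubic :
  jacobi_sum cubic_char *+ 3 = - \sum_(i < 3) w ^+ i * (square_trace (4 * c ^+ i))%:~R.
Proof.
have [ch0 ch1 chM] := cubic_charP.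
have -> : jacobi_sum cubic_char
    = \sum_(a : F | a != 0) cubic_char a * (qchar (1 - 4 * a))%:~R.
  transitivity (\sum_(a : F) cubic_char a * (1 + qchar (1 - 4 * a))%:~R).
    rewrite /jacobi_sum (partition_big (fun x => x * (1 - x)) xpredT) //=.
    apply: eq_bigr => a _; rewrite -(card_sub_sqr Fn) -sum1_card.
    rewrite -pmulrn natr_sum mulr_sumr; apply: eq_big => x.
      by rewrite unfold_in /= mulrBr mulr1 expr2.
    by move=> /eqP ->; rewrite mulr1.
  under eq_bigr do rewrite rmorphD mulrDr rmorph1 mulr1.
  have sum_chi : \sum_(x : F) cubic_char x = 0 := @sum_cubic_char_expr 1 isT.
  by rewrite big_split /= sum_chi add0r (bigD1 0) //= ch0 mul0r add0r.
rewrite (sum_cubic_classes3 Fn rP cr).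
have -> : - \sum_(i < 3) w ^+ i * (square_trace (4 * c ^+ i))%:~R
   = \sum_(i < 3) w ^+ i * (mordell_sum (16 * (c ^+ i) ^+ 2) - 1)%:~R.
  under [RHS]eq_bigr do rewrite rmorphB mulrBr rmorph1 mulr1.
  rewrite sumrB sum_prim_root3 subr0 -sumrN; apply: eq_bigr => i _.
  rewrite /square_trace exprMn -natrX rmorphN mulrN opprK //.
apply: eq_bigr => i _; have ci0 : c ^+ i != 0 by rewrite expf_neq0.
rewrite (mordell_sum_sqr_scaled Fn ci0) [in RHS](bigD1 0) //= expr0n /= mulr0 mulr0 subr0.
rewrite (qchar1 F2) addrAC subrr add0r rmorph_sum mulr_sumr /=.
apply: eq_bigr => v v0; congr (_ * _).
rewrite chM (cubic_char_class (i := i)) //; last by rewrite -exprM mulnC exprM cr.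
by rewrite (cubic_char_class (i := 0)) ?expf_neq0 ?mulr1 // (expf_root_eq1 F3).
Qed.

End CubicCharacter.

(** The image in [K] of an element of Z[w] of norm [eis_norm k]; [eis_num (w ^+ 2) k] is its
    conjugate. *)
Definition eis_num (K : fieldType) (w : K) (k : nat) : K := (k + 1)%:R + (2 * k + 1)%:R * w.

Lemma eis_numE (K : fieldType) (w : K) (k : nat) :
  eis_num w k = (k%:R + 1) + (2 * k%:R + 1) * w.
Proof. by congr (_ + _ * _); rewrite addn1 -[LHS]natr1 ?natrM. Qed.

Lemma sum_mod3 (V : zmodType) (f : nat -> V) (s : nat) :
  \sum_(i < 3) f ((s + i) %% 3)%N = f 0 + f 1 + f 2.
Proof.
under eq_bigr do rewrite -modnDml.
have : (s %% 3 < 3)%N by rewrite ltn_mod.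
rewrite !big_ord_recl big_ord0; case: (s %% 3)%N => [|[|[|//]]] _.
- by transitivity (f 0 + (f 1 + (f 2 + 0))); rewrite // addr0 addrA.
- by transitivity (f 1 + (f 2 + (f 0 + 0))); rewrite // addr0 addrA addrC addrA.
- by transitivity (f 2 + (f 0 + (f 1 + 0))); rewrite // addr0 addrC.
Qed.

Section EisensteinReciprocity.
Variables (k q : nat) (L : fieldType) (w : L).
Hypothesis p_pr : prime (eis_norm k).
Hypothesis wP : 3.-primitive_root w.
Local Notation p := (eis_norm k).
Local Notation F := 'F_p.
Local Notation r := ((3 * k + 1)%:R : F).
Let n := (k * k.+1)./2.
Let n2 : (2 * n = k * k.+1)%N.
Proof. by rewrite mul2n /n halfK oddM /= andbN subn0. Qed.
Let chi : F -> L := cubic_char n r w.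

Let w3 : w ^+ 3 = 1 := prim_expr_order wP.

Lemma prim_root3_eq0 : 1 + w + w ^+ 2 = 0.
Proof. by have := sum_prim_root3 wP; rewrite !big_ord_recl big_ord0 /= /bump /= addr0 addrA expr0 expr1. Qed.

Lemma prim_root3_three_neq0 : 3 != 0 :> L.
Proof.
have w1 : w - 1 != 0 by rewrite subr_eq0 -[w]expr1 -(prim_order_dvd wP).
apply: contraNneq w1 => h3; rewrite -sqrf_eq0.
have -> : (w - 1) ^+ 2 = (1 + w + w ^+ 2) - 3 * w by ring.
by rewrite prim_root3_eq0 h3 mul0r subr0.
Qed.

Lemma eis_num_norm : eis_num w k * eis_num (w ^+ 2) k = p%:R.
Proof.
have w2 : w ^+ 2 = - 1 - w by rewrite -[LHS]subr0 -prim_root3_eq0; ring.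
have -> : p%:R = 3 * k%:R ^+ 2 + 3 * k%:R + 1 :> L.
  by rewrite -natrX -!natrM -natrD natr1 /eis_norm addn1.
rewrite !eis_numE.
transitivity ((k%:R + 1) ^+ 2 + (k%:R + 1) * (2 * k%:R + 1) * (w + w ^+ 2)
   + (2 * k%:R + 1) ^+ 2 * w ^+ 3); first by ring.
by rewrite w3 w2; ring.
Qed.

(** The factor 4 in [jacobi_sum_cubic] brings in [square_trace4]: the traces are
    [trace_value k (k + 2 + i)], so multiplying by [w^(k+2)] aligns the powers of [w] with the
    exponents. The factor 3 cancels because a primitive cube root of unity excludes characteristic
    3. *)
Lemma jacobi_sum_eis : w ^+ (k + 2) * jacobi_sum chi = eis_num w k.
Proof.
have [c cP] := eis_generator p_pr; rewrite -/n in cP.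
have Fn := card_eis_field p_pr; have rP := eis_rootP p_pr.
have four0 : (4 : F) != 0.
  by rewrite natr_eis_neq0 // /eis_norm; have := eis_norm_gt0 p_pr; lia.
have [j jE] := cubic_class Fn rP four0; rewrite n2 in jE.
have c0 : c != 0.
  apply/eqP => cz; have := prim_expr_order rP.
  rewrite -cP cz -exprM expr0n !muln_eq0 /=; have := card_finField_gt0 F; rewrite Fn -/n.
  by case: n => //= m _ /esym/eqP; rewrite oner_eq0.
have tc (i : nat) : square_trace (4 * c ^+ i) = trace_value k (k + 2 + i).
  have -> : trace_value k (k + 2 + i) = trace_value k (eis_shift k + j + i).
    apply: trace_valueD; apply: (trace_value_inj p_pr).
    by rewrite -(square_trace4 p_pr) (square_trace_value p_pr four0 jE).
  rewrite -addnA; apply: square_trace_value => //; first by rewrite mulf_neq0 ?expf_neq0.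
  by rewrite exprMn jE -(exprM c) [(i * _)%N]mulnC (exprM c) -n2 cP -exprD.
apply: (mulfI prim_root3_three_neq0).
transitivity (w ^+ (k + 2) * (jacobi_sum chi *+ 3)); first by rewrite -mulr_natl; ring.
rewrite (jacobi_sum_cubic Fn rP cP wP) mulrN.
under eq_bigr do rewrite tc.
rewrite mulr_sumr.
have E i : w ^+ (k + 2) * (w ^+ i * (trace_value k (k + 2 + i))%:~R)
    = w ^+ ((k + 2 + i) %% 3) * (trace_value k ((k + 2 + i) %% 3))%:~R.
  by rewrite mulrA -exprD (expr_mod _ w3) trace_value_mod3.
under eq_bigr do rewrite E.
have w2 : w ^+ 2 = - 1 - w by rewrite -[LHS]subr0 -prim_root3_eq0; ring.
have t1 : (trace_value k 1)%:~R = - (3 * k%:R + 1) :> L.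
  by rewrite /trace_value /= rmorphN rmorphD rmorphM /= -!pmulrn.
have t2 : (trace_value k 2)%:~R = 3 * k%:R + 2 :> L.
  by rewrite /trace_value /= rmorphD rmorphM /= -!pmulrn.
have t0 : (trace_value k 0)%:~R = -1 :> L by rewrite /trace_value /= rmorphN1.
rewrite (sum_mod3 (fun j => w ^+ j * (trace_value k j)%:~R)).
rewrite t0 t1 t2 expr0 expr1 w2 eis_numE; ring.
Qed.

End EisensteinReciprocity.

Definition eis_ratio (K : fieldType) (w : K) (k : nat) : K := eis_num w k / eis_num (w ^+ 2) k.

(* The order of the group in which [eis_ratio] takes its values when [w] is a cube
   root of unity in characteristic [q]: the units of F_q if [q = 1 mod 3], and the
   elements of norm 1 of F_{q^2} if [q = 2 mod 3]. *)
Definition eis_ord (q : nat) : nat := if (q %% 3 == 1)%N then q.-1 else q.+1.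

(** For [q = 2] modulo 3, twice [eis_ord q / 3] stands for its negative, exponents being natural
    numbers. *)
Definition cubic_exp (q : nat) : nat :=
  if (q %% 3 == 1)%N then (q.-1 %/ 3)%N else (2 * (q.+1 %/ 3))%N.

Definition prime_star (q : nat) : int := (-1) ^+ (q.-1)./2 * q%:Z.

Lemma prime_mod3 q : prime q -> q != 3%N -> ((q %% 3 == 1) || (q %% 3 == 2))%N.
Proof.
move=> q_pr q3; have := ltn_mod q 3.
case E : (q %% 3)%N => [|[|[|//]]] // _.
by move: E => /eqP; rewrite -/(dvdn 3 q) dvdn_prime2 // eq_sym (negPf q3).
Qed.

Section EisensteinFrobenius.
Variables (k q : nat) (L : fieldType) (w : L).
Hypothesis wP : 3.-primitive_root w.
Hypothesis qL : q \in [pchar L].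
Let w3 : w ^+ 3 = 1 := prim_expr_order wP.

Lemma eis_num_Frobenius (v : L) : eis_num v k ^+ q = eis_num (v ^+ q) k.
Proof.
by rewrite -(pFrobenius_autE qL) rmorphD rmorphM !rmorph_nat /= pFrobenius_autE.
Qed.

Lemma eis_num_Frobenius1 : (q %% 3 = 1)%N ->
  eis_num w k ^+ q = eis_num w k /\ eis_num (w ^+ 2) k ^+ q = eis_num (w ^+ 2) k.
Proof.
by move=> q1; rewrite !eis_num_Frobenius -exprM mulnC exprM -(expr_mod _ w3) q1 expr1.
Qed.

Lemma eis_num_Frobenius2 : (q %% 3 = 2)%N ->
  eis_num w k ^+ q = eis_num (w ^+ 2) k /\ eis_num (w ^+ 2) k ^+ q = eis_num w k.
Proof.
move=> q2; rewrite !eis_num_Frobenius -exprM mulnC exprM -(expr_mod _ w3) q2 -exprM.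
by rewrite -[w ^+ (2 * 2)]/(w ^+ (1 + 3)) exprD w3 mulr1 expr1.
Qed.

Hypothesis q3 : q != 3%N.
Hypothesis p0 : (eis_norm k)%:R != 0 :> L.

Let q_pr : prime q := pcharf_prime qL.

Lemma eis_num_neq0 : eis_num w k != 0 /\ eis_num (w ^+ 2) k != 0.
Proof. by move: p0; rewrite -(eis_num_norm k wP) mulf_eq0 negb_or => /andP[]. Qed.

Lemma expf_fixed (x : L) m : x != 0 -> x ^+ m.+1 = x -> x ^+ m = 1.
Proof. by move=> x0; rewrite exprS => e; apply: (mulfI x0); rewrite e mulr1. Qed.

End EisensteinFrobenius.

Section CubicReciprocity.
Variables (k q : nat) (L : fieldType) (w z : L).
Hypothesis p_pr : prime (eis_norm k).
Hypothesis wP : 3.-primitive_root w.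
Hypothesis qL : q \in [pchar L].
Hypothesis q3 : q != 3%N.
Hypothesis pq : eis_norm k != q.
Local Notation p := (eis_norm k).
Local Notation r := ((3 * k + 1)%:R : 'F_p).
Hypothesis zP : p.-primitive_root z.
Let n := (k * k.+1)./2.
Let chi := cubic_char n r w.
Let q_pr : prime q := pcharf_prime qL.
Let p0 : p%:R != 0 :> L.
Proof. by rewrite -(dvdn_pcharf qL) dvdn_prime2 // eq_sym. Qed.

(** Here [G^3 = p J]. If [q = 1] modulo 3, Frobenius preserves [chi] and [chi(q) G^(q-1) = 1]; if
    [q = 2], it inverts [chi] and [G^(q+1) = chi(q) p]. Both are statements on powers of [G^3], from
    which the action of Frobenius on [eis_num] eliminates [p]. *)
Lemma cubic_reciprocity_aux :
  cubic_char n r w q%:R = (w ^+ (k + 2) * eis_ratio w k) ^+ cubic_exp q.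
Proof.
have Fn := card_eis_field p_pr; have rP := eis_rootP p_pr.
have [c cP] := eis_generator p_pr; rewrite -/n in Fn cP.
have w3 := prim_expr_order wP.
have chiP : mult_char chi := cubic_charP Fn rP wP.
have [chi0 chi1 chiM] := chiP.
have chi3 (x : 'F_p) : x != 0 -> chi x ^+ 3 = 1 by exact: cubic_char_expr3.
have chi2P : mult_char (fun x => chi x ^+ 2).
  by split; rewrite ?chi0 ?chi1 ?expr0n ?expr1n // => x y; rewrite chiM exprMn.
have chiV (x : 'F_p) : x != 0 -> chi x * chi x ^+ 2 = 1 by move=> /chi3; rewrite exprS.
have sum1 : \sum_(x : 'F_p) chi x = 0 := @sum_cubic_char_expr _ _ _ _ _ _ Fn rP cP wP 1 isT.
have sum2 : \sum_(x : 'F_p) chi x ^+ 2 = 0 := sum_cubic_char_expr Fn rP cP wP (isT : ~~ (3 %| 2)%N).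
have psiD := Fp_charD p_pr zP; have psi0 := Fp_char0 p z; have sum_psi := sum_Fp_char p_pr zP.
have GG := gauss_sum_mul_inv psiD psi0 sum_psi chiP (_ : chi 0 ^+ 2 = 0) chiV sum1.
have {}GG : gauss_sum (Fp_char z) chi * gauss_sum (Fp_char z) (fun x => chi x ^+ 2) = p%:R.
  rewrite GG ?chi0 ?expr0n // /chi (cubic_charN1 n rP wP) ?mul1r ?card_Fp //.
have G2 := gauss_sum_sqr psiD chiP sum2.
have qF : q%:R != 0 :> 'F_p by rewrite -(dvdn_pcharf (pchar_Fp p_pr)) dvdn_prime2.
have J := jacobi_sum_eis p_pr wP; rewrite -/n -/chi in J.
have N := eis_num_norm k wP.
have [a0 b0] := eis_num_neq0 wP p0.
set G := gauss_sum _ chi in GG G2 *; set G' := gauss_sum _ (fun x => chi x ^+ 2) in GG G2 *.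
have G0 : G != 0 by apply: contraNneq p0 => G0; rewrite -GG G0 mul0r.
set W := w ^+ (k + 2) in J *.
have W3 : W ^+ 3 = 1 by rewrite -exprM mulnC exprM w3 expr1n.
have G3 : G ^+ 3 = p%:R * (W ^+ 2 * eis_num w k).
  rewrite exprSr G2 -mulrA [G' * G]mulrC GG -J mulrC; congr (_ * _).
  by rewrite mulrA -exprSr W3 mul1r.
rewrite -/chi /cubic_exp; case: ifP (prime_mod3 q_pr q3) => [/eqP q1 _|_ /eqP q2].
  have chiq x : chi x ^+ q = chi x.
    have [->|x0] := eqVneq x 0; first by rewrite chi0 expr0n gtn_eqF // prime_gt0.
    by rewrite -(expr_mod _ (chi3 x x0)) q1.
  have := gauss_sum_Frobenius psiD psi0 qL qF chiP chiq; rewrite -/G => Gq.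
  have qE : (q = 3 * (q.-1 %/ 3) + 1)%N by have := divn_eq q 3; move: q1; clear; lia.
  have {Gq} : chi q%:R * (G ^+ 3) ^+ (q.-1 %/ 3) = 1.
    apply: (mulIf G0); rewrite mul1r -[RHS]Gq -mulrA -exprM -exprSr; congr (_ * G ^+ _).
    by move: qE; clear; lia.
  rewrite G3 -N; set m := (q.-1 %/ 3)%N => e.
  have [aq _] := eis_num_Frobenius1 k wP qL q1.
  have a3m : eis_num w k ^+ (3 * m) = 1 by apply: (expf_fixed a0); rewrite -addn1 -qE.
  rewrite -[LHS]mulr1; have <- : (W * eis_ratio w k) ^+ m *
      (eis_num w k * eis_num (w ^+ 2) k * (W ^+ 2 * eis_num w k)) ^+ m = 1.
    rewrite -exprMn -{}a3m exprM; congr (_ ^+ m); rewrite /eis_ratio.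
    transitivity (W ^+ 3 * eis_num w k ^+ 3); first by field.
    by rewrite W3 mul1r.
  by rewrite mulrCA e mulr1.
have chiq x : chi x ^+ q = chi x ^+ 2.
  have [->|x0] := eqVneq x 0; first by rewrite chi0 !expr0n gtn_eqF // prime_gt0.
  by rewrite -(expr_mod _ (chi3 x x0)) q2.
have := gauss_sum_Frobenius psiD psi0 qL qF chi2P chiq; rewrite -/G -/G' => Gq.
set m := (q.+1 %/ 3)%N.
have qE : (q.+1 = 3 * m)%N by have := divn_eq q 3; rewrite /m; move: q2; clear; lia.
have {Gq} : (G ^+ 3) ^+ m = chi q%:R * p%:R.
  rewrite -exprM -qE exprS -GG -[in RHS]Gq.
  transitivity (chi q%:R ^+ 3 * (G * G ^+ q)); last by ring.
  by rewrite chi3 // mul1r.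
have [aq bq] := eis_num_Frobenius2 k wP qL q2.
rewrite G3 -N => e; apply: (mulIf (mulf_neq0 a0 b0)); rewrite -e.
have bE : eis_num w k * eis_num (w ^+ 2) k = (eis_num (w ^+ 2) k ^+ m) ^+ 3.
  by rewrite -exprM [(m * _)%N]mulnC -qE (exprS _ q) bq mulrC.
rewrite [in RHS]bE [(2 * m)%N]mulnC exprM /eis_ratio !exprMn exprVn.
by field; rewrite expf_neq0.
Qed.

End CubicReciprocity.

(** The splitting field of [X^p - 1], separable because [p] is invertible in [K]. *)
Lemma exists_prim_root_ext (K : finFieldType) (p : nat) : p%:R != 0 :> K ->
  exists (L : fieldType) (f : {rmorphism K -> L}) (z : L), p.-primitive_root z.
Proof.
move=> p0; have p_gt0 : (0 < p)%N by case: p p0; rewrite ?eqxx.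
have Xp0 : 'X^p - 1 != 0 :> {poly K} by rewrite -size_poly_eq0 size_XnsubC.
have [L [rs prs _]] := FinSplittingFieldFor Xp0.
have {}prs : ('X^p - 1 : {poly L}) %= \prod_(x <- rs) ('X - x%:P).
  by move: prs; rewrite rmorphB rmorph1 /= map_polyXn.
have pL : p%:R != 0 :> L by rewrite -(rmorph_nat (in_alg L)) fmorph_eq0.
exists L, (in_alg L).
have urs : uniq rs.
  by rewrite -separable_prod_XsubC -(eqp_separable prs) separable_Xn_sub_1.
have ars : all p.-unity_root rs.
  by apply/allP => x; rewrite -root_prod_XsubC -(eqp_root prs).
have srs : (p <= size rs)%N.
  by rewrite -ltnS -(size_prod_XsubC rs id) -(eqp_size prs) size_Xn_sub_1.
by have /hasP[z _ zP] := has_prim_root p_gt0 ars urs srs; exists z.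
Qed.

Section FinFieldReciprocity.
Variables (k q : nat) (K : finFieldType) (w : K).
Hypothesis p_pr : prime (eis_norm k).
Hypothesis wP : 3.-primitive_root w.
Hypothesis qK : q \in [pchar K].
Hypothesis q3 : q != 3%N.
Hypothesis pq : eis_norm k != q.
Local Notation p := (eis_norm k).
Local Notation r := ((3 * k + 1)%:R : 'F_p).
Let n := (k * k.+1)./2.
Let q_pr : prime q := pcharf_prime qK.
Let p0 : p%:R != 0 :> K.
Proof. by rewrite -(dvdn_pcharf qK) dvdn_prime2 // eq_sym. Qed.

(** Both sides lie in [K], so the identity descends from the extension that contains the [p]-th
    roots of unity. *)
Theorem cubic_reciprocity :
  cubic_char n r w q%:R = (w ^+ (k + 2) * eis_ratio w k) ^+ cubic_exp q.
Proof.
have [L [f [z zP]]] := exists_prim_root_ext p0.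
have fwP : 3.-primitive_root (f w) by rewrite fmorph_primitive_root.
have qL : q \in [pchar L] by rewrite (fmorph_pchar f).
have e := cubic_reciprocity_aux p_pr fwP qL q3 pq zP.
apply: (fmorph_inj f); rewrite rmorphXn rmorphM rmorphXn.
have -> : f (eis_ratio w k) = eis_ratio (f w) k.
  have fn v : f (eis_num v k) = eis_num (f v) k.
    by rewrite /eis_num rmorphD rmorphM !rmorph_nat.
  by rewrite /eis_ratio fmorph_div !fn rmorphXn.
by rewrite -e /n /cubic_char; case: eqP => _; rewrite ?rmorph0 ?rmorphXn.
Qed.

(** In [K] the symbol is [p^((q-1)/2)], and [p] is the product of two conjugate values of [eis_num].
    Frobenius fixes or swaps them according to [q] modulo 3, which turns this power into one of
    their ratio. *)
Theorem quadratic_reciprocity : odd q ->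
  (qchar ((prime_star q)%:~R : 'F_p))%:~R = eis_ratio w k ^+ (eis_ord q)./2 :> K.
Proof.
move=> q_odd; have [L [f [z zP]]] := exists_prim_root_ext p0.
have qL : q \in [pchar L] by rewrite (fmorph_pchar f).
have p_odd := odd_eis_norm k.
have e := Euler_quadratic_reciprocity p_pr p_odd zP qL q_odd pq.
have F2 : #|'F_p|.-1 = (2 * (3 * n))%N by rewrite (card_eis_field p_pr) mulnA.
have s1 : qchar (-1 : 'F_p) ^+ 2 = 1 by rewrite qchar_sqr_eq1 // oppr_eq0 oner_eq0.
have -> : (qchar ((prime_star q)%:~R : 'F_p))%:~R = p%:R ^+ (q.-1)./2 :> K.
  apply: (fmorph_inj f); rewrite rmorphXn rmorph_nat rmorph_int.
  rewrite /prime_star intrM rmorphXn rmorphN1 (qcharM F2) (qcharX F2) -pmulrn.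
  rewrite intrM rmorphXn /= -e exprMn mulrA -exprMn -intrM -expr2 s1.
  by rewrite expr1n mul1r.
rewrite -(eis_num_norm k wP); have [a0 b0] := eis_num_neq0 wP p0.
set s := (q.-1)./2; have qE : q = (2 * s).+1.
  by have := odd_double_half q; rewrite q_odd /s -mul2n; clear; lia.
rewrite /eis_ord /eis_ratio; case: ifP (prime_mod3 q_pr q3) => [/eqP q1 _|_ /eqP q2].
  have [_ bq] := eis_num_Frobenius1 k wP qK q1.
  rewrite -/s expr_div_n exprMn; congr (_ * _).
  have : eis_num (w ^+ 2) k ^+ (2 * s) = 1 by apply: (expf_fixed b0); rewrite -qE.
  by rewrite mul2n -addnn exprD => h; apply: (mulIf (expf_neq0 s b0)); rewrite h mulVf // expf_neq0.
have [aq bq] := eis_num_Frobenius2 k wP qK q2.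
have -> : (q.+1)./2 = s.+1 by rewrite qE mul2n -doubleS doubleK.
apply: (mulIf (expf_neq0 s.+1 b0)); rewrite expr_div_n divfK ?expf_neq0 //.
rewrite exprMn -mulrA -exprD (_ : (s + s.+1)%N = q) ?bq ?exprSr //.
by rewrite [RHS]qE mul2n -addnn addnS.
Qed.

End FinFieldReciprocity.

(** * Local symbols *)

Lemma Frobenius_fixed_nat (K : fieldType) (q : nat) (x : K) : q \in [pchar K] ->
  x ^+ q = x -> exists m : nat, x = m%:R.
Proof.
move=> qK xq; have q_pr := pcharf_prime qK; have q1 := prime_gt1 q_pr.
pose rs : seq K := [seq m%:R | m <- iota 0 q].
have urs : uniq rs.
  rewrite map_inj_in_uniq ?iota_uniq // => i j; rewrite !mem_iota /= !add0n => iq jq.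
  wlog ij : i j iq jq / (i <= j)%N.
    by move=> h; case: (leqP i j) => [|/ltnW] ij e; [exact: h|apply/esym/h].
  move=> /eqP; rewrite eq_sym -subr_eq0 -natrB // -(dvdn_pcharf qK) => /dvdn_leq h.
  by case: (posnP (j - i)) => [|/h]; move: ij jq; clear; lia.
have [/mapP[m _ ->]|xrs] := boolP (x \in rs); first by exists m.
have szX : size ('X^q - 'X : {poly K}) = q.+1.
  by rewrite size_polyDl ?size_polyXn // size_polyN size_polyX.
have X0 : 'X^q - 'X != 0 :> {poly K} by rewrite -size_poly_eq0 szX.
have := max_poly_roots X0 (_ : all (root _) (x :: rs)) (_ : uniq (x :: rs)).
rewrite szX /= xrs urs size_map size_iota ltnn => h; exfalso.
suff : false by []; apply: h => //; apply/andP; split.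
  by rewrite /root !hornerE xq subrr.
apply/allP => y /mapP[m _ ->]; rewrite /root !hornerE.
by rewrite -(pFrobenius_autE qK) rmorph_nat subrr.
Qed.

(** Numerator and denominator add up to 1 for every [k]. *)
Lemma eis_ratio_neqN1 (k : nat) (K : fieldType) (w : K) : 3.-primitive_root w ->
  (eis_norm k)%:R != 0 :> K -> eis_ratio w k != -1.
Proof.
move=> wP p0; have [a0 b0] := eis_num_neq0 wP p0.
apply/eqP => e; have : eis_num w k = - eis_num (w ^+ 2) k.
  by rewrite -[LHS](divfK b0) -/(eis_ratio w k) e mulN1r.
move/eqP; rewrite -addr_eq0 !eis_numE.
have -> : k%:R + 1 + (2 * k%:R + 1) * w + (k%:R + 1 + (2 * k%:R + 1) * w ^+ 2)
  = 1 + (2 * k%:R + 1) * (1 + w + w ^+ 2) by ring.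
by rewrite (prim_root3_eq0 wP) mulr0 addr0 oner_eq0.
Qed.

Lemma eis_ord_dvd6 q : prime q -> (5 <= q)%N -> (6 %| eis_ord q)%N.
Proof.
move=> q_pr q5; have q3 : q != 3%N by apply: contraTneq q5 => ->.
have q_odd : odd q by case: (even_prime q_pr) q5 => [->|].
have := prime_mod3 q_pr q3; rewrite /eis_ord; have := odd_double_half q; rewrite q_odd.
by case: ifP; move: q5; clear; lia.
Qed.

Lemma eis_ord_gt6 q : prime q -> (5 <= q)%N -> q != 5%N -> q != 7%N -> (6 < eis_ord q)%N.
Proof.
move=> q_pr q5 q5' q7; have /dvdnP[m] := eis_ord_dvd6 q_pr q5; rewrite /eis_ord.
by case: ifP => _; move: q5 q5' q7; clear; lia.
Qed.

Lemma eis_ord_dvd q : prime q -> (eis_ord q %| (q ^ 2).-1)%N.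
Proof.
move=> /prime_gt0; rewrite /eis_ord; case: q => // q _.
have -> : ((q.+1 ^ 2).-1 = q * q.+2)%N by lia.
by case: ifP => _ /=; [exact: dvdn_mulr|exact: dvdn_mull].
Qed.

Lemma cubic_exp_ord q :
  (cubic_exp q = eis_ord q %/ 3 \/ cubic_exp q = 2 * (eis_ord q %/ 3))%N.
Proof. by rewrite /cubic_exp /eis_ord; case: ifP; [left|right]. Qed.

(** The field with q^2 elements serves both cases, as q - 1 and q + 1 divide q^2 - 1. *)
Lemma exists_quadratic_ext (q : nat) : prime q -> (5 <= q)%N ->
  exists (K : finFieldType) (w z : K), [/\ q \in [pchar K], 3.-primitive_root w &
    (eis_ord q).-primitive_root z].
Proof.
move=> q_pr q5; have [K qK cK] := pPrimePowerField q_pr (isT : (0 < 2)%N).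
have [g gP] := finField_prim_root K; rewrite cK in gP.
have N6 := eis_ord_dvd q_pr.
have N3 : (3 %| (q ^ 2).-1)%N.
  by apply: dvdn_trans N6; apply: dvdn_trans (eis_ord_dvd6 q_pr q5).
by exists K, (g ^+ ((q ^ 2).-1 %/ 3)), (g ^+ ((q ^ 2).-1 %/ eis_ord q)); split;
  rewrite // dvdn_prim_root.
Qed.

Section LocalSymbols.
Variables (q : nat) (K : finFieldType) (w : K).
Hypotheses (qK : q \in [pchar K]) (wP : 3.-primitive_root w) (q5 : (5 <= q)%N).
Let q_pr : prime q := pcharf_prime qK.
Let q3 : q != 3%N. Proof. by apply: contraTneq q5 => ->. Qed.

(* [k |-> eis_ratio w k] is a Moebius map from the projective line over F_q to the
   group of [eis_ord q]-th roots of unity; the excluded value -1 is taken at infinity. *)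
Lemma exists_eis_ratio (v : K) : v ^+ eis_ord q = 1 -> v != -1 ->
  exists k : nat, (eis_norm k)%:R != 0 :> K /\ eis_ratio w k = v.
Proof.
move=> vN vN1; have w3 := prim_expr_order wP.
have e0 := prim_root3_eq0 wP.
have v0 : v != 0.
  apply/eqP => vz; move: vN; rewrite vz expr0n gtn_eqF.
    by move/esym/eqP; rewrite oner_eq0.
  by rewrite /eis_ord; case: ifP; move: q5; clear; lia.
have v1 : 1 + v != 0 by rewrite addrC addr_eq0.
have w2 : w ^+ 2 = - 1 - w by rewrite -[LHS]subr0 -e0; ring.
have s0 : 1 + 2 * w != 0.
  have : (1 + 2 * w) ^+ 2 = -3.
    by transitivity (4 * (1 + w + w ^+ 2) - 3); [ring|rewrite e0; ring].
  move=> h; apply/eqP => s0; move: h; rewrite s0 expr0n /= => /esym/eqP.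
  by rewrite oppr_eq0 (negPf (prim_root3_three_neq0 wP)).
(* The root of the linear equation [eis_num w x = v * eis_num (w^2) x]; being fixed by Frobenius, it
   comes from a natural number. *)
pose x := (w ^+ 2 - v * w) / ((1 + 2 * w) * (1 + v)).
have xq : x ^+ q = x.
  have fM := pFrobenius_autE qK; rewrite -fM /x fmorph_div rmorphB rmorphXn !rmorphM !rmorphD rmorphM.
  rewrite rmorph1 rmorph_nat /= !fM.
  case: (orP (prime_mod3 q_pr q3)) => /eqP qm.
    have -> : w ^+ q = w by rewrite -(expr_mod _ w3) qm expr1.
    have -> // : v ^+ q = v.
    move: vN; rewrite /eis_ord qm eqxx => h.
    by rewrite -(prednK (prime_gt0 q_pr)) exprS h mulr1.
  have -> : w ^+ q = w ^+ 2 by rewrite -(expr_mod _ w3) qm.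
  have -> : v ^+ q = v^-1.
    move: vN; rewrite /eis_ord qm /= exprS => h.
    by apply: (mulfI v0); rewrite h divff.
  have -> : 1 + 2 * w ^+ 2 = - (1 + 2 * w) by rewrite w2; ring.
  have -> : w ^+ 2 ^+ 2 = w by rewrite -exprM -[(2 * 2)%N]/(1 + 3)%N exprD w3 mulr1 expr1.
  by field; rewrite oppr_eq0 s0 v0 v1.
have [k kE] := Frobenius_fixed_nat qK xq; exists k.
have num : eis_num w k = v * eis_num (w ^+ 2) k.
  apply/eqP; rewrite -subr_eq0 !eis_numE -kE; apply/eqP.
  transitivity (x * ((1 + 2 * w) * (1 + v)) - 2 * v * x * (1 + w + w ^+ 2) + (1 + w) - v * (1 + w ^+ 2)).
    by ring.
  rewrite e0 /x divfK ?mulf_neq0 // w2; ring.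
have b0 : eis_num (w ^+ 2) k != 0.
  apply/eqP => b0; have a0 : eis_num w k = 0 by rewrite num b0 mulr0.
  have := eis_num_norm k wP; rewrite a0 mul0r => p0.
  have h : (1 + 2 * w) * (2 * k%:R + 1) = 0.
    transitivity (eis_num w k - eis_num (w ^+ 2) k); last by rewrite a0 b0 subrr.
    by rewrite !eis_numE w2; ring.
  move/eqP: h; rewrite mulf_eq0 (negPf s0) /= => /eqP h.
  have : (k%:R + 1) * 2 = 1 + (2 * k%:R + 1) :> K by ring.
  have -> : k%:R + 1 = 0 :> K by move: a0; rewrite eis_numE h mul0r addr0.
  by rewrite mul0r h addr0 => /esym/eqP; rewrite oner_eq0.
split; last by rewrite /eis_ratio num mulfK.
by rewrite -(eis_num_norm k wP) mulf_neq0 // num mulf_neq0.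
Qed.

End LocalSymbols.

Lemma cubic_char_inv (F : finFieldType) (L : fieldType) (n : nat) (r x : F) (w : L) (i : nat) :
  #|F|.-1 = (6 * n)%N -> 3.-primitive_root r -> 3.-primitive_root w -> x != 0 ->
  cubic_char n r w x = w ^+ i -> x ^+ (2 * n) = r ^+ i.
Proof.
move=> Fn rP wP x0; have [j jE] := cubic_class Fn rP x0.
rewrite (cubic_char_class rP wP x0 jE) jE => /eqP; rewrite (eq_prim_root_expr wP) => ij.
by apply/eqP; rewrite (eq_prim_root_expr rP).
Qed.

(** Aim at [eis_ratio = z^j]: the parity of [j] gives the quadratic symbol, [j] modulo 3 the cubic
    one. If [z^j = -1], then [j + 6] has the same symbols and works unless [eis_ord q = 6], where
    the hypothesis excludes this [j]. Measuring the cubic exponent from [(k + 2) * cubic_exp q]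
    isolates the part that depends on [k] modulo [q] alone. *)
Theorem local_symbol (q : nat) (s : bool) (x : nat) : prime q -> (5 <= q)%N ->
  ~~ [&& (q == 5%N) || (q == 7%N), s & 3 %| x]%N ->
  exists k0 : nat, ~~ (q %| eis_norm k0)%N /\
   forall k : nat, k = k0 %[mod q] -> prime (eis_norm k) -> eis_norm k != q ->
     qchar ((prime_star q)%:~R : 'F_(eis_norm k)) = (-1) ^+ s /\
     (q%:R : 'F_(eis_norm k)) ^+ (k * k.+1) = (3 * k + 1)%:R ^+ ((k + 2) * cubic_exp q + x).
Proof.
move=> q_pr q5 sx; have q3 : q != 3%N by apply: contraTneq q5 => ->.
have q_odd : odd q by case: (even_prime q_pr) q5 => [->|].
have [K [w [z [qK wP zP]]]] := exists_quadratic_ext q_pr q5.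
have /dvdnP[M NE] := eis_ord_dvd6 q_pr q5.
have M0 : (0 < M)%N by have := prim_order_gt0 zP; rewrite NE muln_gt0 => /andP[].
have K2 : -1 != 1 :> K.
  rewrite eq_sym -addr_eq0 -[1 + 1]/(2%:R) -(dvdn_pcharf qK) dvdn_prime2 //.
  by apply: contraTneq q5 => ->.
have half : (eis_ord q)./2 = (3 * M)%N by rewrite NE; clear; lia.
have zh : z ^+ (3 * M) = -1.
  have /eqP : (z ^+ (3 * M)) ^+ 2 = 1.
    by rewrite -exprM -(prim_expr_order zP) NE; congr (_ ^+ _); clear; lia.
  rewrite sqrf_eq1 -(prim_order_dvd zP) NE => /orP[|/eqP //].
  by move=> /dvdn_leq; move: M0; clear; lia.
have [t tE] : exists t : nat, z ^+ cubic_exp q = w ^+ t /\ (t = 1 \/ t = 2)%N.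
  have e3 : (eis_ord q %/ 3 = 2 * M)%N by rewrite NE; clear; lia.
  have zc : 3.-primitive_root (z ^+ cubic_exp q).
    have z1 : 3.-primitive_root (z ^+ (2 * M)).
      by rewrite -e3 dvdn_prim_root // NE; apply/dvdnP; exists (2 * M)%N; clear; lia.
    case: (cubic_exp_ord q) => ->; rewrite e3 // mulnC exprM.
    by rewrite (prim_root_exp_coprime _ z1).
  have [i iE] := prim_rootP wP (prim_expr_order zc); exists i; split => //.
  case: i iE => [[|[|[|i]]] //= _] iE; [|by left|by right].
  by move: zc; rewrite iE expr0 => /prim_order_dvd/(_ 1%N); rewrite expr1 eqxx.
case: tE => tE t12.
(* Odd exactly when [s] holds, and [t * j0 = x] modulo 3 because [t^2 = 1] modulo 3. *)
pose j0 := (3 * s + 4 * (t * x))%N.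
have [j [j2 j3 jN]] : exists j : nat, [/\ odd j = s, (t * j = x %[mod 3])%N & z ^+ j != -1].
  have j02 : odd j0 = s by rewrite /j0 oddD !oddM /= addbF oddb.
  have j03 : (t * j0 = x %[mod 3])%N.
    by rewrite /j0; case: t12 => ->; clear; lia.
  have [e|ne] := eqVneq (z ^+ j0) (-1); last by exists j0.
  exists (j0 + 6)%N; split.
  - by rewrite oddD j02 addbF.
  - by rewrite mulnDr -modnDmr (_ : (t * 6) %% 3 = 0)%N ?addn0 //; clear; lia.
  rewrite exprD e mulN1r eqr_opp -(prim_order_dvd zP); apply/negP => N6.
  have N6' : eis_ord q = 6%N.
    by have := dvdn_leq (isT : 0 < 6)%N N6; move: M0; rewrite NE; clear; lia.
  move: sx; have -> : (q == 5%N) || (q == 7%N).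
    apply/negP => /negP; rewrite negb_or => /andP[h5 h7].
    by have := eis_ord_gt6 q_pr q5 h5 h7; rewrite N6'.
  have M1 : M = 1%N by move: NE; rewrite N6'; clear; lia.
  move: e; rewrite -zh M1 => /eqP; rewrite (eq_prim_root_expr zP) N6' => /eqP e.
  move=> /negP; apply; apply/andP; split; last first.
    by move: e; rewrite /j0; case: t12 => ->; case: (s) => /=; clear; lia.
  by move: e; rewrite /j0; case: (s) => //=; case: t12 => ->; clear; lia.
have vN : (z ^+ j) ^+ eis_ord q = 1.
  by rewrite -exprM mulnC exprM (prim_expr_order zP) expr1n.
have [k0 [p0 kE]] := exists_eis_ratio qK wP q5 vN jN.
exists k0; split; first by rewrite (dvdn_pcharf qK).
move=> k kk0 p_pr pq.
have kK : k%:R = k0%:R :> K by rewrite -(GRing.natr_mod_pchar qK k) kk0 (GRing.natr_mod_pchar qK).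
have ratio : eis_ratio w k = z ^+ j.
  by rewrite -kE /eis_ratio !eis_numE kK.
have qF : q%:R != 0 :> 'F_(eis_norm k).
  by rewrite -(dvdn_pcharf (pchar_Fp p_pr)) dvdn_prime2.
split.
  have := quadratic_reciprocity p_pr wP qK q3 pq q_odd.
  rewrite ratio half exprAC zh -(signr_odd _ j) j2.
  have c0 : (prime_star q)%:~R != 0 :> 'F_(eis_norm k).
    by rewrite /prime_star intrM mulf_neq0 -?pmulrn // rmorphXn expf_neq0 // rmorphN1 oppr_eq0 oner_eq0.
  case: (qchar_neq0 c0) => ->; case: (s) => //= /eqP; rewrite ?rmorph1 ?rmorphN1 ?expr1.
    by rewrite eq_sym (negPf K2).
  by rewrite (negPf K2).
have := cubic_reciprocity p_pr wP qK q3 pq.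
rewrite ratio exprMn -(exprM z) [(j * _)%N]mulnC (exprM z) tE -!exprM -exprD.
have Fn := card_eis_field p_pr.
move=> /(cubic_char_inv Fn (eis_rootP p_pr) wP qF).
have -> : (2 * (k * k.+1)./2 = k * k.+1)%N.
  by rewrite mul2n halfK oddM /= andbN subn0.
move=> ->; apply/eqP; rewrite (eq_prim_root_expr (eis_rootP p_pr)).
by rewrite -modnDmr j3 modnDmr.
Qed.

(** * Symbols of -1, 2 and 3, and the pair missed by 5 and 7 *)

Lemma exists_root3_ext (q : nat) : prime q -> q != 3%N ->
  exists (K : finFieldType) (w : K), q \in [pchar K] /\ 3.-primitive_root w.
Proof.
move=> q_pr q3; have [K qK cK] := pPrimePowerField q_pr (isT : (0 < 2)%N).
have [g gP] := finField_prim_root K; rewrite cK in gP.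
exists K, (g ^+ ((q ^ 2).-1 %/ 3)); split; rewrite // dvdn_prim_root //.
have -> : ((q ^ 2).-1 = q.-1 * q.+1)%N by have := prime_gt0 q_pr; clear; nia.
have : (3 %| q.-1)%N || (3 %| q.+1)%N.
  by case/orP: (prime_mod3 q_pr q3); clear; lia.
by case/orP => h; [exact: dvdn_mulr|exact: dvdn_mull].
Qed.

(** A closed form that extends [cubic_exp], modulo 3, from primes to all integers prime to 3,
    turning products into sums. *)
Definition sqr_log3 (m : nat) : nat := (2 * ((m ^ 2).-1 %/ 3))%N.

Lemma sqr_mod3 m : ~~ (3 %| m)%N -> exists a, (m ^ 2 = 3 * a + 1)%N.
Proof.
rewrite /dvdn => m3; have := divn_eq m 3; have := ltn_mod m 3.
case: (m %% 3)%N m3 => [|[|[|]]] // _ _ ->; move: (m %/ 3)%N => l.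
  by exists (3 * l ^ 2 + 2 * l)%N; nia.
by exists (3 * l ^ 2 + 4 * l + 1)%N; nia.
Qed.

Lemma sqr_log3M m l : ~~ (3 %| m)%N -> ~~ (3 %| l)%N ->
  sqr_log3 (m * l) = sqr_log3 m + sqr_log3 l %[mod 3].
Proof.
rewrite /sqr_log3 => /sqr_mod3[a aE] /sqr_mod3[b bE]; rewrite expnMn aE bE.
have -> : (((3 * a + 1) * (3 * b + 1)).-1 = 3 * (3 * (a * b) + a + b))%N by nia.
rewrite !addn1 /= !mulKn //; move: (a * b)%N => c; clear; lia.
Qed.

Lemma sqr_log3_prime q : prime q -> q != 3%N -> cubic_exp q = sqr_log3 q %[mod 3].
Proof.
move=> q_pr q3; rewrite /cubic_exp /sqr_log3; have := divn_eq q 3.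
case/orP: (prime_mod3 q_pr q3) => /eqP h; rewrite h /=; move: (q %/ 3)%N => l ->.
  have -> : ((l * 3 + 1).-1 = l * 3)%N by lia.
  have -> : (((l * 3 + 1) ^ 2).-1 = 3 * (3 * l ^ 2 + 2 * l))%N by nia.
  rewrite mulnK //.
  by rewrite mulKn //; clear; lia.
have -> : ((l * 3 + 2).+1 = (l + 1) * 3)%N by lia.
have -> : (((l * 3 + 2) ^ 2).-1 = 3 * (3 * l ^ 2 + 4 * l + 1))%N by nia.
by rewrite mulKn // mulnK //; clear; lia.
Qed.

Section SpecialSymbols.
Variable k : nat.
Hypothesis p_pr : prime (eis_norm k).
Local Notation p := (eis_norm k).
Local Notation F := 'F_p.
Local Notation r := ((3 * k + 1)%:R : F).
Let n := (k * k.+1)./2.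
Let n2 : (2 * n = k * k.+1)%N.
Proof. by rewrite mul2n /n halfK oddM /= andbN subn0. Qed.
Let Fn : #|F|.-1 = (6 * n)%N := card_eis_field p_pr.
Let F2 : #|F|.-1 = (2 * (3 * n))%N. Proof. by rewrite Fn mulnA. Qed.
Let rP : 3.-primitive_root r := eis_rootP p_pr.

Lemma eis_expr3 (x : F) : x != 0 -> (x ^+ 3) ^+ (k * k.+1) = 1.
Proof.
by move=> x0; rewrite -exprM -n2 mulnA -Fn expf_card_pred.
Qed.

Lemma eis_root_eq (i j : nat) : (r ^+ i == r ^+ j) = (i == j %[mod 3])%N.
Proof. exact: eq_prim_root_expr rP i j. Qed.

Lemma two_neq0 : 2 != 0 :> F. Proof. exact: finField_two_neq0 F2. Qed.

Lemma cubic_symbol2 : (2 : F) ^+ (k * k.+1) = r ^+ (eis_shift k + 2 * (k + 2)).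
Proof.
have four0 : 4 != 0 :> F by rewrite (_ : 4 = 2 * 2) ?mulf_neq0 ?two_neq0 // -natrM.
have [j jE] := cubic_class Fn rP four0; rewrite n2 in jE.
have e : eis_shift k + j = k + 2 %[mod 3].
  by apply: (trace_value_inj p_pr); rewrite -(square_trace4 p_pr) (square_trace_value p_pr four0 jE).
have : 2 ^+ (k * k.+1) * (2 ^+ 3) ^+ (k * k.+1) = (4 ^+ (k * k.+1)) ^+ 2 :> F.
  by rewrite -exprMn exprAC; congr (_ ^+ _); rewrite -!natrX -natrM.
rewrite eis_expr3 ?two_neq0 // mulr1 jE -exprM => ->.
apply/eqP; rewrite eis_root_eq; move: e; rewrite /eis_shift.
by case: ifP => _; move: (j : nat) => i; clear; lia.
Qed.

(** In characteristic [l], for a prime [l] dividing [k], the ratio is (1 + w)/(1 + w^2) = w, and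
    [w^(k+2) = 1] because [k = 1] modulo 3. So reciprocity gives the symbol of every prime factor of
    [m]. *)
Lemma cubic_symbol_dvd m : (k %% 3 = 1)%N -> (0 < m)%N -> (m %| k)%N ->
  (m%:R : F) ^+ (k * k.+1) = r ^+ sqr_log3 m.
Proof.
move=> k3; have k3' : ~~ (3 %| k)%N by rewrite /dvdn k3.
have [N] := ubnP m; elim: N m => // N IH m mN m0 mk.
have [m1|m1] := leqP m 1.
  have -> : m = 1%N by move: m0 m1; clear; lia.
  by rewrite expr1n.
pose l := pdiv m; have l_pr : prime l := pdiv_prime m1.
have /dvdnP[m' mE] : (l %| m)%N := pdiv_dvd m.
have m'0 : (0 < m')%N by move: m0; rewrite mE muln_gt0 => /andP[].
have m'k : (m' %| k)%N by apply: dvdn_trans mk; rewrite mE dvdn_mulr.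
have lk : (l %| k)%N by apply: dvdn_trans mk; rewrite mE dvdn_mull.
have l3 : l != 3%N by apply: contraNneq k3' => <-.
have m'3 : ~~ (3 %| m')%N by apply: contraNN k3' => h; exact: dvdn_trans h m'k.
have l3' : ~~ (3 %| l)%N by apply: contraNN k3' => h; exact: dvdn_trans h lk.
have pl : p != l.
  apply: contraTneq lk => <-; rewrite gtnNdvd ?(eis_norm_gt0 p_pr) // /eis_norm.
  by clear; lia.
have [K [w [lK wP]]] := exists_root3_ext l_pr l3.
have k0 : k%:R = 0 :> K by apply/eqP; rewrite -(dvdn_pcharf lK).
have w3 := prim_expr_order wP; have e0 := prim_root3_eq0 wP.
have := cubic_reciprocity p_pr wP lK l3 pl.
have -> : w ^+ (k + 2) = 1 by rewrite -(expr_mod _ w3) -modnDml k3 expr0.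
have -> : eis_ratio w k = w.
  have w0 : w != 0.
    by apply/eqP => wz; move: w3; rewrite wz expr0n /= => /esym/eqP; rewrite oner_eq0.
  rewrite /eis_ratio !eis_numE k0 mulr0 !add0r !mul1r.
  have -> : 1 + w = - w ^+ 2 by rewrite -[LHS]subr0 -e0; ring.
  have -> : 1 + w ^+ 2 = - w by rewrite -[LHS]subr0 -e0; ring.
  by rewrite invrN mulrNN expr2 mulfK.
rewrite mul1r -/n; have lF : l%:R != 0 :> F by rewrite -(dvdn_pcharf (pchar_Fp p_pr)) dvdn_prime2.
move=> /(cubic_char_inv Fn rP wP lF); rewrite n2 => lE.
rewrite mE natrM exprMn lE IH // -?exprD; last first.
  by move: mN; rewrite mE; have := prime_gt1 l_pr; move: m'0; clear; nia.
apply/eqP; rewrite eis_root_eq; apply/eqP.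
by rewrite sqr_log3M // -modnDmr (sqr_log3_prime l_pr l3) modnDmr.
Qed.

(* Modulo [p] one has [3 k^2 = - (3k+1)], which reduces the symbol of 3 to that
   of [k]; the latter is read off the prime factors of [k]. *)
Lemma cubic_symbol3 : (k %% 3 = 1)%N -> (3 : F) ^+ (k * k.+1) = r ^+ (2 + k %/ 3).
Proof.
move=> k3; have kF : k%:R != 0 :> F.
  by rewrite natr_eis_neq0 // (eis_norm_gt0 p_pr) /eis_norm; clear; lia.
have e : 3 * k%:R ^+ 2 = -1 * r.
  apply/eqP; rewrite mulN1r -subr_eq0 opprK -natrX -natrM -natrD natr_eis_eq0 //.
  by rewrite addnA -/(eis_norm k).
have e1 : 3 ^+ (k * k.+1) * (k%:R ^+ (k * k.+1)) ^+ 2 = r ^+ (k * k.+1).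
  rewrite exprAC -exprMn e exprMn; have -> : (-1) ^+ (k * k.+1) = 1 :> F.
    by rewrite -n2 exprM sqrrN !expr1n.
  by rewrite mul1r.
have kE := cubic_symbol_dvd k3 (eis_norm_gt0 p_pr) (dvdnn k).
have : 3 ^+ (k * k.+1) * (k%:R ^+ (k * k.+1)) ^+ 2 * k%:R ^+ (k * k.+1) = (3 : F) ^+ (k * k.+1).
  by rewrite -mulrA -exprSr exprAC eis_expr3 // mulr1.
rewrite e1 kE -exprD => <-; apply/eqP; rewrite eis_root_eq /sqr_log3.
have := divn_eq k 3; rewrite k3; move: (k %/ 3)%N => l ->.
have -> : (((l * 3 + 1) ^ 2).-1 = 3 * (3 * l ^ 2 + 2 * l))%N by nia.
rewrite mulKn //; have -> : ((l * 3 + 1) * (l * 3 + 1).+1 = 3 * (3 * l ^ 2 + 3 * l) + 2)%N by nia.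
by clear; lia.
Qed.

Lemma qchar_sign (x : F) m : x ^+ (3 * n) = (-1) ^+ m -> qchar x = (-1) ^+ m.
Proof.
rewrite -(signr_odd F) -(signr_odd int) => e; apply/eqP; case: (odd m) e => /= /eqP.
  by rewrite !expr1 (qchar_eqN1 F2).
by rewrite !expr0 (qchar_eq1 F2).
Qed.

Lemma qchar_N1 : qchar (-1 : F) = (-1) ^+ n.
Proof. by apply: qchar_sign; rewrite exprM exprS sqrrN expr1n mulr1. Qed.

Lemma qchar_N3 : qchar (-3 : F) = 1.
Proof.
have e0 := prim_root3_eq0 rP.
have e : -3 = (2 * r + 1) ^+ 2.
  by transitivity (4 * (1 + r + r ^+ 2) - 3); [rewrite e0|]; ring.
rewrite e (qcharX F2) qchar_sqr_eq1 //; apply: contraNneq (prim_root3_three_neq0 rP) => h.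
by rewrite -oppr_eq0 e h expr0n.
Qed.

(** With [i^2 = -1] one has [2 i = (1 + i)^2], so 2 and [i] have the same symbol. *)
Lemma qchar_2 : ~~ odd n -> qchar (2 : F) = (-1) ^+ n./2.
Proof.
move=> nE; have nE' : n = (2 * n./2)%N by rewrite mul2n even_halfK.
have [i iE] : exists i : F, i ^+ 2 = -1.
  have Fd : #|F|.-1 = (2 * (3 * n))%N by [].
  apply: (expf_eq1_root Fd); rewrite {}nE' [(3 * _)%N]mulnCA exprM sqrrN.
  by rewrite !expr1n.
have i0 : i != 0.
  by apply/eqP => iz; move/eqP: iE; rewrite iz expr0n eq_sym oppr_eq0 oner_eq0.
have i1 : 1 + i != 0.
  apply/eqP => h; have := two_neq0; have -> : 2 = (1 + i) ^+ 2 - 2 * i * (1 + i) + 2 * (1 + i ^+ 2) - 1 * (1 + i^+2) :> F by ring.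
  by rewrite h iE subrr !(mulr0, expr0n, subr0, addr0) eqxx.
have two : 2 * i = (1 + i) ^+ 2.
  by transitivity (1 + i ^+ 2 + 2 * i); [rewrite iE; ring|ring].
apply: qchar_sign.
have h : 2 ^+ (3 * n) * i ^+ (3 * n) = 1 :> F.
  by rewrite -exprMn two -exprM -F2 expf_card_pred.
have ii : i ^+ (3 * n) = (-1) ^+ n./2.
  by rewrite {1}nE' mulnCA exprM iE exprM exprS sqrrN expr1n mulr1.
transitivity (2 ^+ (3 * n) * i ^+ (3 * n) * (-1) ^+ n./2); last by rewrite h mul1r.
by rewrite ii -mulrA -expr2 sqrr_sign mulr1.
Qed.

(** For both primes [eis_ord] is 6: the ratio [y] satisfies [y^3 = -1], and [y^4 = 1] for 5 or
    [y^2 = 1] for 7. Hence [y = -1], against [eis_ratio_neqN1]. *)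
Lemma exceptional_symbol q : (q == 5%N) || (q == 7%N) -> p != q ->
  qchar ((prime_star q)%:~R : F) = -1 ->
  (q%:R : F) ^+ (k * k.+1) = r ^+ ((k + 2) * cubic_exp q) -> False.
Proof.
move=> q57 pq qs qc; have q_pr : prime q by case/orP: q57 => /eqP ->.
have q5 : (5 <= q)%N by case/orP: q57 => /eqP ->.
have q3 : q != 3%N by case/orP: q57 => /eqP ->.
have q_odd : odd q by case/orP: q57 => /eqP ->.
have [K [w [z [qK wP _]]]] := exists_quadratic_ext q_pr q5.
have p0 : p%:R != 0 :> K by rewrite -(dvdn_pcharf qK) dvdn_prime2 // eq_sym.
have qF : q%:R != 0 :> F by rewrite -(dvdn_pcharf (pchar_Fp p_pr)) dvdn_prime2.
have w0 : w != 0.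
  apply/eqP => wz; have := prim_expr_order wP.
  by rewrite wz expr0n /= => /esym/eqP; rewrite oner_eq0.
have hq := quadratic_reciprocity p_pr wP qK q3 pq q_odd; rewrite qs rmorphN1 in hq.
have hc := cubic_reciprocity p_pr wP qK q3 pq.
rewrite (cubic_char_class rP wP qF (i := ((k + 2) * cubic_exp q)%N)) ?n2 // in hc.
move: hc; rewrite exprMn exprM -[LHS]mulr1 => /(mulfI _) h.
have {}h : eis_ratio w k ^+ cubic_exp q = 1 by rewrite -h // !expf_neq0.
have := eis_ratio_neqN1 wP p0; move: hq h; move: (eis_ratio w k) => y.
case/orP: q57 => /eqP -> /esym; rewrite /eis_ord /cubic_exp => y3 y2 /eqP; apply.
  have {y2} : y ^+ 4 = 1 by exact: y2.
  by rewrite exprS [y ^+ 3]y3 mulrN1 => /eqP; rewrite eqr_oppLR => /eqP.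
have {}y2 : y ^+ 2 = 1 by exact: y2.
by transitivity (y ^+ 3); [rewrite exprSr y2 mul1r|exact: y3].
Qed.

End SpecialSymbols.

(** * Progressions of anomalous primes *)

Lemma coprime_prodr (n : nat) (ms : seq nat) :
  (forall m, m \in ms -> coprime n m) -> coprime n (\prod_(m <- ms) m).
Proof.
elim: ms => [|m ms IH] h; first by rewrite big_nil coprimen1.
rewrite big_cons coprimeMr h ?mem_head //=; apply: IH => m' m'ms.
by apply: h; rewrite inE m'ms orbT.
Qed.

Lemma pairwise_coprime_primes (ms : seq nat) :
  uniq ms -> all prime ms -> pairwise coprime ms.
Proof.
elim: ms => //= m ms IH /andP[mms ums] /andP[m_pr ms_pr]; rewrite IH // andbT.
apply/allP => l lms; have l_pr := allP ms_pr l lms.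
rewrite prime_coprime // dvdn_prime2 //.
by apply: contraNneq mms => ->.
Qed.

Lemma crt_seq (P : nat -> nat -> Prop) (ms : seq nat) : pairwise coprime ms ->
  (forall m, m \in ms -> exists r, forall k, k = r %[mod m] -> P m k) ->
  exists k0, forall k, k = k0 %[mod \prod_(m <- ms) m] -> forall m, m \in ms -> P m k.
Proof.
elim: ms => [|m ms IH] /=; first by exists 0%N.
move=> /andP[mms cms] h; have [|k1 k1P] := IH cms.
  by move=> m' m'ms; apply: h; rewrite inE m'ms orbT.
have [r rP] := h m (mem_head _ _).
have cop : coprime m (\prod_(m <- ms) m) by apply: coprime_prodr => m' /(allP mms).
exists (chinese m (\prod_(m <- ms) m) r k1) => k kE m'.
rewrite inE => /orP[/eqP ->|m'ms].
  apply: rP; rewrite -(chinese_modl cop r k1); move: kE; rewrite big_cons => /eqP.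
  by rewrite chinese_remainder // => /andP[/eqP].
apply: k1P m'ms; rewrite -(chinese_modr cop r k1); move: kE; rewrite big_cons => /eqP.
by rewrite chinese_remainder // => /andP[_ /eqP].
Qed.

Lemma eis_norm_mod (k k' m : nat) : k = k' %[mod m] -> eis_norm k = eis_norm k' %[mod m].
Proof.
move=> h; rewrite /eis_norm -modnDml -(modnDml (3 * k' ^ 2 + _)); congr ((_ + _) %% _)%N.
rewrite -modnDm -[RHS]modnDm; congr ((_ + _) %% _)%N; rewrite -modnMmr -[RHS]modnMmr.
  by rewrite -modnXm h modnXm.
by rewrite h.
Qed.

Lemma absz_prime_star q : `|prime_star q|%N = q.
Proof. by rewrite /prime_star abszM abszX !absz_nat /= exp1n mul1n. Qed.

(** * Symbols of g from its factorisation *)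

Section Factorisation.
Variable g : int.
Hypothesis g0 : g != 0.
Let G := `|g|%N.
Let G0 : (0 < G)%N. Proof. by rewrite absz_gt0. Qed.
Let a := logn 2 G.
Let b := logn 3 G.

Definition big_primes : seq nat := [seq q <- primes G | 5 <= q]%N.
Local Notation Q := big_primes.

Lemma big_primesP q : q \in Q -> [/\ prime q, (5 <= q)%N & (q %| G)%N].
Proof. by rewrite mem_filter mem_primes => /andP[-> /and3P[-> _ ->]]. Qed.

Lemma big_primes_uniq : uniq Q.
Proof. by rewrite filter_uniq // primes_uniq. Qed.

Lemma absz_factor : G = (2 ^ a * 3 ^ b * \prod_(q <- Q) q ^ logn q G)%N.
Proof.
have GE : G = (\prod_(q <- primes G) q ^ logn q G)%N.
  by rewrite [LHS]prod_prime_decomp // prime_decompE big_map.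
have small (l : nat) : (l ^ logn l G = \prod_(q <- primes G | q == l) q ^ logn q G)%N.
  have [lG|lG] := boolP (l \in primes G); last first.
    rewrite big1_seq => [|q /andP[/eqP ->]]; last by rewrite (negPf lG).
    by rewrite (_ : logn l G = 0)%N // lognE -mem_primes (negPf lG).
  by rewrite -big_filter filter_pred1_uniq ?primes_uniq // big_seq1.
rewrite {1}GE (bigID (fun q => 5 <= q)%N) /= -big_filter mulnC; congr (_ * _)%N.
rewrite (bigID (fun q => q == 2%N)) /=; congr (_ * _)%N.
  rewrite small; apply: eq_bigl => q; case: eqP => [->|]; rewrite ?andbT ?andbF //.
rewrite small big_seq_cond [RHS]big_seq_cond; apply: eq_bigl => q.
case: (boolP (q \in primes G)) => //=; rewrite mem_primes => /and3P[q_pr _ _].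
by case: q q_pr => [|[|[|[|[|q]]]]].
Qed.

(** -3 is a residue at every prime [eis_norm k], and reciprocity describes [prime_star q] rather
    than [q]; all signs are thus collected in [star_sign]. *)
Definition star_factor : int := 2 ^+ a * (-3) ^+ b * \prod_(q <- Q) prime_star q ^+ logn q G.

Definition star_sign : bool := g != star_factor.

Lemma absz_star_factor : `|star_factor|%N = G.
Proof.
rewrite [RHS]absz_factor /star_factor !abszM !abszX; congr (_ * _)%N.
rewrite (big_morph absz abszM absz1); apply: eq_bigr => q _.
by rewrite abszX absz_prime_star.
Qed.

Lemma star_factorE : g = (-1) ^+ star_sign * star_factor.
Proof.
rewrite /star_sign; case: eqVneq => [<-|gh]; first by rewrite expr0 mul1r.
have /eqP : `|g| = `|star_factor| by rewrite -!abszE absz_star_factor.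
by rewrite eqr_norm2 (negPf gh) /= expr1 mulN1r => /eqP.
Qed.

Section Symbols.
Variables (k : nat) (s : nat -> bool) (x : nat -> nat) (t : nat).
Hypothesis p_pr : prime (eis_norm k).
Hypothesis gp : (6 * G < eis_norm k)%N.
Local Notation F := 'F_(eis_norm k).
Local Notation r := ((3 * k + 1)%:R : F).
Let n := (k * k.+1)./2.
Let n2 : (2 * n = k * k.+1)%N.
Proof. by rewrite mul2n /n halfK oddM /= andbN subn0. Qed.
Let F2 : #|F|.-1 = (2 * (3 * n))%N. Proof. by rewrite (card_eis_field p_pr) mulnA. Qed.

Lemma intr_absz (R : pzRingType) (z : int) : z%:~R = (-1) ^+ (z < 0)%R * `|z|%N%:R :> R.
Proof.
case: z => m /=; first by rewrite expr0 mul1r -pmulrn.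
by rewrite NegzE expr1 mulN1r rmorphN /= -pmulrn.
Qed.

Lemma intr_neq0 : g%:~R != 0 :> F.
Proof.
rewrite intr_absz mulf_neq0 ?signr_eq0 // natr_eis_neq0 // G0 /=.
by move: gp; clear; lia.
Qed.

Hypothesis symQ : forall q, q \in Q ->
  qchar ((prime_star q)%:~R : F) = (-1) ^+ s q /\
  (q%:R : F) ^+ (k * k.+1) = r ^+ ((k + 2) * cubic_exp q + x q).

Lemma qchar_factor : qchar (g%:~R : F) =
  qchar (((-1) ^+ star_sign * 2 ^+ a)%:~R : F) * (-1) ^+ (\sum_(q <- Q) logn q G * s q).
Proof.
have qM (u v : int) : qchar ((u * v)%:~R : F) = qchar (u%:~R : F) * qchar (v%:~R : F).
  by rewrite intrM (qcharM F2).
have qX (u : int) m : qchar ((u ^+ m)%:~R : F) = qchar (u%:~R : F) ^+ m.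
  by rewrite rmorphXn (qcharX F2).
rewrite {1}star_factorE /star_factor !mulrA qM (qM ((-1) ^+ star_sign * 2 ^+ a)) qX.
have -> : qchar ((-3)%:~R : F) = 1 by rewrite rmorphN /= (qchar_N3 p_pr).
rewrite expr1n mulr1; congr (_ * _).
have q1 : qchar ((1 : int)%:~R : F) = 1 by rewrite rmorph1 (qchar1 F2).
rewrite (big_morph (fun u : int => qchar (u%:~R : F)) qM q1).
rewrite expr_sum big_seq [RHS]big_seq; apply: eq_bigr => q qQ.
by rewrite qX; have [-> _] := symQ qQ; rewrite -exprM mulnC.
Qed.

Hypothesis sym3 : (3 %| b)%N \/ (3%:R : F) ^+ (k * k.+1) = r ^+ t.

(** The symbol of 3 is available for [k = 1] modulo 3, and [3 ^ b] is a cube when 3 divides [b];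
    hence the two cases of [sym3]. *)
Lemma cubic_factor : (g%:~R : F) ^+ (k * k.+1) =
  r ^+ (a * (eis_shift k + 2 * (k + 2)) + b * t
        + \sum_(q <- Q) logn q G * ((k + 2) * cubic_exp q + x q)).
Proof.
have N1 : (-1) ^+ (k * k.+1) = 1 :> F by rewrite -n2 exprM sqrrN !expr1n.
rewrite intr_absz exprMn -exprM mulnC exprM N1 expr1n mul1r -/G {1}absz_factor.
have e2 : ((2 ^ a)%N%:R : F) ^+ (k * k.+1) = r ^+ (a * (eis_shift k + 2 * (k + 2))).
  by rewrite natrX exprAC (cubic_symbol2 p_pr) -exprM; congr (_ ^+ _); exact: mulnC.
have e3 : ((3 ^ b)%N%:R : F) ^+ (k * k.+1) = r ^+ (b * t).
  rewrite natrX exprAC; case: sym3 => [/dvdnP[c ->]|->]; last first.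
    by rewrite -exprM; congr (_ ^+ _); exact: mulnC.
  rewrite [(c * 3)%N]mulnC exprM (exprAC _ (k * k.+1)) (eis_expr3 p_pr); last first.
    exact: prim_root3_three_neq0 (eis_rootP p_pr).
  by rewrite expr1n -mulnA exprM (prim_expr_order (eis_rootP p_pr)) expr1n.
have eQ : ((\prod_(q <- Q) q ^ logn q G)%N%:R : F) ^+ (k * k.+1)
    = r ^+ (\sum_(q <- Q) logn q G * ((k + 2) * cubic_exp q + x q)).
  rewrite natr_prod expr_sum -prodrXl big_seq [RHS]big_seq; apply: eq_bigr => q qQ.
  rewrite natrX exprAC; have [_ ->] := symQ qQ.
  by rewrite -exprM; congr (_ ^+ _); exact: mulnC.
by rewrite !natrM !exprMn e2 e3 eQ -!exprD.
Qed.

End Symbols.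

End Factorisation.

(** * Assembling local choices into a progression *)

Definition anomalous_progression (g : int) : Prop :=
  exists k0 M : nat, [/\ (0 < M)%N, coprime (eis_norm k0) M &
    forall k, k = k0 %[mod M] -> prime (eis_norm k) -> (6 * `|g| < eis_norm k)%N ->
      mordell_sum (g%:~R : 'F_(eis_norm k)) = -1].

Definition local_choice (q : nat) (s : bool) (x : nat) : bool :=
  ~~ [&& (q == 5%N) || (q == 7%N), s & 3 %| x]%N.

(** The coefficient of [k + 2] in the exponent found in [cubic_factor]. *)
Definition cube_defect (g : int) : nat :=
  (2 * logn 2 `|g| + \sum_(q <- big_primes g) logn q `|g| * cubic_exp q)%N.

Lemma eis_shift_mod8 (k k' : nat) : k = k' %[mod 8] -> eis_shift k = eis_shift k'.
Proof.
move=> h; rewrite /eis_shift; suff -> : odd k = odd k' by [].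
by move: h; clear; lia.
Qed.

(** The residue modulo 8 controls the symbols of -1 and 2 and [eis_shift], the one modulo 9 the term
    in [k + 2] and the symbol of 3, the one modulo [q] the symbols of [q]. The last two hypotheses
    express the criterion [mordell_sum_eqN1]. *)
Lemma progression_of_choice (g : int) (s : nat -> bool) (x : nat -> nat) (k8 k9 : nat)
    (s2 : bool) : g != 0 ->
  (forall q, q \in big_primes g -> local_choice q (s q) (x q)) ->
  (forall k, k = k8 %[mod 8] -> prime (eis_norm k) ->
     qchar (((-1) ^+ star_sign g * 2 ^+ logn 2 `|g|)%:~R : 'F_(eis_norm k)) = (-1) ^+ s2) ->
  (3 %| logn 3 `|g|)%N \/ (k9 %% 3 = 1)%N ->
  odd (s2 + \sum_(q <- big_primes g) logn q `|g| * s q) ->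
  logn 2 `|g| * eis_shift k8 + (k9 + 2) * cube_defect g + logn 3 `|g| * (2 + k9 %/ 3)
    + \sum_(q <- big_primes g) logn q `|g| * x q = eis_shift k8 %[mod 3] ->
  anomalous_progression g.
Proof.
move=> g0 sx h2 h3 hodd hcub.
pose Q := big_primes g.
pose P (m k : nat) : Prop := [/\ coprime (eis_norm k) m, (m = 8 -> k = k8 %[mod 8])%N,
  (m = 9 -> k = k9 %[mod 9])%N & m \in Q -> prime (eis_norm k) -> eis_norm k != m ->
     qchar ((prime_star m)%:~R : 'F_(eis_norm k)) = (-1) ^+ s m /\
     (m%:R : 'F_(eis_norm k)) ^+ (k * k.+1) = (3 * k + 1)%:R ^+ ((k + 2) * cubic_exp m + x m)].
pose ms := [:: 8, 9 & Q]%N.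
have Q_lb m : m \in Q -> prime m /\ (5 <= m)%N by case/big_primesP.
have [||k0 k0P] := @crt_seq P ms.
- have h8 : all (coprime 8) Q.
    apply/allP => q /Q_lb[q_pr q5].
    by rewrite -[8%N]/(2 ^ 3)%N coprime_pexpl // prime_coprime // dvdn_prime2 //; move: q5; clear; lia.
  have h9 : all (coprime 9) Q.
    apply/allP => q /Q_lb[q_pr q5].
    by rewrite -[9%N]/(3 ^ 2)%N coprime_pexpl // prime_coprime // dvdn_prime2 //; move: q5; clear; lia.
  rewrite /ms /= h8 h9 pairwise_coprime_primes ?big_primes_uniq //.
  by apply/allP => q /Q_lb[].
- move=> m; rewrite !inE => /or3P[/eqP ->|/eqP ->|mQ].
  + exists k8 => k kk8; split=> //.
      by rewrite -[8%N]/(2 ^ 3)%N coprime_pexpr // coprimen2 odd_eis_norm.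
    by case/Q_lb.
  + exists k9 => k kk9; split=> //.
      rewrite -[9%N]/(3 ^ 2)%N coprime_pexpr // coprime_sym prime_coprime // eis_norm_pred.
      by rewrite /dvdn -addn1 -modnDml modnMr.
    by case/Q_lb.
  have [m_pr m5] := Q_lb m mQ.
  have [r [rm rP]] := local_symbol m_pr m5 (sx m mQ).
  exists r => k kr; split; [|by move=> m8; move: m_pr; rewrite m8|by move=> m9; move: m_pr; rewrite m9|].
    rewrite coprime_sym prime_coprime //; apply: contraNN rm.
    by rewrite /dvdn (eis_norm_mod kr).
  by move=> _; exact: rP.
exists k0, (\prod_(m <- ms) m)%N; split.
- rewrite big_seq prodn_cond_gt0 // => m; rewrite !inE => /or3P[/eqP ->|/eqP ->|/Q_lb[]] //.
  by move=> /prime_gt0.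
- by apply: coprime_prodr => m /(k0P k0 erefl)[].
move=> k kk0 p_pr gp; have kP := k0P k kk0.
have m8 : 8%N \in ms by rewrite !inE.
have m9 : 9%N \in ms by rewrite !inE.
have [_ /(_ erefl) k8E _ _] := kP 8%N m8.
have [_ _ /(_ erefl) k9E _] := kP 9%N m9.
have symQ q : q \in Q -> 
  qchar ((prime_star q)%:~R : 'F_(eis_norm k)) = (-1) ^+ s q /\
  (q%:R : 'F_(eis_norm k)) ^+ (k * k.+1) = (3 * k + 1)%:R ^+ ((k + 2) * cubic_exp q + x q).
  move=> qQ; have qms : q \in ms by rewrite !inE qQ !orbT.
  have [_ _ _ /(_ qQ p_pr)] := kP q qms; apply.
  have [_ _ /dvdn_leq] := big_primesP qQ.
  rewrite absz_gt0 g0 => /(_ isT) qg; apply/eqP => pq; move: gp; rewrite pq.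
  by move: qg; clear; lia.
apply/(mordell_sum_eqN1 p_pr (intr_neq0 g0 p_pr gp)); split.
  rewrite (qchar_factor g0 p_pr symQ) h2 // -exprD.
  by rewrite -signr_odd hodd expr1.
have sym3 : (3 %| logn 3 `|g|)%N \/
   (3%:R : 'F_(eis_norm k)) ^+ (k * k.+1) = (3 * k + 1)%:R ^+ (2 + k %/ 3).
  case: h3 => [|k93]; [by left|right]; apply: (cubic_symbol3 p_pr).
  by move: k93 k9E; clear; lia.
rewrite (cubic_factor g0 p_pr symQ sym3).
apply/eqP; rewrite (eis_root_eq p_pr) (eis_shift_mod8 k8E) -hcub; apply/eqP.
have -> : (\sum_(q <- Q) logn q `|g| * ((k + 2) * cubic_exp q + x q) =
  (k + 2) * (\sum_(q <- Q) logn q `|g| * cubic_exp q) + \sum_(q <- Q) logn q `|g| * x q)%N.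
  rewrite big_distrr -big_split /=; apply: eq_bigr => q _.
  by rewrite mulnDr mulnCA.
rewrite /cube_defect -/Q.
move: (\sum_(q <- Q) _ * cubic_exp q)%N (\sum_(q <- Q) _ * x q)%N => X Y.
have k3 : k = k9 %[mod 3] by move: k9E; clear; lia.
have -> : (logn 2 `|g| * (eis_shift k8 + 2 * (k + 2)) + logn 3 `|g| * (2 + k %/ 3) +
   ((k + 2) * X + Y) = logn 2 `|g| * eis_shift k8 + (k + 2) * (2 * logn 2 `|g| + X)
   + logn 3 `|g| * (2 + k %/ 3) + Y)%N by ring.
have e1 E : (k + 2) * E = (k9 + 2) * E %[mod 3].
  by rewrite -modnMml -modnDml k3 modnDml modnMml.
have k33 : k %/ 3 = k9 %/ 3 %[mod 3] by move: k9E; clear; lia.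
have e2 B : B * (2 + k %/ 3) = B * (2 + k9 %/ 3) %[mod 3].
  by rewrite -modnMmr -modnDmr k33 modnDmr modnMmr.
move: (e1 (2 * logn 2 `|g| + X)%N) (e2 (logn 3 `|g|)); clear.
move: ((k + 2) * _)%N ((k9 + 2) * _)%N (_ * (2 + k %/ 3))%N (_ * (2 + k9 %/ 3))%N (_ * eis_shift k8)%N.
clear; lia.
Qed.

(** The residues are read off from n = k(k+1)/2: the symbol of -1 is (-1)^n and, for even n, that of
    2 is (-1)^(n/2). The parity [b0] is what determines [eis_shift]. *)
Lemma two_part_choice (sg : bool) (a : nat) (b0 s2 : bool) : odd a || sg || ~~ s2 ->
  exists k8, odd k8 = b0 /\ forall k, k = k8 %[mod 8] -> prime (eis_norm k) ->
    qchar (((-1) ^+ sg * 2 ^+ a)%:~R : 'F_(eis_norm k)) = (-1) ^+ s2.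
Proof.
move=> h.
have red k : prime (eis_norm k) -> qchar (((-1) ^+ sg * 2 ^+ a)%:~R : 'F_(eis_norm k)) =
   (-1) ^+ ((k * k.+1)./2 * sg) * qchar (2 : 'F_(eis_norm k)) ^+ (odd a).
  move=> p_pr; have F2 : #|'F_(eis_norm k)|.-1 = (2 * (3 * (k * k.+1)./2))%N.
    by rewrite (card_eis_field p_pr) mulnA.
  have two2 : qchar (2 : 'F_(eis_norm k)) ^+ 2 = 1 by rewrite qchar_sqr_eq1 // two_neq0.
  rewrite intrM rmorphXn rmorphXn /= (qcharM F2) !(qcharX F2) rmorphN1 (qchar_N1 p_pr) -exprM.
  by congr (_ * _); rewrite -[in LHS](odd_double_half a) exprD -mul2n exprM two2 expr1n mulr1.
have mod8 k c : k = c %[mod 8] -> (c < 8)%N -> exists l, k = (8 * l + c)%N.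
  by move=> kc c8; exists (k %/ 8)%N; have := divn_eq k 8; rewrite kc (modn_small c8); clear; lia.
move: h; have [oa /= _|oa /= h] := boolP (odd a).
  exists (if b0 then if s2 then 3 else 7 else if s2 then 4 else 0)%N.
  split; first by case: b0; case: (s2).
  move=> k kk p_pr; rewrite red // oa expr1.
  have [l kl] : exists l, k = (8 * l + if b0 then if s2 then 3 else 7 else if s2 then 4 else 0)%N.
    by apply: mod8 => //; case: b0 {kk}; case: (s2).
  have nE : ~~ odd (k * k.+1)./2 /\ odd (k * k.+1)./2./2 = s2.
    by rewrite kl; case: b0 {kk kl}; case: (s2); clear; lia.
  have [n1 n2] := nE; rewrite qchar_2 //.
  by rewrite -signr_odd oddM (negPf n1) /= expr0 mul1r -signr_odd n2.
have {h} [hs|[hs h]] : sg \/ ~~ sg /\ ~~ s2 by case: (sg) h; [left|right].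
  exists (if b0 then if s2 then 1 else 7 else if s2 then 2 else 0)%N.
  split; first by case: b0; case: (s2).
  move=> k kk p_pr; rewrite red // (negPf oa) expr0 hs mulr1 muln1.
  have [l kl] : exists l, k = (8 * l + if b0 then if s2 then 1 else 7 else if s2 then 2 else 0)%N.
    by apply: mod8 => //; case: b0 {kk}; case: (s2).
  rewrite -signr_odd; congr (_ ^+ nat_of_bool _).
  by rewrite kl; case: b0 {kk kl}; case: (s2); clear; lia.
exists b0; split; first by case: b0.
by move=> k _ p_pr; rewrite red // (negPf oa) (negPf hs) (negPf h) muln0 !expr0 mulr1.
Qed.

(** If 3 does not divide [b], then [k = 3j + 1] kills the term in [E] and [j] moves the symbol of 3
    freely. If 3 divides [b] but not [E], [k] modulo 3 suffices; if it divides both, only a trivial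
    [f] is reached. *)
Lemma three_part_choice (b E f : nat) : ~~ (3 %| b)%N || ~~ (3 %| E)%N || (3 %| f)%N ->
  exists k9, ((3 %| b)%N \/ (k9 %% 3 = 1)%N) /\
    (k9 + 2) * E + b * (2 + k9 %/ 3) = f %[mod 3].
Proof.
have m3 m : exists l c, m = (3 * l + c)%N /\ (c < 3)%N.
  by exists (m %/ 3)%N, (m %% 3)%N; rewrite ltn_mod mulnC -divn_eq.
have [lb [cb [-> cb3]]] := m3 b; have [lE [cE [-> cE3]]] := m3 E.
have [lf [cf [-> cf3]]] := m3 f; move=> h.
have key j : (2 + (3 * j + 1) %/ 3 = 2 + j)%N by clear; lia.
case: (posnP cb) => [cb0|cb0].
  have [k9 [k93 k9E]] : exists k9, (k9 < 3 /\ (k9 + 2) * cE = cf %[mod 3])%N.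
    move: h; rewrite cb0; case: cE cE3 => [|[|[|//]]] _; case: cf cf3 => [|[|[|//]]] _ h;
    by [exists 1%N | exists 2%N | exists 0%N | move: h; clear; lia].
  exists k9; split; first by left; rewrite cb0 addn0 dvdn_mulr.
  have -> : (k9 %/ 3 = 0)%N by rewrite divn_small.
  move: k9E; rewrite cb0 mulnDr; move: ((k9 + 2) * cE)%N => X.
  rewrite mulnCA; move: ((k9 + 2) * lE)%N; clear; lia.
have [j jE] : exists j, (cb * (2 + j) = cf %[mod 3])%N.
  move: cb0; case: cb cb3 {h} => [|[|[|//]]] _ // _; case: cf cf3 => [|[|[|//]]] _;
  by [exists 0%N | exists 1%N | exists 2%N].
exists (3 * j + 1)%N; split; first by right; clear; lia.
rewrite key; move: jE.
have -> : ((3 * j + 1 + 2) * (3 * lE + cE) + (3 * lb + cb) * (2 + j) =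
  3 * ((j + 1) * (3 * lE + cE) + lb * (2 + j)) + cb * (2 + j))%N by ring.
move: (_ + lb * (2 + j))%N (cb * (2 + j))%N; clear; lia.
Qed.

Lemma sum_point1 (Q : seq nat) (c : nat -> nat) (q1 u : nat) : uniq Q -> q1 \in Q ->
  (\sum_(q <- Q) c q * (if q == q1 then u else 0) = c q1 * u)%N.
Proof.
move=> uQ q1Q; rewrite (bigD1_seq q1) //= eqxx big1 ?addn0 // => q /negPf ->.
by rewrite muln0.
Qed.

Lemma sum_indicator (Q : seq nat) (c : nat -> nat) (q1 : nat) : uniq Q -> q1 \in Q ->
  (\sum_(q <- Q) c q * (q == q1) = c q1)%N.
Proof.
move=> uQ q1Q; rewrite -[RHS]muln1 -(sum_point1 c 1 uQ q1Q); apply: eq_bigr => q _.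
by case: eqP.
Qed.

Lemma sum_point2 (Q : seq nat) (c : nat -> nat) (q1 q2 u v : nat) :
  uniq Q -> q1 \in Q -> q2 \in Q -> q2 != q1 ->
  (\sum_(q <- Q) c q * (if q == q1 then u else if q == q2 then v else 0) = c q1 * u + c q2 * v)%N.
Proof.
move=> uQ q1Q q2Q q12; rewrite (bigD1_seq q1) //= eqxx; congr (_ + _)%N.
rewrite -big_filter (bigD1_seq q2) ?filter_uniq ?mem_filter ?q12 //=.
rewrite (negPf q12) eqxx big_seq_cond big1 ?addn0 // => q.
by rewrite mem_filter => /andP[/andP[/negPf -> _] /negPf ->]; rewrite muln0.
Qed.

(** * Case analysis on the exponents of g *)

Section Choice.
Variable g : int.
Hypothesis g0 : g != 0.
Local Notation Q := (big_primes g).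
Local Notation c := (fun q => logn q `|g|%N).
Let a := logn 2 `|g|%N.
Let b := logn 3 `|g|%N.
Let E := cube_defect g.
Let sg := star_sign g.
Let full := ~~ (3 %| b)%N || ~~ (3 %| E)%N.

Lemma progression_of_data (s : nat -> bool) (x : nat -> nat) (b0 s2 : bool) (f : nat) :
  (forall q, q \in Q -> local_choice q (s q) (x q)) ->
  odd a || sg || ~~ s2 -> full || (3 %| f)%N ->
  odd (s2 + \sum_(q <- Q) c q * s q) ->
  a * (if b0 then 1 else 2) + f + \sum_(q <- Q) c q * x q = (if b0 then 1 else 2) %[mod 3] ->
  anomalous_progression g.
Proof.
move=> sx h2 h3 hodd hcub.
have [k8 [k8b k8P]] := two_part_choice b0 h2.
have [k9 [k93 k9E]] := three_part_choice h3.
apply: (@progression_of_choice g s x k8 k9 s2) => //.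
rewrite /eis_shift k8b -hcub.
move: k9E; rewrite -/a -/b -/E.
move: ((k9 + 2) * E)%N (b * _)%N (a * _)%N (\sum_(q <- Q) _)%N; clear; lia.
Qed.

(** Under [full] the residue modulo 9 supplies any cubic exponent [f], so a single source of the
    sign is enough. *)
Lemma progression_full : full -> odd a || sg || has (fun q => odd (c q)) Q ->
  anomalous_progression g.
Proof.
move=> hf; case: (boolP (odd a || sg)) => [q2 _|_ /hasP[q qQ oq]].
  apply: (@progression_of_data (fun=> false) (fun=> 0%N) true true (1 + 2 * a)%N).
  - by move=> q _; rewrite /local_choice andbF.
  - by rewrite q2.
  - by rewrite hf.
  - by rewrite big1 // => q _; rewrite muln0.
  - by rewrite big1 /=; [clear; lia|move=> q _; rewrite muln0].
apply: (@progression_of_data (fun q' => q' == q) (fun q' => if q' == q then 1 else 0)%N true false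
   (1 + 2 * a + 2 * c q)%N).
- by move=> q' _; rewrite /local_choice; case: (q' =P q); rewrite /= ?andbF.
- by rewrite orbT.
- by rewrite hf.
- by have /= -> := sum_indicator c (big_primes_uniq g) qQ.
- by have /= -> := sum_point1 c 1 (big_primes_uniq g) qQ; clear; lia.
Qed.

(** The sign comes from -1 or 2, the cubic exponent from [q2], whose multiplicity is its own inverse
    modulo 3. *)
Lemma progression_partial (q2 : nat) : (3 %| b)%N -> (3 %| E)%N ->
  q2 \in Q -> ~~ (3 %| c q2)%N -> odd a || sg -> anomalous_progression g.
Proof.
move=> b3 E3 q2Q c3 h2.
apply: (@progression_of_data (fun=> false) (fun q => if q == q2 then c q2 * (1 + 2 * a) else 0)%N true true 0%N).
- by move=> q _; rewrite /local_choice andbF.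
- by rewrite h2.
- by rewrite orbT.
- by rewrite big1 // => q _; rewrite muln0.
have /= -> := sum_point1 c (c q2 * (1 + 2 * a)) (big_primes_uniq g) q2Q; rewrite addn0 muln1 mulnA.
have : (c q2 * c q2 = 1 %[mod 3])%N.
  have [l lE] := sqr_mod3 c3; rewrite mulnn /= lE; clear; lia.
rewrite /= => h; rewrite -modnDmr -modnMml h modnMml mul1n modnDmr; clear; lia.
Qed.

(** [q1] supplies the sign with exponent 1, which is allowed even for 5 and 7; [q2] corrects the
    cubic exponent. *)
Lemma progression_odd_two (q1 q2 : nat) : (3 %| b)%N -> (3 %| E)%N ->
  q1 \in Q -> odd (c q1) -> q2 \in Q -> q2 != q1 -> ~~ (3 %| c q2)%N ->
  anomalous_progression g.
Proof.
move=> b3 E3 q1Q oq1 q2Q q12 c3.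
apply: (@progression_of_data (fun q => q == q1)
  (fun q => if q == q1 then 1 else if q == q2 then c q2 * (1 + 2 * a + 2 * c q1) else 0)%N
  true false 0%N).
- by move=> q _; rewrite /local_choice; case: (q =P q1); rewrite /= ?andbF.
- by rewrite orbT.
- by rewrite orbT.
- by have /= -> := sum_indicator c (big_primes_uniq g) q1Q.
have /= -> := sum_point2 c 1 (c q2 * (1 + 2 * a + 2 * c q1)) (big_primes_uniq g) q1Q q2Q q12; rewrite addn0 !muln1 mulnA.
have : (c q2 * c q2 = 1 %[mod 3])%N.
  have [l lE] := sqr_mod3 c3; rewrite mulnn /= lE; clear; lia.
rewrite /= => h; rewrite addnA -modnDmr -modnMml h modnMml mul1n modnDmr; clear; lia.
Qed.

Lemma progression_odd_one (q1 x : nat) (b0 : bool) : (3 %| b)%N -> (3 %| E)%N ->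
  q1 \in Q -> odd (c q1) -> local_choice q1 true x ->
  a * (if b0 then 1 else 2) + c q1 * x = (if b0 then 1 else 2) %[mod 3] ->
  anomalous_progression g.
Proof.
move=> b3 E3 q1Q oq1 lx h.
apply: (@progression_of_data (fun q => q == q1) (fun q => if q == q1 then x else 0)%N b0 false 0%N).
- by move=> q _; case: eqP => [->|_] //; rewrite /local_choice andbF.
- by rewrite orbT.
- by rewrite orbT.
- by have /= -> := sum_indicator c (big_primes_uniq g) q1Q.
by have /= -> := sum_point1 c x (big_primes_uniq g) q1Q; rewrite addn0.
Qed.

(* The required symbol is the one that 5 and 7 miss, and no other factor of [g]
   can compensate. *)
Definition exceptional_exponents (q1 : nat) : Prop :=
  [/\ (q1 == 5) || (q1 == 7), q1 \in Q, odd (c q1) &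
   [/\ sg = false, a %% 6 = 4, 3 %| b, 3 %| E & forall q, q \in Q -> q != q1 -> 6 %| c q]]%N.

Lemma progression_cases :
  [\/ anomalous_progression g,
      [/\ sg = false, ~~ odd a & forall q, q \in Q -> ~~ odd (c q)],
      [/\ 3 %| a, 3 %| b & forall q, q \in Q -> 3 %| c q]%N |
      exists q1, exceptional_exponents q1].
Proof.
have [hs|] := boolP (odd a || sg || has (fun q => odd (c q)) Q); last first.
  rewrite !negb_or => /andP[/andP[ao /negPf so] /hasPn ho].
  by apply: Or42; split=> // q /ho.
have [hf|] := boolP full; first by apply: Or41; exact: progression_full.
rewrite negb_or !negbK => /andP[b3 E3].
have [/allP c3|] := boolP (all (fun q => 3 %| c q)%N Q).
  apply: Or43; split=> //; move: E3; rewrite /E /cube_defect addnC dvdn_addr ?Gauss_dvdr //.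
  by rewrite big_seq; apply: dvdn_sum => q /c3 ?; rewrite dvdn_mulr.
rewrite -has_predC => /hasP[q2 q2Q /= c2].
have [h2|] := boolP (odd a || sg); first by apply: Or41; exact: (progression_partial b3 E3 q2Q).
rewrite negb_or => /andP[ao so]; move: hs; rewrite (negPf ao) (negPf so) /= => /hasP[q1 q1Q oq1].
have [q12|q12] := eqVneq q2 q1; last by apply: Or41; exact: (progression_odd_two b3 E3 q1Q oq1 q2Q).
subst q2.
have [/hasP[q q3Q /andP[q31 c3]]|] := boolP (has (fun q => (q != q1) && ~~ (3 %| c q)%N) Q).
  by apply: Or41; exact: (progression_odd_two b3 E3 q1Q oq1 q3Q).
move=> /hasPn h3.
have {}h3 q : q \in Q -> q != q1 -> (3 %| c q)%N.
  by move=> /h3; rewrite negb_and !negbK => /orP[/eqP ->|//]; rewrite eqxx.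
(* The condition is [(a - 1) * u + c q1 * x = 0] modulo 3, where [u] is 1 or 2 by the parity of [k].
   If [a] is not 1 modulo 3, [x = 1] and a suitable [u] solve it; otherwise [x] must vanish. *)
have [a3|a3] := eqVneq (a %% 3)%N 1%N; last first.
  have [b0 b0P] : exists b0 : bool,
     (a * (if b0 then 1 else 2) + c q1 * 1 = (if b0 then 1 else 2) %[mod 3])%N.
    have : (a %% 3 < 3)%N by rewrite ltn_mod.
    have : (c q1 %% 3 < 3)%N by rewrite ltn_mod.
    move: c2; rewrite /dvdn; move: a3; clear => /=; move: (logn q1 _) => d.
    move=> a3 d3 d3' a3'; exists (a %% 3 + d %% 3 == 1 %[mod 3])%N.
    case: ifP; move: a3 d3 d3' a3'; clear; lia.
  by apply: Or41; apply: (progression_odd_one b3 E3 q1Q oq1 _ b0P); rewrite /local_choice andbF.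
have [q57|q57] := boolP ((q1 == 5) || (q1 == 7))%N; last first.
  apply: Or41; apply: (@progression_odd_one q1 0 true) => //.
    by rewrite /local_choice (negPf q57).
  by rewrite muln0 muln1 addn0 a3.
(* Another prime of odd multiplicity can carry the sign; its multiplicity is divisible by 3, so its
   exponent 1 leaves the cubic condition intact. *)
have [/hasP[q qQ /andP[qq1 oq]]|/hasPn ho] := boolP (has (fun q => (q != q1) && odd (c q)) Q).
  apply: Or41; apply: (@progression_odd_one q 1 true) => //.
    by rewrite /local_choice andbF.
  by move: (h3 q qQ qq1) a3 => /=; move: (logn q _); clear; lia.
apply: Or44; exists q1; split=> //; split=> //.
- exact: negbTE.
- by move: ao a3; clear; lia.
- move=> q qQ qq1; have := ho q qQ; have := h3 q qQ qq1; rewrite qq1 /=.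
  by move: (logn q _); clear; lia.
Qed.

End Choice.

(** * The shapes without a progression *)

Lemma expr_dvd (y : int) (e d : nat) : (d %| e)%N -> exists m, y ^+ e = m ^+ d.
Proof. by move=> /dvdnP[l ->]; exists (y ^+ l); rewrite -exprM. Qed.

Lemma prod_expr_dvd (I : eqType) (Q : seq I) (f : I -> int) (c : I -> nat) (d : nat) :
  (forall q, q \in Q -> d %| c q)%N -> exists m, \prod_(q <- Q) f q ^+ c q = m ^+ d.
Proof.
move=> h; exists (\prod_(q <- Q) f q ^+ (c q %/ d)); rewrite -prodrXl.
by rewrite big_seq [RHS]big_seq; apply: eq_bigr => q /h dq; rewrite -exprM divnK.
Qed.

(** The residue modulo 6 forced on the multiplicity of 5 or 7: it is odd and makes [cube_defect]
    divisible by 3 when that of 2 is 4 modulo 6. *)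
Definition exceptional_exp (q : nat) : nat := if q == 5%N then 1%N else 5%N.

Definition finite_shape (g : int) : Prop :=
  (exists n, [\/ g = n ^+ 2, g = -3 * n ^+ 2 | g = n ^+ 3]) \/
  exists (q e : nat) (n : int), [/\ (q == 5%N) || (q == 7%N), (e == 0%N) || (e == 3%N) &
    g = 2 ^+ 4 * (-3) ^+ e * prime_star q ^+ exceptional_exp q * n ^+ 6].

Lemma progression_or_shape (g : int) : g != 0 -> anomalous_progression g \/ finite_shape g.
Proof.
move=> g0; set c := fun q => logn q `|g|%N.
have gE := star_factorE g0; rewrite /star_factor in gE.
case: (progression_cases g0) => [|[s0 ao co]|[a3 b3 c3]|[q1 [q57 q1Q oc [s0 a6 b3 E3 c6]]]].
- by left.
- right; left; rewrite s0 expr0 mul1r in gE.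
  have [m mE] : exists m, \prod_(q <- big_primes g) prime_star q ^+ c q = m ^+ 2.
    by apply: prod_expr_dvd => q /co; rewrite dvdn2.
  have [m2 m2E] : exists m, (2 : int) ^+ logn 2 `|g| = m ^+ 2.
    by apply: expr_dvd; rewrite dvdn2.
  rewrite -/(c _) in gE; rewrite mE m2E in gE.
  have [bo|bo] := boolP (odd (logn 3 `|g|%N)); last first.
    have [m3 m3E] : exists m, (-3 : int) ^+ logn 3 `|g| = m ^+ 2.
      by apply: expr_dvd; rewrite dvdn2.
    by exists (m2 * m3 * m); apply: Or31; rewrite {1}gE m3E; ring.
  exists (m2 * (-3) ^+ (logn 3 `|g|)./2 * m); apply: Or32.
  rewrite {1}gE -{1}(odd_double_half (logn 3 `|g|)) bo exprD -muln2 exprM; ring.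
- right; left.
  have [m mE] : exists m, \prod_(q <- big_primes g) prime_star q ^+ c q = m ^+ 3.
    exact: prod_expr_dvd.
  have [m2 m2E] := expr_dvd 2 a3; have [m3 m3E] := expr_dvd (-3) b3.
  rewrite -/(c _) in gE; rewrite mE m2E m3E in gE.
  exists ((-1) ^+ star_sign g * m2 * m3 * m); apply: Or33; rewrite {1}gE.
  have u3 : ((-1) ^+ star_sign g) ^+ 3 = (-1) ^+ star_sign g :> int.
    by rewrite -exprM; case: (star_sign g).
  by rewrite !exprMn u3; ring.
right; right; rewrite s0 expr0 mul1r in gE.
have uQ := big_primes_uniq g.
have [m mE] : exists m, \prod_(q <- big_primes g | q != q1) prime_star q ^+ c q = m ^+ 6.
  rewrite -big_filter; apply: prod_expr_dvd => q; rewrite mem_filter => /andP[qq1 qQ].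
  exact: c6.
rewrite (bigD1_seq q1) //= -/(c _) mE in gE.
have cE : (c q1 %% 6 = exceptional_exp q1)%N.
  move: E3; rewrite /cube_defect (bigD1_seq q1) //= -/(c q1) => E3.
  have r3 : (3 %| \sum_(q <- big_primes g | q != q1) logn q `|g| * cubic_exp q)%N.
    rewrite big_seq_cond; apply: dvdn_sum => q /andP[qQ qq1].
    by rewrite dvdn_mulr // (dvdn_trans _ (c6 q qQ qq1)).
  move: E3; rewrite addnA dvdn_addl //; move: a6 oc q57; rewrite -/(c q1).
  move: (logn 2 _) (c q1) => a d a6 oc /orP[] /eqP ->;
    rewrite /cubic_exp /exceptional_exp /=; move: a6 oc; clear.
    by rewrite (_ : 6 %/ 3 = 2)%N //; lia.
  by rewrite (_ : 6 %/ 3 = 2)%N //; lia.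
have bE : (logn 3 `|g| %% 6 == 0)%N || (logn 3 `|g| %% 6 == 3)%N by move: b3; clear; lia.
have powE (y : int) l : y ^+ l = y ^+ (l %% 6) * (y ^+ (l %/ 6)) ^+ 6.
  by rewrite -exprM -exprD addnC -divn_eq.
exists q1, (logn 3 `|g| %% 6)%N.
exists (2 ^+ (logn 2 `|g| %/ 6) * (-3) ^+ (logn 3 `|g| %/ 6) * prime_star q1 ^+ (c q1 %/ 6) * m).
split=> //; rewrite [LHS]gE (powE 2) (powE (-3)) (powE (prime_star q1)) a6 cE !exprMn; ring.
Qed.

(** The first two shapes are residues; a cube has trivial cubic symbol, whereas [eis_shift] is 1 or
    2; for the others the criterion amounts to the pair ruled out by [exceptional_symbol]. *)
Lemma shape_mordell_sum (g : int) (k : nat) (p_pr : prime (eis_norm k)) : g != 0 ->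
  (6 * `|g| < eis_norm k)%N -> finite_shape g ->
  mordell_sum (g%:~R : 'F_(eis_norm k)) <> -1.
Proof.
move=> g0 gp shape; set F := 'F_(eis_norm k).
have gF : g%:~R != 0 :> F by exact: intr_neq0.
have F2 : #|F|.-1 = (2 * (3 * (k * k.+1)./2))%N by rewrite (card_eis_field p_pr) mulnA.
move/(mordell_sum_eqN1 p_pr gF) => [qs cs].
case: shape => [[n]|[q [e [n [q57 e03 gE]]]]].
  case=> gE; move: gF qs cs; rewrite gE.
  - by rewrite rmorphXn expf_eq0 /= => nF; rewrite (qcharX F2) qchar_sqr_eq1.
  - rewrite intrM rmorphXn mulf_eq0 expf_eq0 /= negb_or => /andP[_ nF].
    rewrite (qcharM F2) (qcharX F2) qchar_sqr_eq1 // rmorphN /=.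
    by rewrite (qchar_N3 p_pr).
  - rewrite rmorphXn expf_eq0 /= => nF _; rewrite (eis_expr3 p_pr nF) => /eqP.
    by rewrite eq_sym -(prim_order_dvd (eis_rootP p_pr)) /eis_shift; case: ifP.
have q_pr : prime q by case/orP: q57 => /eqP ->.
have pq : eis_norm k != q.
  have qg : (q %| `|g|)%N.
    rewrite gE !abszM !abszX absz_prime_star dvdn_mulr // dvdn_mull // dvdn_exp //.
    by rewrite /exceptional_exp; case: ifP.
  apply: contraTneq gp => ->; rewrite -leqNgt.
  have g1 : (0 < `|g|)%N by rewrite absz_gt0.
  by have := dvdn_leq g1 qg; clear; lia.
have gFE : g%:~R = 2 ^+ 4 * (-3) ^+ e * (prime_star q)%:~R ^+ exceptional_exp q * n%:~R ^+ 6 :> F.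
  by rewrite gE 3!intrM 4!rmorphXn rmorphN !rmorph_nat.
have [psF nF] : (prime_star q)%:~R != 0 :> F /\ n%:~R != 0 :> F.
  split; apply: contraNneq gF => z0; rewrite gFE z0 expr0n ?mulr0 //.
  by rewrite /exceptional_exp; case: ifP => _; rewrite mulr0 mul0r.
have two0 := two_neq0 p_pr.
have q3N : qchar ((-3) ^+ e : F) = 1.
  by rewrite (qcharX F2) (qchar_N3 p_pr) expr1n.
have c3N : ((-3) ^+ e : F) ^+ (k * k.+1) = 1.
  case/orP: e03 => /eqP ->; first by rewrite expr0 expr1n.
  rewrite (eis_expr3 p_pr) // oppr_eq0.
  exact: prim_root3_three_neq0 (eis_rootP p_pr).
have qsym : qchar ((prime_star q)%:~R : F) = -1.
  move: qs; rewrite gFE 3!(qcharM F2) q3N !(qcharX F2).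
  rewrite (exprM _ 2 2) (exprM _ 2 3) !qchar_sqr_eq1 // !expr1n mul1r mulr1 mul1r.
  by have [->|->] := qchar_neq0 psF; rewrite ?expr1n.
apply: (exceptional_symbol p_pr q57 pq qsym).
have qF : q%:R != 0 :> F by rewrite -(dvdn_pcharf (pchar_Fp p_pr)) dvdn_prime2.
have [i iE] := cubic_class (card_eis_field p_pr) (eis_rootP p_pr) qF.
have n2 : (2 * (k * k.+1)./2 = k * k.+1)%N by rewrite mul2n halfK oddM /= andbN subn0.
rewrite n2 in iE; rewrite iE.
have N1 : (-1) ^+ (k * k.+1) = 1 :> F by rewrite -n2 exprM sqrrN !expr1n.
have psE : ((prime_star q)%:~R : F) ^+ (k * k.+1) = q%:R ^+ (k * k.+1).
  rewrite /prime_star intrM exprMn rmorphXn rmorphN1 (exprAC (-1)) N1.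
  by rewrite expr1n mul1r -pmulrn.
move: cs; rewrite gFE 3!exprMn c3N mulr1 (exprAC 2) (cubic_symbol2 p_pr).
rewrite (exprM n%:~R 2 3) (eis_expr3 p_pr (expf_neq0 2 nF)) mulr1 (exprAC (prime_star q)%:~R).
rewrite psE iE.
rewrite -!exprM -exprD => /eqP; rewrite (eis_root_eq p_pr) => h.
apply/eqP; rewrite (eis_root_eq p_pr); move: h; rewrite /eis_shift /exceptional_exp /cubic_exp.
by case/orP: q57 => /eqP -> /=; rewrite (_ : 6 %/ 3 = 2)%N //; case: ifP => _;
  move: (i : nat) => j; clear; lia.
Qed.

(** * Models of the curve and point counts *)

Lemma mordell_sum_scale6 (F : finFieldType) (m : nat) (g v : F) : #|F|.-1 = (2 * m)%N ->
  v != 0 -> mordell_sum (g * v ^+ 6) = mordell_sum g.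
Proof.
move=> F2 v0; rewrite /mordell_sum -(sum_mulf _ (expf_neq0 2 v0)).
apply: eq_bigr => x _; rewrite exprMn -exprM [g * _]mulrC -mulrDr (qcharM F2) (qcharX F2).
by rewrite (exprM _ 2 3) qchar_sqr_eq1 // expr1n mul1r.
Qed.

(** Cubing permutes [F], so the sum is a complete character sum. *)
Lemma mordell_sum_card2 (F : finFieldType) (m : nat) (g : F) : #|F|.-1 = (2 * m)%N ->
  coprime 3 (2 * m) -> mordell_sum g = 0.
Proof.
move=> F2 c3; have inj : injective (fun x : F => x ^+ 3).
  have m0 : (0 < 2 * m)%N by rewrite -F2 card_finField_gt0.
  case: (egcdnP (2 * m) (isT : (0 < 3)%N)) => u v uv _; rewrite (eqP c3) in uv.
  move=> x y /= xy; have [x0|x0] := eqVneq x 0.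
    by move: xy; rewrite x0 expr0n /= => /esym/eqP; rewrite expf_eq0 /= => /eqP.
  have y0 : y != 0.
    by apply/eqP => y0; move/eqP: xy; rewrite y0 expr0n /= expf_eq0 /= (negPf x0).
  have h (z : F) : z != 0 -> z = (z ^+ 3) ^+ u.
    move=> z0; rewrite -exprM mulnC uv exprD expr1 mulnC exprM -F2 expf_card_pred //.
    by rewrite expr1n mul1r.
  by rewrite (h x x0) (h y y0) xy.
rewrite /mordell_sum -[RHS](sum_qchar F2) -[RHS](sum_addf _ g).
by rewrite [RHS](reindex_inj inj).
Qed.

(** The relations give [(a - b)^2 = 3 (4p - 1)], so [4p = 1 + 3 m^2]; then [m] is odd and
    [k = (|m| - 1)/2]. *)
Lemma odd_square_norm (p : nat) (t a b : int) : t ^+ 2 = 1 -> t + a + b = 0 ->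
  t ^+ 2 + a ^+ 2 + b ^+ 2 = 6 * p%:Z -> exists k, p = eis_norm k.
Proof.
move=> t2 s0 s2.
have D2 : (a - b) ^+ 2 = 3 * (4 * p%:Z - 1).
  have e : (a + b) ^+ 2 = 1 by rewrite -t2 -[RHS]sqrrN; congr (_ ^+ 2); move: s0; clear; lia.
  have : (a - b) ^+ 2 = 2 * (a ^+ 2 + b ^+ 2) - (a + b) ^+ 2 by ring.
  by rewrite e => ->; move: s2; rewrite t2; clear; lia.
have [m mE] : exists m, a - b = m * 3.
  apply/dvdzP; have : (3 %| (a - b) ^+ 2)%Z by rewrite D2 dvdz_mulr.
  by rewrite !dvdzE abszX Euclid_dvdX // => /andP[].
have pE : 4 * p%:Z = 3 * m ^+ 2 + 1 by move: D2; rewrite mE; clear; lia.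
pose M := `|m|%N.
have ME : (4 * p = 3 * M ^ 2 + 1)%N.
  have M2 : (M ^ 2)%N%:Z = m ^+ 2 by rewrite -abszX gez0_abs ?sqr_ge0.
  by move: pE; rewrite -M2; move: (M ^ 2)%N; clear; lia.
have oM : odd M.
  apply/negPn/negP => eM; move: ME; rewrite -(odd_double_half M) (negPf eM) add0n.
  by rewrite -mul2n expnMn; move: (M./2 ^ 2)%N; clear; lia.
exists M./2; move: ME; rewrite -{1}(odd_double_half M) oM /eis_norm.
move: (M./2) => k; clear; nia.
Qed.

Lemma odd_square_norm3 (p : nat) (t0 t1 t2 : int) : t0 + t1 + t2 = 0 ->
  t0 ^+ 2 + t1 ^+ 2 + t2 ^+ 2 = 6 * p%:Z -> [\/ t0 ^+ 2 = 1, t1 ^+ 2 = 1 | t2 ^+ 2 = 1] ->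
  exists k, p = eis_norm k.
Proof.
move=> s0 s2; case=> h; first exact: odd_square_norm h s0 s2.
  by apply: (odd_square_norm (a := t0) (b := t2) h); [rewrite -s0|rewrite -s2]; ring.
by apply: (odd_square_norm (a := t0) (b := t1) h); [rewrite -s0|rewrite -s2]; ring.
Qed.

Lemma mordell_sum_eqN1_norm (p : nat) (g : 'F_p) : prime p -> (5 <= p)%N -> g != 0 ->
  mordell_sum g = -1 -> exists k, p = eis_norm k.
Proof.
move=> p_pr p5 g0 gS; have cF := card_Fp p_pr.
have p_odd : odd p by case: (even_prime p_pr) p5 => [->|].
have p3 : p != 3%N by apply: contraTneq p5 => ->.
have := prime_mod3 p_pr p3; case/orP => /eqP pm; last first.
  have F2 : #|'F_p|.-1 = (2 * (p.-1)./2)%N.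
    by rewrite cF; have := odd_double_half p; rewrite p_odd; clear; lia.
  move: gS; rewrite (mordell_sum_card2 g F2) //.
  by rewrite -F2 cF prime_coprime //; move: pm p5; clear; lia.
have Fn : #|'F_p|.-1 = (6 * (p %/ 6))%N.
  by rewrite cF; move: pm p_odd; clear; lia.
pose n := (p %/ 6)%N.
have [z zP] := finField_prim_root 'F_p; rewrite Fn in zP.
have rP : 3.-primitive_root (z ^+ (2 * n)).
  have -> : (2 * n = (6 * n) %/ 3)%N by clear; lia.
  by rewrite dvdn_prim_root //; apply/dvdnP; exists (2 * n)%N; clear; lia.
have s0 := sum_square_trace Fn rP erefl; have s2 := sum_square_trace_sqr Fn rP erefl.
have g2 : square_trace (g ^+ 2) ^+ 2 = 1.
  by rewrite -(mordell_sum_sqr Fn) gS sqrrN expr1n.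
have z0 : z != 0.
  apply/eqP => z0; move: (prim_expr_order zP); rewrite z0 expr0n.
  rewrite gtn_eqF; first by move/esym/eqP; rewrite oner_eq0.
  by rewrite -Fn card_finField_gt0.
have g20 : g ^+ 2 != 0 by rewrite expf_neq0.
have [i iE] := cubic_class Fn rP g20.
have tE : square_trace (g ^+ 2) = square_trace (z ^+ i).
  apply: (square_trace_class Fn g20); first by rewrite expf_neq0.
  by rewrite iE exprAC.
rewrite cF in s2; move: g2; rewrite {}tE.
move=> t1; apply: (odd_square_norm3 s0 s2); move: t1.
by case: i {iE} => [[|[|[|//]]]] /= _; rewrite ?expr0 ?expr1 => h; [apply: Or31|apply: Or32|apply: Or33].
Qed.

(** The last hypothesis says that the invariant c4 vanishes. Completing the square and the cube then
    leads to y^2 = x^3 + h with h = -c6/864. *)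
Lemma wcard_short (F : finFieldType) (m : nat) (W : weierstrass F) : #|F|.-1 = (2 * m)%N ->
  3 != 0 :> F -> 48 * wa4 W + 24 * wa1 W * wa3 W = (wa1 W ^+ 2 + 4 * wa2 W) ^+ 2 ->
  (wcard W)%:Z = #|F|%:Z + 1 +
    mordell_sum (wa6 W + wa3 W ^+ 2 / 4 - ((wa1 W ^+ 2 + 4 * wa2 W) / 12) ^+ 3).
Proof.
case: W => a1 a2 a3 a4 a6 /= F2 three0 c4; have two0 := finField_two_neq0 F2.
have four0 : 4 != 0 :> F by rewrite (_ : 4 = 2 * 2) ?mulf_neq0 // -natrM.
have twelve0 : 12 != 0 :> F by rewrite (_ : 12 = 3 * 4) ?mulf_neq0 // -natrM.
have c48 : 48 != 0 :> F by rewrite (_ : 48 = 12 * 4) ?mulf_neq0 // -natrM.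
have a4E : a4 = (a1 ^+ 2 + 4 * a2) ^+ 2 / 48 - a1 * a3 / 2.
  by apply: (mulfI c48); rewrite -c4; field; rewrite c48 two0.
set g := a6 + _ - _; rewrite /wcard /= -addn1 PoszD addrAC; congr (_ + _).
have -> : #|[set P : F * F | P.2 ^+ 2 + a1 * P.1 * P.2 + a3 * P.2
    == P.1 ^+ 3 + a2 * P.1 ^+ 2 + a4 * P.1 + a6]%SET|%:Z =
  \sum_(x : F) \sum_(y : F)
    (y ^+ 2 + a1 * x * y + a3 * y == x ^+ 3 + a2 * x ^+ 2 + a4 * x + a6)%:Z.
  rewrite -sum1_card big_mkcond /= -natz natr_sum pair_big /=.
  by apply: eq_bigr => -[x y] _; rewrite inE /=; case: eqP.
have line (x : F) : \sum_(y : F)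
    (y ^+ 2 + a1 * x * y + a3 * y == x ^+ 3 + a2 * x ^+ 2 + a4 * x + a6)%:Z
    = 1 + qchar ((x + (a1 ^+ 2 + 4 * a2) / 12) ^+ 3 + g).
  rewrite -(card_sqrt F2) card_sum -(sum_addf _ (- ((a1 * x + a3) / 2))).
  apply: eq_bigr => y _; congr (nat_of_bool _)%:Z; rewrite /=.
  rewrite -[LHS]subr_eq0 -[RHS]subr_eq0; congr (_ == 0).
  by rewrite /g a4E; field; rewrite ?twelve0 ?two0 ?four0 ?c48 ?three0.
rewrite (eq_bigr _ (fun x _ => line x)) big_split /= sum1_finField; congr (_ + _).
by rewrite (sum_addf (fun x => qchar (x ^+ 3 + g))).
Qed.

(** Isomorphisms preserve c4 = 0 and scale c6 by a sixth power; denominators are cleared so that the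
    relation can be read over Z. *)
Lemma wisomorphic_short (F : fieldType) (g : F) (W : weierstrass F) :
  wisomorphic (Weierstrass 0 0 0 0 g) W ->
  48 * wa4 W + 24 * wa1 W * wa3 W = (wa1 W ^+ 2 + 4 * wa2 W) ^+ 2 /\
  exists2 u : F, u != 0 & 12 ^+ 3 * g = u ^+ 6 * (12 ^+ 3 * wa6 W + 432 * wa3 W ^+ 2
      - (wa1 W ^+ 2 + 4 * wa2 W) ^+ 3).
Proof.
case: W => a1 a2 a3 a4 a6 /= [u [r [s [t [u0 [e1 [e2 [e3 [e4 e6]]]]]]]]].
have rE : 12 * r = u ^+ 2 * (a1 ^+ 2 + 4 * a2).
  transitivity (4 * (u ^+ 2 * a2) + (u * a1) ^+ 2); last by ring.
  by rewrite e1 e2; ring.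
have stE : 4 * (s * t) = u ^+ 4 * (a1 * a3).
  by transitivity ((u * a1) * (u ^+ 3 * a3)); [rewrite e1 e3|]; ring.
have tE : 4 * t ^+ 2 = u ^+ 6 * a3 ^+ 2.
  by transitivity ((u ^+ 3 * a3) ^+ 2); [rewrite e3|]; ring.
split.
  apply: (mulfI (expf_neq0 4 u0)).
  transitivity (48 * (u ^+ 4 * a4) + 24 * (u ^+ 4 * (a1 * a3))); first by ring.
  transitivity ((u ^+ 2 * (a1 ^+ 2 + 4 * a2)) ^+ 2); last by ring.
  by rewrite -rE -stE e4; ring.
exists u => //.
transitivity (12 ^+ 3 * (u ^+ 6 * a6) + 432 * (u ^+ 6 * a3 ^+ 2)
  - (u ^+ 2 * (a1 ^+ 2 + 4 * a2)) ^+ 3); last by ring.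
by rewrite -rE -tE e6; ring.
Qed.

(* The constants are variables and the field is abstract because unification
   unfolds integer literals and fractions of [rat]. *)
Lemma clear_denominators (R : numFieldType) (A B C g n d a1 a2 a3 a6 : int) (u : R) :
  u * d%:~R = n%:~R -> A%:~R ^+ 3 * g%:~R = u ^+ 6 * (A%:~R ^+ 3 * a6%:~R
    + B%:~R * a3%:~R ^+ 2 - (a1%:~R ^+ 2 + C%:~R * a2%:~R) ^+ 3) ->
  A ^+ 3 * g * d ^+ 6 = n ^+ 6 * (A ^+ 3 * a6 + B * a3 ^+ 2 - (a1 ^+ 2 + C * a2) ^+ 3).
Proof.
move=> du gE; apply: (@intr_inj R).
rewrite !(rmorphB, rmorphD, rmorphM, rmorphXn) /= gE -du exprMn.
by rewrite mulrAC.
Qed.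

Lemma mordell_model (g : int) (W : weierstrass int) :
  wisomorphic (mordell g) (map_weierstrass (fun z : int => z%:~R) W) ->
  48 * wa4 W + 24 * wa1 W * wa3 W = (wa1 W ^+ 2 + 4 * wa2 W) ^+ 2 /\
  exists n d : int, [/\ coprimez n d, d != 0 &
    12 ^+ 3 * g * d ^+ 6 = n ^+ 6 * (12 ^+ 3 * wa6 W + 432 * wa3 W ^+ 2
      - (wa1 W ^+ 2 + 4 * wa2 W) ^+ 3)].
Proof.
move=> /wisomorphic_short[c4 [u _ gE]]; split.
  case: W c4 {gE} => a1 a2 a3 a4 a6 /= c4; apply: (@intr_inj rat); move: c4.
  by rewrite !(rmorphD, rmorphM, rmorphXn, rmorph_nat) /=.
exists (numq u), (denq u); split; [exact: coprime_num_den|exact: denq_neq0|].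
apply: (clear_denominators (esym (numqE u))); rewrite !rmorph_nat; exact: gE.
Qed.

(** This is 1728 disc = c4^3 - c6^2 with c4 = 0 and c6 = -864 h. *)
Lemma wdisc_mordell_model (F : fieldType) (W : weierstrass F) : 2 != 0 :> F -> 3 != 0 :> F ->
  48 * wa4 W + 24 * wa1 W * wa3 W = (wa1 W ^+ 2 + 4 * wa2 W) ^+ 2 ->
  wdisc W = - (432 * (wa6 W + wa3 W ^+ 2 / 4 - ((wa1 W ^+ 2 + 4 * wa2 W) / 12) ^+ 3) ^+ 2).
Proof.
case: W => a1 a2 a3 a4 a6 /= two0 three0 c4.
have four0 : 4 != 0 :> F by rewrite (_ : 4 = 2 * 2) ?mulf_neq0 // -natrM.
have twelve0 : 12 != 0 :> F by rewrite (_ : 12 = 3 * 4) ?mulf_neq0 // -natrM.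
set be := (a1 ^+ 2 + 4 * a2) / 12; set h := a6 + _ - _.
have b2E : a1 ^+ 2 + 4 * a2 = 12 * be by rewrite /be [12 * _]mulrC divfK.
have b4E : 2 * a4 + a1 * a3 = 6 * be ^+ 2.
  have c24 : 24 != 0 :> F by rewrite (_ : 24 = 12 * 2) ?mulf_neq0 // -natrM.
  apply: (mulfI c24); transitivity (48 * a4 + 24 * a1 * a3); first by ring.
  by rewrite c4 b2E; ring.
have b6E : a3 ^+ 2 + 4 * a6 = 4 * (h + be ^+ 3).
  rewrite /h subrK mulrDr addrC; congr (_ + _).
  by rewrite mulrC divfK.
have b8E : a1 ^+ 2 * a6 + 4 * a2 * a6 - a1 * a3 * a4 + a2 * a3 ^+ 2 - a4 ^+ 2
    = 12 * be * h + 3 * be ^+ 4.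
  apply: (mulfI four0).
  transitivity ((a1 ^+ 2 + 4 * a2) * (a3 ^+ 2 + 4 * a6) - (2 * a4 + a1 * a3) ^+ 2); first by ring.
  by rewrite b2E b4E b6E; ring.
by rewrite b2E b4E b6E b8E; ring.
Qed.

Lemma wdisc_map (R S : comNzRingType) (f : {rmorphism R -> S}) (W : weierstrass R) :
  wdisc (map_weierstrass f W) = f (wdisc W).
Proof.
case: W => a1 a2 a3 a4 a6 /=.
by rewrite !(rmorph_nat, rmorphN, rmorphD, rmorphXn, rmorphM).
Qed.

Lemma intr_Fp_eq0 (p : nat) (z : int) : prime p -> (z%:~R == 0 :> 'F_p) = (p %| z)%Z.
Proof. by move=> p_pr; rewrite (dvdz_pcharf (pchar_Fp p_pr)). Qed.

Lemma wdisc_short_neq0 (F : fieldType) (g : F) :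
  2 != 0 :> F -> 3 != 0 :> F -> g != 0 -> wdisc (Weierstrass 0 0 0 0 g) != 0.
Proof.
move=> two0 three0 g0; have -> : wdisc (Weierstrass 0 0 0 0 g) = - (2 ^+ 4 * 3 ^+ 3 * g ^+ 2).
  by rewrite /wdisc; ring.
by rewrite oppr_eq0 !mulf_neq0 ?expf_neq0.
Qed.

Lemma wcard_mordell (F : finFieldType) (m : nat) (g : F) : #|F|.-1 = (2 * m)%N ->
  3 != 0 :> F -> (wcard (Weierstrass 0 0 0 0 g))%:Z = #|F|%:Z + 1 + mordell_sum g.
Proof.
move=> F2 three0; rewrite (wcard_short F2 three0) /=; last by ring.
by rewrite expr0n /= mulr0 addr0 !mul0r expr0n /= addr0 subr0.
Qed.

(** The change of variable to a good model need not be integral. But [p] divides neither [g] nor the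
    discriminant, so the scaling factor n/d is a unit at [p], and the two reductions differ by a
    sixth power. *)
Theorem anomalous_mordell (g : int) (p : nat) : prime p -> (5 <= p)%N -> ~~ (p %| `|g|)%N ->
  anomalous (mordell g) p <-> mordell_sum (g%:~R : 'F_p) = -1.
Proof.
move=> p_pr p5 pg; have cF := card_Fp p_pr.
have p_odd : odd p by case: (even_prime p_pr) p5 => [->|].
have F2 : #|'F_p|.-1 = (2 * (p.-1)./2)%N.
  by rewrite cF; have := odd_double_half p; rewrite p_odd; clear; lia.
have two0 := finField_two_neq0 F2.
have three0 : 3 != 0 :> 'F_p.
  by rewrite -(dvdn_pcharf (pchar_Fp p_pr)) gtnNdvd // (leq_trans _ p5).
have g0 : g%:~R != 0 :> 'F_p by rewrite intr_Fp_eq0.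
have four0 : 4 != 0 :> 'F_p by rewrite (_ : 4 = 2 * 2) ?mulf_neq0 // -natrM.
have twelve0 : 12 != 0 :> 'F_p by rewrite (_ : 12 = 3 * 4) ?mulf_neq0 // -natrM.
split=> [[_ [W [[iso disc]]]]|gS].
  have [c4 [n [d [nd d0 gE]]]] := mordell_model iso.
  pose V := wreduction p W.
  have c4F : 48 * wa4 V + 24 * wa1 V * wa3 V = (wa1 V ^+ 2 + 4 * wa2 V) ^+ 2.
    have := congr1 (fun z : int => z%:~R : 'F_p) c4.
    by rewrite /= !(rmorphD, rmorphM, rmorphXn, rmorph_nat).
  pose h : 'F_p := wa6 V + wa3 V ^+ 2 / 4 - ((wa1 V ^+ 2 + 4 * wa2 V) / 12) ^+ 3.
  have gF : g%:~R * d%:~R ^+ 6 = n%:~R ^+ 6 * h.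
    have := congr1 (fun z : int => z%:~R : 'F_p) gE.
    rewrite /= !(rmorphD, rmorphB, rmorphM, rmorphXn, rmorph_nat) => e.
    apply: (mulfI (expf_neq0 3 twelve0)); rewrite mulrA e /h /=; field.
    by rewrite twelve0 four0.
  have h0 : h != 0.
    have VW : wdisc V = (wdisc W)%:~R by exact: (@wdisc_map int 'F_p intr W).
    have : wdisc V != 0 by rewrite VW intr_Fp_eq0.
    by apply: contraNneq => h0; rewrite (wdisc_mordell_model two0 three0 c4F) -/h h0 expr0n mulr0 oppr0.
  have nF : n%:~R != 0 :> 'F_p.
    apply/eqP => n0; have dF : d%:~R = 0 :> 'F_p.
      move/eqP: gF; rewrite n0 expr0n mul0r mulf_eq0 (negPf g0) /= expf_eq0 /=.
      by move/eqP.
    move/eqP: n0; move/eqP: dF; rewrite !intr_Fp_eq0 // !dvdzE /= => pd pn.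
    move: nd; rewrite coprimezE => /eqP nd; have : (p %| gcdn `|n| `|d|)%N by rewrite dvdn_gcd pn pd.
    by rewrite nd dvdn1 => /eqP p1; move: p5; rewrite p1.
  have dF : d%:~R != 0 :> 'F_p.
    apply/eqP => dz; move/eqP: gF; rewrite dz expr0n mulr0 eq_sym mulf_eq0 expf_eq0 /=.
    by rewrite (negPf nF) (negPf h0).
  have gh : mordell_sum h = mordell_sum (g%:~R : 'F_p).
    have -> : h = g%:~R * (d%:~R / n%:~R) ^+ 6.
      by apply: (mulfI (expf_neq0 6 nF)); rewrite -gF; field.
    by rewrite (mordell_sum_scale6 _ F2) // mulf_neq0 // invr_eq0.
  rewrite /trace_of_Frobenius (wcard_short F2 three0 c4F) -/h gh cF.
  by move: (mordell_sum _) => S; clear; lia.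
have redE : wreduction p (Weierstrass 0 0 0 0 g) = Weierstrass 0 0 0 0 (g%:~R : 'F_p) by [].
split=> //; exists (Weierstrass 0 0 0 0 g); split; first split.
- exists 1, 0, 0, 0; rewrite oner_eq0 /= !rmorph0; do !split; ring.
- rewrite -intr_Fp_eq0 //.
  have <- := @wdisc_map int 'F_p intr (Weierstrass 0 0 0 0 g).
  exact: wdisc_short_neq0.
rewrite /trace_of_Frobenius redE (wcard_mordell _ F2 three0) gS cF.
by clear; lia.
Qed.

(** * The Hardy-Littlewood conjecture *)

Lemma quad_prime_count_le (R : realType) (a b c : int) (B : nat) :
  (forall p : nat, prime p -> (exists m : nat, (0 < m)%N /\ p%:Z = a * m%:Z ^+ 2 + b * m%:Z + c) ->
     (p <= B)%N) ->
  forall x : R, (quad_prime_count a b c x <= B.+1)%N.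
Proof.
move=> hB x; rewrite /quad_prime_count.
rewrite -big_filter sum1_size -[X in (_ <= X)%N](size_iota 0).
apply: uniq_leq_size; first by rewrite filter_uniq // iota_uniq.
move=> p; rewrite mem_filter mem_iota add0n => /andP[/andP[p_pr /asboolP hp] _] /=.
by rewrite ltnS hB.
Qed.

Lemma ln_div_sqrt_small (R : realType) (K X : R) :
  exists x : R, [/\ X < x, 0 <= ln x / Num.sqrt x & K * (ln x / Num.sqrt x) < 1 / 2].
Proof.
(* With [x = y^4] the quotient is at most 4/y, because [ln y <= y]; hence the bound [8 |K| < y]. *)
pose y : R := `|X| + 8 * `|K| + 2.
have y1 : 1 < y by rewrite /y; have := normr_ge0 X; have := normr_ge0 K; lra.
have y0 : 0 < y by apply: lt_trans y1.
have Xy : X < y by rewrite /y; have := ler_norm X; have := normr_ge0 K; lra.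
have Ky : 8 * `|K| < y by rewrite /y; have := normr_ge0 X; lra.
have yy2 : y <= y ^+ 2 by rewrite ler_eXnr // ltW.
have yy4 : y <= y ^+ 4 by rewrite ler_eXnr // ltW.
exists (y ^+ 4); split; first exact: lt_le_trans yy4.
  by rewrite divr_ge0 ?sqrtr_ge0 // ln_ge0 // (le_trans _ yy4) // ltW.
have -> : Num.sqrt (y ^+ 4) = y ^+ 2.
  by rewrite (exprM y 2 2) sqrtr_sqr ger0_norm // sqr_ge0.
rewrite lnXn // mulrA ltr_pdivrMr ?exprn_gt0 //.
have l0 : 0 <= ln y by rewrite ln_ge0 // ltW.
have l1 : ln y <= y by rewrite ltW // ln_sublinear.
apply: (@le_lt_trans _ _ (`|K| * (4 * y))).
  apply: le_trans (ler_norm _) _; rewrite normrM ler_wpM2l //.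
  by rewrite ger0_norm ?mulrn_wge0 // -[X in X <= _]mulr_natl ler_wpM2l.
rewrite expr2; nra.
Qed.

(** If these primes were bounded, so would be their count, and whatever the constant [C], the
    quotient would drop below 1/2 at arbitrarily large [x], against the limit 1. *)
Lemma Hardy_Littlewood_unbounded (R : realType) (a b c : int) : Hardy_Littlewood R ->
  0 < a -> ~ (exists n : int, b ^+ 2 - 4 * a * c = n ^+ 2) ->
  gcdz a (gcdz b c) = 1 -> ~ ((2 %| a + b)%Z /\ (2 %| c)%Z) ->
  forall B : nat, exists p : nat, [/\ prime p, (B < p)%N &
    exists m : nat, (0 < m)%N /\ p%:Z = a * m%:Z ^+ 2 + b * m%:Z + c].
Proof.
move=> HL a0 D g1 par B; apply: contrapT => no.
have hB (p : nat) : prime p ->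
    (exists m : nat, (0 < m)%N /\ p%:Z = a * m%:Z ^+ 2 + b * m%:Z + c) -> (p <= B)%N.
  by move=> p_pr hp; rewrite leqNgt; apply/negP => Bp; apply: no; exists p.
have := HL a b c a0 D g1 par; set C := HL_constant R a b c.
move=> /cvgrPdist_lt /(_ (1 / 2)) => /(_ _)[|M [_ MP]]; first by lra.
have [x [Mx s0 xK]] := ln_div_sqrt_small (B.+1%:R * `|C^-1|) M.
have := MP x Mx; set N := quad_prime_count _ _ _ _ => h.
have NB : N%:R <= B.+1%:R :> R by rewrite ler_nat quad_prime_count_le.
move: h; have -> : N%:R / (C * (Num.sqrt x / ln x)) = N%:R * C^-1 * (ln x / Num.sqrt x).
  by rewrite invfM invf_div mulrA.
set u := _ * (ln x / _); have u2 : `|u| < 1 / 2.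
  apply: le_lt_trans xK; rewrite /u 2!normrM (ger0_norm s0) ler_wpM2r // ler_wpM2r //.
  by rewrite ger0_norm.
by have := ler_norm u; have := ler_norm (1 - u); lra.
Qed.

(** [eis_norm (M m + k0)] is a quadratic polynomial in [m] of discriminant -3M^2 < 0 whose constant
    term is odd and prime to 3M, so the conjecture applies to it. *)
Lemma anomalous_progression_unbounded (R : realType) (g : int) : Hardy_Littlewood R ->
  g != 0 -> anomalous_progression g ->
  forall B : nat, exists2 p : nat, (B < p)%N & anomalous (mordell g) p.
Proof.
move=> HL g0 [k0 [M [M0 cop kP]]] B.
pose a : int := 3 * M%:Z ^+ 2; pose b : int := 3 * M%:Z * (2 * k0%:Z + 1).
pose c : int := (eis_norm k0)%:Z.
have cE : c = 3 * k0%:Z ^+ 2 + 3 * k0%:Z + 1 by rewrite /c /eis_norm; lia.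
have M2 : 0 < M%:Z ^+ 2 by rewrite exprn_gt0.
have [||||p [p_pr Bp [m [m0 pE]]]] := @Hardy_Littlewood_unbounded R a b c HL _ _ _ _
    (B + 6 * `|g| + 5)%N.
- by rewrite /a mulr_gt0.
- move=> [n nE]; have := sqr_ge0 n; rewrite -nE.
  have -> : b ^+ 2 - 4 * a * c = - (3 * M%:Z ^+ 2) by rewrite /a /b cE; ring.
  by rewrite oppr_ge0 leNgt mulr_gt0.
- have aE : `|a|%N = (3 * M ^ 2)%N by rewrite /a abszM abszX.
  have c3 : coprime 3 (eis_norm k0).
    by rewrite prime_coprime // eis_norm_pred /dvdn -addn1 -modnDml modnMr.
  have : coprime (3 * M ^ 2) (eis_norm k0) by rewrite coprimeMl c3 coprimeXl // coprime_sym.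
  rewrite /gcdz aE => /(coprime_dvdr (dvdn_gcdr `|b| `|c|)) cop'.
  by congr Posz; apply/eqP.
- move=> [_]; rewrite /c dvdzE /= dvdn2 => /negP; apply; exact: odd_eis_norm.
have pN : p = eis_norm (M * m + k0).
  apply/eqP; rewrite -eqz_nat pE; apply/eqP; rewrite /eis_norm /a /b cE; lia.
exists p; first by move: Bp; clear; lia.
have gp : (6 * `|g| < p)%N by move: Bp; clear; lia.
have g1 : (0 < `|g|)%N by rewrite absz_gt0.
apply/anomalous_mordell => //; first by move: Bp; clear; lia.
  by rewrite gtnNdvd //; move: gp; clear; lia.
rewrite pN; rewrite pN in p_pr gp; apply: kP => //.
by rewrite mulnC modnMDl.
Qed.

Lemma finite_shape_bound (g : int) (p : nat) : g != 0 -> finite_shape g ->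
  anomalous (mordell g) p -> (p < 6 * `|g| + 5)%N.
Proof.
move=> g0 shape an; rewrite ltnNge; apply/negP => pg.
have p_pr : prime p by case: an.
have g1 : (0 < `|g|)%N by rewrite absz_gt0.
have p5 : (5 <= p)%N by move: pg; clear; lia.
have pg' : ~~ (p %| `|g|)%N by rewrite gtnNdvd //; move: pg; clear; lia.
have gF : g%:~R != 0 :> 'F_p by rewrite intr_Fp_eq0.
have S1 := (anomalous_mordell p_pr p5 pg').1 an.
have [k kE] := mordell_sum_eqN1_norm p_pr p5 gF S1.
subst p; apply: (shape_mordell_sum p_pr g0 _ shape S1).
by move: pg; clear; lia.
Qed.

Lemma finite_shapeE (g : int) : finite_shape g <->
  exists n : int,
    g = n ^+ 2 \/ g = - 3 * n ^+ 2 \/ g = n ^+ 3 \/ g = 80 * n ^+ 6 \/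
    g = - 2160 * n ^+ 6 \/
    g = - (2 ^+ 4 * 7 ^+ 5) * n ^+ 6 \/
    g = (2 ^+ 4 * 3 ^+ 3 * 7 ^+ 5) * n ^+ 6.
Proof.
have e5 : 2 ^+ 4 * 5 = 80 :> int by [].
have e5' : 2 ^+ 4 * (-3) ^+ 3 * 5 = -2160 :> int by [].
have s5 : prime_star 5 ^+ exceptional_exp 5 = 5 by [].
have s7 : prime_star 7 ^+ exceptional_exp 7 = - 7 ^+ 5 by [].
split.
  case=> [[n [->|->|->]]|[q [e [n [q57 e03 ->]]]]]; exists n; auto.
  case/orP: q57 => /eqP ->; case/orP: e03 => /eqP ->; [rewrite s5|rewrite s5|rewrite s7|rewrite s7].
  - by rewrite expr0 mulr1 e5; do 3!right; left.
  - by rewrite e5'; do 4!right; left.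
  - by do 5!right; left; rewrite expr0 mulr1 mulrN.
  - by do 6!right; ring.
case=> n [->|[->|[->|[->|[->|[->|->]]]]]].
- by left; exists n; apply: Or31.
- by left; exists n; apply: Or32.
- by left; exists n; apply: Or33.
- by right; exists 5%N, 0%N, n; split; [by []|by []|]; rewrite s5 expr0 mulr1 e5.
- by right; exists 5%N, 3%N, n; split; [by []|by []|]; rewrite s5 e5'.
- by right; exists 7%N, 0%N, n; split; [by []|by []|]; rewrite s7 expr0 mulr1 mulrN.
- by right; exists 7%N, 3%N, n; split; [by []|by []|]; rewrite s7; ring.
Qed.

Local Open Scope classical_set_scope.

(* 268912 = 2^4 * 7^5 and 7260624 = 2^4 * 3^3 * 7^5: unary decimal literals of
   this size overflow the parser. *)
Theorem theorem7p7 (R : realType) (g : int) (g_neq0 : g != 0)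
    (HL : Hardy_Littlewood R) :
  finite_set [set p : nat | anomalous (mordell g) p] <->
  exists n : int,
    g = n ^+ 2 \/ g = - 3 * n ^+ 2 \/ g = n ^+ 3 \/ g = 80 * n ^+ 6 \/
    g = - 2160 * n ^+ 6 \/
    g = - (2 ^+ 4 * 7 ^+ 5) * n ^+ 6 \/
    g = (2 ^+ 4 * 3 ^+ 3 * 7 ^+ 5) * n ^+ 6.
Proof.
rewrite -finite_shapeE; split=> [/finite_seqP[s sE]|shape]; last first.
  apply: (sub_finite_set _ (finite_II (6 * `|g| + 5))) => p.
  exact: finite_shape_bound.
have [prog|//] := progression_or_shape g_neq0.
(* The sum of the finite list bounds each of its members. *)
have [p sp ap] := anomalous_progression_unbounded HL g_neq0 prog (sumn s).
have : [set p : nat | anomalous (mordell g) p] p by [].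
rewrite sE /= => ps; exfalso; move: sp; rewrite ltnNge => /negP; apply.
by rewrite sumnE (big_rem p) //= leq_addr.
Qed.
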